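(* In the word generalized random energy model with external field of intensity $h\ge0$, finite set of words $S$, continuous function $f:\mathbb{R}^S\to\mathbb{R}$, and driving distributions as described in the context, almost surely, for $\beta>0$, $$\lim_{N\to\infty}\frac1N\log Z_N(\beta,h)=\log2-\inf_{(x_S,y_I)\in\mathcal{D}_{\mathcal{J}}}\left\{\beta f(x_S)+\beta h\sum_{i=1}^ny_i+\mathcal{J}(x_S,y_I)\right\},$$ where, for $x_S=(x_s)_{s\in S}\in\mathbb{R}^S$ and $y_I=(y_1,\dots,y_n)\in\mathbb{R}^n$, $$\mathcal{D}_{\mathcal{J}}=\left\{(x_S,y_I):\ \sum_{t\in\mathcal{S}_A}\mathcal{I}_t(x_t)+\sum_{i\in[A]}p_i\,\mathcal{I}_0\!\left(\frac{y_i}{p_i}\right)\le\sum_{i\in[A]}p_i\log2\ \text{ for all }A\subseteq I\right\}$$ and $\mathcal{J}(x_S,y_I)=\sum_{s\in S}\mathcal{I}_s(x_s)+\sum_{i=1}^np_i\,\mathcal{I}_0\!\left(\frac{y_i}{p_i}\right)$ for $(x_S,y_I)\in\mathcal{D}_{\mathcal{J}}$.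
   Context: Let $I=\{\varsigma_1,\dots,\varsigma_n\}$ be a set of $n\ge1$ symbols and $S$ a finite set of words formed from these symbols (symbols may be repeated in a word) such that every symbol appears in at least one word of $S$. A word is also regarded as the subset of $I$ consisting of its symbols. For $A\subseteq I$: $[A]=\{i:\varsigma_i\in A\}$ and $\mathcal{S}_A=\{s\in S:s\subseteq A\}$. For $N\ge n$ let $k(1,N),\dots,k(n,N)\ge1$ be integers with sum $N$ and $\frac{k(i,N)}N\to p_i>0$. Write $\sigma=(\sigma_1,\dots,\sigma_N)\in\{+1,-1\}^N$ as $\langle\sigma^1,\dots,\sigma^n\rangle$, where $\sigma^1$ consists of the first $k(1,N)$ entries, $\sigma^2$ of the next $k(2,N)$ entries, etc. For $s=\varsigma_{i_1}\cdots\varsigma_{i_l}\in S$ put $\sigma(s)=\langle\sigma^{i_1},\dots,\sigma^{i_l}\rangle$. For each $s\in S$ let $\lambda^s$ be a probability on $\mathbb{R}$ such that, with $X\sim\lambda^s$ and $\Lambda_s(\rho)=\log Ee^{\rho X}$, $0$ is an interior point of $\{\rho:\Lambda_s(\rho)<\infty\}$; let $\lambda_N^s$ be the law of $\frac1N(X_1+\cdots+X_N)$ with $X_1,X_2,\dots$ i.i.d. with law $\lambda^s$, and let $\mathcal{I}_s(x)=\sup_{\rho\in\mathbb{R}}\{\rho x-\Lambda_s(\rho)\}$. For each $N$ let $\xi(s,\sigma(s))$, one for each $s\in S$ and each possible value of $\sigma(s)$, be independent random variables, $\xi(s,\sigma(s))$ having law $\lambda^s_N$ (all $N$ on one probability space),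 and put $\xi(\sigma)=(\xi(s,\sigma(s)))_{s\in S}\in\mathbb{R}^S$. Hamiltonian: $H_N(\sigma,h)=Nf(\xi(\sigma))+h\sum_{i=1}^N\sigma_i$. Partition function: $Z_N(\beta,h)=\sum_\sigma e^{-\beta H_N(\sigma,h)}$. $\mathcal{I}_0(y)=\frac{1+y}2\log(1+y)+\frac{1-y}2\log(1-y)$ for $-1<y<1$, $\mathcal{I}_0(\pm1)=\log2$, $\mathcal{I}_0(y)=\infty$ for $|y|>1$. *)

(* Defs.v *)
From HB Require Import structures.
From mathcomp Require Export all_boot all_order all_algebra finmap.
From mathcomp Require Export all_classical all_reals all_analysis.
Set Implicit Arguments.
Unset Strict Implicit.
Unset Printing Implicit Defensive.
Import Order.TTheory GRing.Theory Num.Theory.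
Import numFieldNormedType.Exports.
Local Open Scope classical_set_scope.
Local Open Scope ring_scope.

Definition mutually_independent d (T : measurableType d) (R : realType)
    (P : probability T R) (I : choiceType) (D : set I)
    (X : I -> {RV P >-> R}) : Prop :=
  forall (J : {fset I}) (B : I -> set R),
    [set` J] `<=` D -> (forall i, measurable (B i)) ->
    P (\bigcap_(i in [set` J]) (X i @^-1` B i)) =
    (\prod_(i <- J) P (X i @^-1` B i))%E.

Section Rate.
Variable R : realType.

(* [mu] is the law of (X_1 + ... + X_N) / N for i.i.d. X_i of law [lam].
   Laws are compared on measurable sets only: the value of a measure on a
   non-measurable set carries no meaning. *)
Definition is_sample_mean_law (lam : probability R R) (N : nat)
    (mu : set R -> \bar R) : Prop :=
  exists d (T : measurableType d) (Q : probability T R)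
         (X : 'I_N -> {RV Q >-> R}),
    [/\ mutually_independent [set: 'I_N] X,
        forall i (A : set R), measurable A -> distribution Q (X i) A = lam A &
        forall A : set R, measurable A ->
          mu A = Q [set w | A (N%:R^-1 * \sum_(i < N) X i w)]].

Definition log_mgf (lam : probability R R) (rho : R) : \bar R :=
  lne ('M_lam (fun x : R => x) rho).

Definition rate (lam : probability R R) (x : R) : \bar R :=
  ereal_sup [set ((rho * x)%:E - log_mgf lam rho)%E | rho in [set: R]].

Definition rate0 (y : R) : \bar R :=
  if `|y| < 1 then
    ((1 + y) / 2 * ln (1 + y) + (1 - y) / 2 * ln (1 - y))%:E
  else if `|y| == 1 then (ln 2)%:E
  else +oo%E.

End Rate.

Section Model.
Variables (R : realType) (n : nat) (S : {fset seq 'I_n}).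

Definition symbols (s : seq 'I_n) : {set 'I_n} := [set i in s]%SET.

(* A configuration is an [N]-tuple of booleans, [true] standing for +1 and
   [false] for -1. *)
Definition spin (b : bool) : R := if b then 1 else -1.

Definition block (k : 'I_n -> nat) (sigma : seq bool) (i : 'I_n) : seq bool :=
  nth [::] (reshape (codom k) sigma) i.

(* The successive blocks are kept as a sequence instead of being concatenated;
   as block [i] has the prescribed length [k i], this is the same data. *)
Definition word_spins (k : 'I_n -> nat) (sigma : seq bool) (s : seq 'I_n) :
    seq (seq bool) :=
  [seq block k sigma i | i <- s].

Definition possible_values (k : 'I_n -> nat) (N : nat) :
    set (S * seq (seq bool)) :=
  [set sw | exists sigma : N.-tuple bool,
     sw.2 = word_spins k sigma (val sw.1)].

Definition energies (k : 'I_n -> nat) (xi : S -> seq (seq bool) -> R)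
    (sigma : seq bool) : S -> R :=
  fun s => xi s (word_spins k sigma (val s)).

Definition hamiltonian (f : (S -> R) -> R) (k : 'I_n -> nat)
    (xi : S -> seq (seq bool) -> R) (h : R) (N : nat) (sigma : N.-tuple bool) :
    R :=
  N%:R * f (energies k xi sigma) + h * \sum_(i < N) spin (tnth sigma i).

Definition partition_function (f : (S -> R) -> R) (k : 'I_n -> nat)
    (xi : S -> seq (seq bool) -> R) (h beta : R) (N : nat) : R :=
  \sum_(sigma : N.-tuple bool) expR (- beta * hamiltonian f k xi h sigma).

Variables (p : 'I_n -> R) (lam : S -> probability R R).

Definition rate_sum (x : S -> R) (y : 'I_n -> R) : \bar R :=
  (\sum_(s : S) rate (lam s) (x s) +
   \sum_(i < n) (p i)%:E * rate0 (y i / p i))%E.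

Definition rate_domain : set ((S -> R) * ('I_n -> R)) :=
  [set xy | forall A : {set 'I_n},
    (\sum_(t : S | symbols (val t) \subset A) rate (lam t) (xy.1 t) +
     \sum_(i in A) (p i)%:E * rate0 (xy.2 i / p i) <=
     (\sum_(i in A) p i * ln 2)%:E)%E].

End Model.

Arguments possible_values {n} S k N.

(* Main.v *)
Require Import Defs.
From mathcomp Require Import all_boot all_order all_algebra finmap.
From mathcomp Require Import all_classical all_reals all_analysis.
From mathcomp Require Import measurable_realfun measurable_fun_approximation.
From mathcomp Require Import simple_functions ring lra.
Set Implicit Arguments.
Unset Strict Implicit.
Unset Printing Implicit Defensive.
Import Order.TTheory GRing.Theory Num.Theory.
Import numFieldNormedType.Exports.
Local Open Scope classical_set_scope.
Local Open Scope ring_scope.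

(** Each configuration t determines a point zeta t of R^(S + I): its energies
    xi(s, t(s)) and the block magnetisations (1/N) sum of the spins of block
    i. In these coordinates Z_N is the sum over t of exp(N energy(zeta t))
    with energy continuous, so the theorem is Laplace's principle once it is
    known that, almost surely, about exp(N (log 2 - J(z))) configurations have
    zeta t close to z when z satisfies the constraints of the domain, and none
    has when z violates one of them. Each coordinate j has a convex function
    L_j vanishing at 0 (a logarithmic moment generating function) whose
    Legendre transform is its rate: the log-mgf of lambda^s with rate I_s, and
    p_i log cosh with rate p_i I_0(y / p_i).

    Upper bound. For fixed slopes tau, the expectation of the sum over t of
    exp(N <tau, zeta t>) factorises, over the words of one configuration and
    over the blocks, into exp(N (sum_j L_j(tau_j) + log 2 + o(1))). Markov's
    inequality and Borel-Cantelli turn this into an almost sure bound,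
    simultaneously for all rational slopes (exp_moment_as), and rational
    slopes suffice to compute the rates. The constraint of a set A of blocks
    follows from the same bound with slopes vanishing outside A: a
    configuration with too large a value <tau, zeta t> would share it with all
    the configurations that agree with it on the blocks of A, since the words
    inside A only see these blocks, and together they would exceed the bound
    (zeta_linear_upper). What remains is deterministic (upper_bound): the
    points zeta t stay in a compact set, every point of it has a neighbourhood
    in which the sum is controlled, and finitely many of these neighbourhoods
    suffice.

    Lower bound. A point z of the domain is first moved to (1 - e) z + e z0,
    where z0 is made of the means of the lambda^s and of zero magnetisations;
    the rates vanish at z0, so by convexity they are multiplied by at most 1 -
    e and all the constraints with a nonempty A become strict (exists_cell).
    At the moved point Cramer's lower bound holds (sample_lower for the words,
    block_count for the blocks). The number of configurations in a small cell
    around it is then estimated by its second moment (second_moment): pairs of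
    configurations are sorted by the set B of blocks on which they agree; the
    words inside B have common energies, all the other energies are
    independent, and the strict constraint of B says exactly that these pairs
    contribute exponentially less than the square of the mean. Borel-Cantelli
    again gives an almost sure bound, for all the countably many cells with
    rational data (cell_count_as). The empty word, if it belongs to S, has the
    same energy in all configurations and is kept out of the second moment;
    the constraint of the empty A forces its coordinate to be the mean, and
    the upper bound shows that its energy converges to it (empty_word_near).

    Cramer's lower bound is obtained for laws with exponential moments near 0
    only, without differentiating moment generating functions: the law is
    truncated, a slope rho is chosen at which the truncated moment generating
    function psi of X - x0 is nearly minimal, and psi(rho + t) + psi(rho - t)
    <= (2 + C t^2) psi(rho) shows that the deviations from x0 under the law
    tilted by rho are exponentially unlikely (tilt_lower, cramer_lower). *)

(** * Measurable sets and integrals of real functions *)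

Section MeasurableSets.
Context d (T : measurableType d) (R : realType).
Implicit Types (f : T -> R) (c : R).

Lemma measurable_lt_cst f c : measurable_fun [set: T] f -> measurable [set w | f w < c].
Proof.
move=> mf; rewrite (_ : [set w | _] = [set: T] `&` f @^-1` `]-oo, c[%classic); first exact: mf.
by rewrite setTI; apply/seteqP; split => w /=; rewrite in_itv.
Qed.

Lemma measurable_gt_cst f c : measurable_fun [set: T] f -> measurable [set w | c < f w].
Proof.
move=> mf; rewrite (_ : [set w | _] = [set: T] `&` f @^-1` `]c, +oo[%classic); first exact: mf.
by rewrite setTI; apply/seteqP; split => w /=; rewrite in_itv/= andbT.
Qed.

Lemma measurable_ge_cst f c : measurable_fun [set: T] f -> measurable [set w | c <= f w].
Proof.
move=> mf; rewrite (_ : [set w | _] = [set: T] `&` f @^-1` `[c, +oo[%classic); first exact: mf.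
by rewrite setTI; apply/seteqP; split => w /=; rewrite in_itv/= andbT.
Qed.

End MeasurableSets.

Lemma measurable_window (R : realType) (x r : R) : measurable [set v : R | (`|v - x| < r)%R].
Proof.
rewrite (_ : [set v | _] = `]x - r, x + r[%classic)//.
by apply/seteqP; split => v /=; rewrite in_itv/= ltr_distl.
Qed.

Section RealIntegrals.
Context d (T : measurableType d) (R : realType) (mu : {measure set T -> \bar R}).
Implicit Types f g : T -> R.

Lemma le_integral_EFin f g : measurable_fun [set: T] f -> measurable_fun [set: T] g ->
  (forall x, 0 <= f x) -> (forall x, f x <= g x) ->
  (\int[mu]_x (f x)%:E <= \int[mu]_x (g x)%:E)%E.
Proof.
move=> mf mg f0 fg; apply: ge0_le_integral.
- exact: measurableT.
- by move=> x _; rewrite lee_fin.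
- exact/measurable_EFinP.
- exact/measurable_EFinP.
- by move=> x _; rewrite lee_fin.
Qed.

Lemma integralZl_EFin k f : 0 <= k -> measurable_fun [set: T] f -> (forall x, 0 <= f x) ->
  (\int[mu]_x (k * f x)%:E = k%:E * \int[mu]_x (f x)%:E)%E.
Proof.
move=> k0 mf f0; under eq_integral do rewrite EFinM.
apply: ge0_integralZl.
- exact: measurableT.
- exact/measurable_EFinP.
- by move=> x _; rewrite lee_fin.
- by rewrite lee_fin.
Qed.

Lemma ge0_integralD_EFin f g : measurable_fun [set: T] f -> measurable_fun [set: T] g ->
  (forall x, 0 <= f x) -> (forall x, 0 <= g x) ->
  (\int[mu]_x (f x + g x)%:E = \int[mu]_x (f x)%:E + \int[mu]_x (g x)%:E)%E.
Proof.
move=> mf mg f0 g0; under eq_integral do rewrite EFinD.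
apply: ge0_integralD.
- exact: measurableT.
- by move=> x _; rewrite lee_fin.
- exact/measurable_EFinP.
- by move=> x _; rewrite lee_fin.
- exact/measurable_EFinP.
Qed.

Lemma integral_sum_EFin (I : Type) (r : seq I) (Q : pred I) (f : I -> T -> R) :
  (forall i, measurable_fun [set: T] (f i)) -> (forall i w, 0 <= f i w) ->
  (\int[mu]_w (\sum_(i <- r | Q i) f i w)%:E = \sum_(i <- r | Q i) \int[mu]_w (f i w)%:E)%E.
Proof.
move=> mf f0; under eq_integral do rewrite -sumEFin -big_filter.
rewrite -[RHS]big_filter ge0_integral_sum//.
- by move=> i; exact/measurable_EFinP.
- by move=> i w _; rewrite lee_fin.
Qed.

End RealIntegrals.

(** * Products of independent variables and almost sure events *)

Section Independence.
Import HBNNSimple.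
Context d (T : measurableType d) (R : realType) (P : probability T R).
Local Open Scope ereal_scope.

(** Both sides are additive in g and continuous along increasing limits, so
    the case of indicators gives that of simple functions and then the general
    one. W stands for a product of other independent variables. *)
Lemma integral_indicM (X : {RV P >-> R}) (W : T -> R) (K : \bar R) :
  measurable_fun [set: T] W -> (forall w, 0 <= W w)%R -> K \is a fin_num ->
  (forall B : set R, measurable B ->
     \int[P]_w ((\1_B (X w))%:E * (W w)%:E) = P (X @^-1` B) * K) ->
  forall g : R -> R, measurable_fun [set: R] g -> (forall x, 0 <= g x)%R ->
  \int[P]_w ((g (X w))%:E * (W w)%:E) = (\int[P]_w (g (X w))%:E) * K.
Proof.
move=> mW W0 Kfin HB g mg g0.
have mEW : measurable_fun [set: T] (EFin \o W) by exact/measurable_EFinP.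
have mEg : measurable_fun [set: R] (EFin \o g : R -> \bar R) by exact/measurable_EFinP.
pose gn' := nnsfun_approx measurableT mEg.
have cg x : EFin \o gn'^~ x @ \oo --> (g x)%:E.
  by apply: (cvg_nnsfun_approx measurableT mEg) => // y _; rewrite lee_fin.
have ndg x : {homo (fun n => (gn' n x)%:E) : n m / (n <= m)%N >-> n <= m}.
  by move=> n m nm; rewrite lee_fin; apply/lefP/nd_nnsfun_approx.
have mgX n : measurable_fun [set: T] (fun w => (gn' n (X w))%:E).
  by apply/measurable_EFinP; apply: measurableT_comp.
have simple n : \int[P]_w ((gn' n (X w))%:E * (W w)%:E)
    = (\int[P]_w (gn' n (X w))%:E) * K.
  have E w : (gn' n (X w))%:E
      = \sum_(y <- fset_set (range (gn' n))) (y * \1_(gn' n @^-1` [set y]) (X w))%:E.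
    by rewrite {1}fimfunE fsbig_finite// sumEFin.
  have yge0 y : y \in fset_set (range (gn' n)) -> (0 <= y)%R.
    by rewrite in_fset_set// inE => -[x _ <-]; exact: fun_ge0.
  have yi0 y w : 0 <= (y * \1_(gn' n @^-1` [set y]) (X w))%:E.
    exact: nnfun_muleindic_ge0.
  have mind y : measurable_fun [set: T]
      (fun w => (\1_(gn' n @^-1` [set y]) (X w) : R)%:E).
    by apply/measurable_EFinP; apply: measurableT_comp.
  have mind' y : measurable_fun [set: T]
      (fun w => (y * \1_(gn' n @^-1` [set y]) (X w) : R)%:E).
    by under eq_fun do rewrite EFinM; apply: measurable_funeM.
  under eq_integral do rewrite E ge0_sume_distrl//.
  rewrite ge0_integral_sum//; last 2 first.
    by move=> y; apply: emeasurable_funM.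
    by move=> y w _; apply: mule_ge0 => //; rewrite lee_fin.
  under [X in _ = X * _]eq_integral do rewrite E.
  rewrite ge0_integral_sum// ge0_sume_distrl; last by move=> y _; apply: integral_ge0.
  apply: eq_big_seq => y /yge0 y0.
  under eq_integral do rewrite EFinM -muleA.
  under [in RHS]eq_integral do rewrite EFinM.
  rewrite ge0_integralZl// [LHS]ge0_integralZl//; last 2 first.
    by apply: emeasurable_funM.
    by move=> w _; apply: mule_ge0; rewrite lee_fin.
  rewrite HB// -muleA; congr (_ * (_ * _)).
  rewrite -[X in P X]setIT -integral_indic//.
  exact: (measurable_sfunP X (measurable_sfunP (gn' n) (measurable_set1 y))).
have lim1 : \int[P]_w ((gn' n (X w))%:E * (W w)%:E) @[n --> \oo]
    --> \int[P]_w ((g (X w))%:E * (W w)%:E).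
  have : \int[P]_w ((gn' n (X w))%:E * (W w)%:E) @[n --> \oo]
      --> \int[P]_w limn (fun n => (gn' n (X w))%:E * (W w)%:E).
    apply: (@cvg_monotone_convergence _ _ _ P _ measurableT
      (fun n w => (gn' n (X w))%:E * (W w)%:E)) => //.
    - by move=> n; apply: emeasurable_funM.
    - by move=> n w _; apply: mule_ge0; rewrite lee_fin.
    - move=> w _ n m nm; apply: lee_wpmul2r; first by rewrite lee_fin.
      by move: (ndg (X w) _ _ nm).
  congr (_ --> _); apply: eq_integral => w _; apply/cvg_lim => //.
  by apply: cvgeZr => //; exact: cg.
have lim2 : \int[P]_w (gn' n (X w))%:E @[n --> \oo] --> \int[P]_w (g (X w))%:E.
  have : \int[P]_w (gn' n (X w))%:E @[n --> \oo]
      --> \int[P]_w limn (fun n => (gn' n (X w))%:E).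
    apply: (@cvg_monotone_convergence _ _ _ P _ measurableT
      (fun n w => (gn' n (X w))%:E)) => //.
    - by move=> n w _; rewrite lee_fin.
  by congr (_ --> _); apply: eq_integral => w _; apply/cvg_lim => //; exact: cg.
have lim3 : \int[P]_w ((gn' n (X w))%:E * (W w)%:E) @[n --> \oo]
    --> (\int[P]_w (g (X w))%:E) * K.
  by under eq_fun do rewrite simple; exact: cvgeZr.
by rewrite -(cvg_lim _ lim1)// (cvg_lim _ lim3).
Qed.

(** Independence speaks of indicators only; they are replaced by functions one
    index at a time. The general term, with functions on s1 and indicators on
    s2, is what makes the induction on s1 work: the index being treated is
    first moved to s2. *)
Lemma integral_prod_indep (I : choiceType) (D : set I)
    (X : I -> {RV P >-> R}) (g : I -> R -> R) (s1 s2 : seq I) (B : I -> set R) :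
  mutually_independent D X ->
  (forall i, measurable_fun [set: R] (g i)) -> (forall i x, 0 <= g i x)%R ->
  (forall i, i \in s1 -> \int[P]_w (g i (X i w))%:E < +oo) ->
  (forall i, measurable (B i)) ->
  uniq (s1 ++ s2) -> (forall i, i \in s1 ++ s2 -> D i) ->
  \int[P]_w (\prod_(i <- s1) g i (X i w) * \prod_(i <- s2) \1_(B i) (X i w))%:E
  = \prod_(i <- s1) (\int[P]_w (g i (X i w))%:E) *
    \prod_(i <- s2) P (X i @^-1` B i).
Proof.
move=> indep mg g0 gfin; elim: s1 s2 B gfin => [|i s1 IH] s2 B gfin mB us sD.
  rewrite big_nil mul1e; under eq_integral do rewrite big_nil mul1r.
  pose J := [fset x in s2]%fset.
  have JE : perm_eq J s2.
    by apply: uniq_perm => // x; rewrite in_fset.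
  have JD : [set` J] `<=` D by move=> x /=; rewrite in_fset; exact: sD.
  have := indep J B JD mB; rewrite (perm_big _ JE) => <-.
  rewrite -[X in P X]setIT -integral_indic//; last first.
    by apply: fin_bigcap_measurable => // j _; exact: measurable_sfunP.
  apply: eq_integral => w _; congr EFin; rewrite -(perm_big _ JE)/= indicE.
  have [Jw|nJw] := boolP (w \in _).
    move: Jw; rewrite inE => Jw.
    by rewrite big_seq big1// => j jJ; rewrite indicE mem_set//; exact: Jw.
  have : exists2 j, j \in J & ~ B j (X j w).
    apply: contrapT => /forall2NP h; move/negP: nJw; apply; rewrite inE => j/= jJ.
    by have [//|/contrapT] := h j.
  move=> [j jJ Bj]; rewrite (big_rem j)//= indicE memNset ?mul0r//.
rewrite big_cons -muleA; under eq_integral do rewrite big_cons -mulrA EFinM.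
apply: (@integral_indicM (X i) (fun w => \prod_(j <- s1) g j (X j w) *
    \prod_(j <- s2) \1_(B j) (X j w))%R) => //.
- apply: measurable_funM; apply: measurable_prod => j _ //.
    exact: measurableT_comp.
  exact: measurableT_comp.
- by move=> w; rewrite mulr_ge0// prodr_ge0.
- apply: fin_numM; rewrite big_seq; apply: prode_fin_num => j js1.
    rewrite ge0_fin_numE; last by apply: integral_ge0 => w _; rewrite lee_fin.
    by apply: gfin; rewrite inE js1 orbT.
  by apply: fin_num_measure; exact: measurable_sfunP.
move=> B0 mB0.
have [iNs1 iNs2 us'] : [/\ i \notin s1, i \notin s2 & uniq (s1 ++ s2)].
  by move: us; rewrite /= mem_cat negb_or => /andP[/andP[]].
have E (V : Type) (idx : V) op (F : I -> set R -> V) :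
    \big[op/idx]_(j <- s2) F j (if j == i then B0 else B j) =
    \big[op/idx]_(j <- s2) F j (B j).
  rewrite big_seq_cond [RHS]big_seq_cond; apply: eq_bigr => j /andP[js2 _].
  by case: eqP => // ji; move: js2; rewrite ji (negbTE iNs2).
have := IH (i :: s2) (fun j => if j == i then B0 else B j).
rewrite big_cons eqxx (E _ _ _ (fun j b => P (X j @^-1` b))) [RHS]muleCA => <-.
- apply: eq_integral => w _.
  rewrite -EFinM big_cons eqxx (E _ _ _ (fun j b => \1_b (X j w)))%R.
  by rewrite mulrCA.
- by move=> j js1; apply: gfin; rewrite inE js1 orbT.
- by move=> j; case: ifP.
- by rewrite -[i :: s2]cat1s uniq_catCA.
- by move=> j; rewrite mem_cat inE orbCA -mem_cat => h; apply: sD; rewrite inE.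
Qed.
End Independence.

Lemma integral_prod (R : realType) d (T : measurableType d) (P : probability T R)
    (I : choiceType) (D : set I) (X : I -> {RV P >-> R}) (g : I -> R -> R)
    (s : seq I) :
  mutually_independent D X ->
  (forall i, measurable_fun [set: R] (g i)) -> (forall i x, 0 <= g i x) ->
  (forall i, i \in s -> \int[P]_w (g i (X i w))%:E < +oo)%E ->
  uniq s -> (forall i, i \in s -> D i) ->
  (\int[P]_w (\prod_(i <- s) g i (X i w))%:E
   = \prod_(i <- s) (\int[P]_w (g i (X i w))%:E))%E.
Proof.
move=> indep mg g0 gfin us sD.
have := @integral_prod_indep _ _ _ P I D X g s [::] (fun=> setT) indep mg g0 gfin
  (fun=> measurableT).
rewrite cats0 big_nil mule1 => <- //.
by apply: eq_integral => w _; rewrite big_nil mulr1.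
Qed.

(** The form in which all almost sure statements are obtained: the exceptional
    events are exponentially small from some rank on. *)
Lemma borel_cantelli_geometric (R : realType) d (T : measurableType d)
    (P : probability T R) (E : nat -> set T) (C r : R) (n0 : nat) :
  (forall n, measurable (E n)) -> 0 <= C -> 0 <= r < 1 ->
  (forall n, (n0 <= n)%N -> P (E n) <= (C * r ^+ n)%:E)%E ->
  {ae P, forall w, \forall n \near \oo, ~ E n w}.
Proof.
move=> mE C0 /andP[r0 r1] PE.
(* The series of probabilities has to converge from its first term, hence the
   first events are replaced by the empty set. *)
pose F n := if (n < n0)%N then set0 else E n.
have mF n : measurable (F n) by rewrite /F; case: ifP.
have PF n : (P (F n) <= (C * r ^+ n)%:E)%E.
  rewrite /F; case: ltnP => // [_|]; last exact: PE.
  by rewrite measure0 lee_fin mulr_ge0// exprn_ge0.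
have lim0 : P (lim_sup_set F) = 0%E.
  apply: lim_sup_set_cvg0 => //.
  apply: (@le_lt_trans _ _ (C * (1 - r)^-1)%:E); last exact: ltry.
  apply: lime_le; first exact: is_cvg_nneseries.
  apply: nearW => n.
  apply: (@le_trans _ _ (\sum_(0 <= i < n) (C * r ^+ i)%:E)%E).
    by apply: lee_sum => i _; exact: PF.
  rewrite sumEFin lee_fin -mulr_sumr ler_wpM2l//.
  have /(congr1 (fun f => f n)) := @geometric_seriesE R 1 r (negbT (lt_eqF r1)).
  rewrite /series /geometric /= => h.
  under eq_bigr do rewrite -[_ ^+ _]mul1r.
  rewrite h mul1r; apply: ler_piMl; first by rewrite invr_ge0 subr_ge0 ltW.
  by rewrite gerBl exprn_ge0.
exists (lim_sup_set F); split => //.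
  by apply: bigcap_measurable => // n _; apply: bigcup_measurable.
move=> w /= nE n _; apply: contrapT => h; apply: nE.
exists (maxn n n0) => // m /=; rewrite geq_max => /andP[nm n0m] Em.
by apply: h; exists m => //; rewrite /F ltnNge n0m.
Qed.

Lemma ae_forall_countable (R : realType) d (T : measurableType d)
    (P : probability T R) (I : countType) (Q : I -> T -> Prop) :
  (forall i, {ae P, forall w, Q i w}) -> {ae P, forall w, forall i, Q i w}.
Proof.
move=> h.
have : {ae P, forall w, forall n : nat,
    (fun n w => if choice.unpickle n is Some i then Q i w else True) n w}.
  apply: ae_foralln => n; case: (choice.unpickle n) => [i|]; first exact: h.
  exact: aeW.
apply: filterS => w /= H i; have := H (choice.pickle i).
by rewrite choice.pickleK.
Qed.

(** * Exponential inequalities and tilting *)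

Section Elementary.
Variable R : realType.
Implicit Types (u a t : R).

(** For |u| <= 1/2 this follows from e^u <= 1 / (1 - u); the constant 4 is
    what makes 4 u^2 at least 1 for larger |u|. *)
Lemma expR_le_quadratic u : expR u <= 1 + u + 4 * u ^+ 2 * expR `|u|.
Proof.
have e1 : 1 <= expR `|u| by rewrite -expR0 ler_expR.
have u2 : 0 <= u ^+ 2 by exact: sqr_ge0.
have [u12|u12] := leP u (2^-1).
  have [um|um] := leP (- 2^-1) u.
    have := expR_ge1Dx (- u); rewrite expRN => h.
    have u1 : 0 < 1 - u by lra.
    have eu : expR u * (1 - u) <= 1.
      by rewrite mulrC -ler_pdivlMr ?expR_gt0// mul1r.
    have : expR u <= 1 + u + 4 * u ^+ 2.
      rewrite -(ler_pM2r u1); apply: (le_trans eu).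
      have : 0 <= u ^+ 2 * (2^-1 - u) by rewrite mulr_ge0// subr_ge0.
      by nra.
    by move=> /le_trans; apply; rewrite lerD2l ler_peMr// mulr_ge0.
  have : expR u <= 1 by rewrite -expR0 ler_expR; lra.
  nra.
have -> : `|u| = u by rewrite ger0_norm; lra.
have u4 : 1 <= 4 * u ^+ 2 by nra.
have := ler_peMl (expR_ge0 u) u4; lra.
Qed.

(** The linear terms of e^(tu) and e^(-tu) cancel, which leaves a correction
    of order t^2. *)
Lemma expR_cosh_le (b u t : R) : `|u| <= b -> 0 <= t <= 1 ->
  expR (t * u) + expR (- (t * u)) <= 2 + (8 * b ^+ 2 * expR b) * t ^+ 2.
Proof.
move=> ub /andP[t0 t1].
have h1 := expR_le_quadratic (t * u); have h2 := expR_le_quadratic (- (t * u)).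
have tub : `|t * u| <= b.
  by rewrite normrM ger0_norm// (le_trans _ ub)// ler_piMl.
have eb : expR `|t * u| <= expR b by rewrite ler_expR.
have b0 : 0 <= b by exact: le_trans ub.
have u2 : u ^+ 2 <= b ^+ 2 by rewrite -real_normK ?num_real// lerXn2r ?nnegrE.
have h : (t * u) ^+ 2 * expR `|t * u| <= t ^+ 2 * b ^+ 2 * expR b.
  apply: ler_pM => //; first exact: sqr_ge0.
  by rewrite exprMn ler_wpM2l// sqr_ge0.
rewrite normrN sqrrN in h2; lra.
Qed.

(** The tangent to the exponential at th * u lies below its values at u and at
    0; th and 1 - th weigh these two values. *)
Lemma expR_convex (th u : R) : 0 <= th <= 1 -> expR (th * u) <= th * expR u + (1 - th).
Proof.
move=> /andP[th0 th1].
have h1 := expR_ge1Dx (u - th * u); have h2 := expR_ge1Dx (- (th * u)).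
have e0 := expR_gt0 (th * u).
have E1 : expR u = expR (th * u) * expR (u - th * u) by rewrite -expRD; congr expR; ring.
have E2 : 1 = expR (th * u) * expR (- (th * u)) by rewrite -expRD subrr expR0.
rewrite E1 [X in _ + (X - _)]E2.
suff : 1 <= th * expR (u - th * u) + (1 - th) * expR (- (th * u)).
  move=> h.
  have : expR (th * u) * 1 <= expR (th * u) * (th * expR (u - th * u) + (1 - th) * expR (- (th * u))).
    by rewrite ler_pM2l.
  rewrite mulr1 => /le_trans; apply.
  rewrite mulrDr; rewrite -E2.
  have -> : expR (th * u) * ((1 - th) * expR (- (th * u))) = 1 - th.
    by rewrite mulrCA -E2 mulr1.
  lra.
nra.
Qed.

(** Tilting, pointwise: outside the window |T| < D one of the slopes rho + t
    and rho - t gains a factor e^(tD), and inside it the exponential is at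
    most e^(|rho| D). T will be the centred sum of N variables. *)
Lemma expR_window_le (rho t T D : R) : 0 <= t ->
  expR (rho * T) <= expR (`|rho| * D) * (`|T| < D)%R%:R
    + expR (- (t * D)) * (expR ((rho + t) * T) + expR ((rho - t) * T)).
Proof.
move=> t0; have [TD|DT] := ltP `|T| D.
  rewrite mulr1 -[leLHS]addr0 lerD ?mulr_ge0 ?addr_ge0 ?expR_ge0// ler_expR.
  by rewrite (le_trans (ler_norm _))// normrM ler_wpM2l// ltW.
rewrite mulr0 add0r mulrDr -!expRD.
have [T0|T0] := leP 0 T.
  rewrite ger0_norm// in DT.
  by rewrite -[leLHS]addr0 lerD ?expR_ge0// ler_expR; nra.
rewrite ltr0_norm// in DT.
by rewrite -[leLHS]add0r lerD ?expR_ge0// ler_expR; nra.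
Qed.

Lemma near_expr_lt (r e : R) : 0 <= r < 1 -> 0 < e -> \forall N \near \oo, r ^+ N < e.
Proof.
move=> /andP[r0 r1] e0.
have := @cvg_geometric R 1 r; rewrite ger0_norm// => /(_ r1) /cvgr0Pnorm_lt/(_ _ e0).
apply: filterS => N; rewrite /geometric/= mul1r ger0_norm// exprn_ge0//.
Qed.

(** Cramer's lower bound with the probability removed. Here psi is a moment
    generating function of X - x0, psi^N that of the sum of N copies, q the
    probability of a window of half-width N d' and L the infimum of psi. At a
    slope rho where psi is within a factor 1 + t^2 of L, the bound on psi (rho
    + t) + psi (rho - t), together with L <= psi, gives psi (rho + t), psi
    (rho - t) <= (1 + O(t^2)) psi rho; leaving the window costs e^(- t N d'),
    which is stronger for small t, so that the window carries half of psi rho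
    ^ N. The bound K on the slopes makes the factor e^(|rho| N d') negligible
    for small d'. *)
Lemma tilt_lower (psi : R -> R) (K C L d a : R) :
  (forall r, 0 < psi r) -> 0 <= C -> 0 <= K ->
  (forall r t, 0 <= t <= 1 -> psi (r + t) + psi (r - t) <= (2 + C * t ^+ 2) * psi r) ->
  (forall r, L <= psi r) ->
  (forall e, 0 < e -> exists2 r, `|r| <= K & psi r <= (1 + e) * L) ->
  0 < d -> expR (- a) < L ->
  exists2 d', 0 < d' <= d & exists rho t, 0 < t /\
   \forall N \near \oo, forall q : R,
    psi rho ^+ N <= expR (`|rho| * (N%:R * d')) * q
      + expR (- (t * (N%:R * d'))) * (psi (rho + t) ^+ N + psi (rho - t) ^+ N) ->
    expR (- (N%:R * a)) <= q.
Proof.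
move=> psi0 C0 K0 psiC Lpsi Kpsi d0 aL.
have L0 : 0 < L by rewrite (le_lt_trans _ aL)// expR_ge0.
pose s := a + ln L.
have s0 : 0 < s by rewrite /s -ltrBlDl sub0r -ltr_expR lnK.
(* s is the exponential slack between L and e^(-a); half of it pays for
   e^(|rho| N d'), half for constants. *)
pose d' := Num.min d (s / (2 * (K + 1))).
have K1 : 0 < 2 * (K + 1) by lra.
have d'0 : 0 < d' by rewrite lt_min d0 divr_gt0.
have Kd : K * d' <= s / 2.
  have : d' <= s / (2 * (K + 1)) by rewrite ge_min lexx orbT.
  rewrite ler_pdivlMr// => h; nra.
pose t := Num.min 1 (d' / (C + 2)).
have C2 : 0 < C + 2 by lra.
have t0 : 0 < t by rewrite lt_min ltr01 divr_gt0.
have t1 : t <= 1 by rewrite ge_min lexx.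
have tC : t * (C + 2) <= d' by rewrite -ler_pdivlMr// ge_min lexx orbT.
have [rho rhoK psirho] := Kpsi (t ^+ 2) (exprn_gt0 2 t0).
exists d'; first by rewrite d'0 ge_min lexx.
exists rho, t; split => //.
pose b := 1 + (C + 1) * t ^+ 2.
have t01 : 0 <= t <= 1 by rewrite ltW.
have Ct : 0 <= (C + 1) * t ^+ 2 by rewrite mulr_ge0 ?sqr_ge0//; lra.
have b0 : 0 < b by rewrite /b; lra.
(* Near minimality at precision t^2 loses a term of the same order as the
   second difference. *)
have psib : psi rho - t ^+ 2 * psi rho <= L.
  have := psi0 rho; have := Lpsi rho; nra.
have psip : psi (rho + t) <= b * psi rho.
  have := psiC rho t t01; have := Lpsi (rho - t); rewrite /b; lra.
have psim : psi (rho - t) <= b * psi rho.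
  have := psiC rho t t01; have := Lpsi (rho + t); rewrite /b; lra.
pose r := b * expR (- (t * d')).
have r0 : 0 <= r by rewrite mulr_ge0 ?expR_ge0 ?ltW.
have r1 : r < 1.
  rewrite /r expRN ltr_pdivrMr ?expR_gt0// mul1r.
  apply: lt_le_trans (expR_ge1Dx _); rewrite /b ltrD2l.
  have : t * (t * (C + 2)) <= t * d' by rewrite ler_pM2l.
  have : 0 < t ^+ 2 by rewrite exprn_gt0.
  nra.
have e1 : 0 < s / 2 by lra.
have ee : 0 <= expR (- (s / 2)) < 1 by rewrite expR_ge0 expR_lt1; lra.
near=> N => q hq.
have rN : r ^+ N < 4^-1 by near: N; apply: near_expr_lt; rewrite ?r0.
have sN : expR (- (s / 2)) ^+ N < 2^-1 by near: N; exact: near_expr_lt.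
have P0 : 0 < psi rho ^+ N by rewrite exprn_gt0.
have pN x : 0 < x -> x <= b * psi rho -> expR (- (t * (N%:R * d'))) * x ^+ N <= r ^+ N * psi rho ^+ N.
  move=> x0 xb; rewrite /r [b * _]mulrC exprMn -expRM_natl.
  rewrite mulrN [N%:R * (t * _)]mulrCA -mulrA -exprMn ler_wpM2l ?expR_ge0//.
  by apply: lerXn2r => //; rewrite nnegrE ltW// mulr_gt0.
have h1 := pN _ (psi0 _) psip; have h2 := pN _ (psi0 _) psim.
have h3 : psi rho ^+ N / 2 <= expR (`|rho| * (N%:R * d')) * q.
  have : r ^+ N * psi rho ^+ N <= 4^-1 * psi rho ^+ N by rewrite ler_wpM2r ?ltW.
  lra.
have h4 : L ^+ N <= psi rho ^+ N by apply: lerXn2r => //; rewrite nnegrE ltW.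
have q0 : 0 <= q.
  have : 0 < expR (`|rho| * (N%:R * d')) * q by apply: lt_le_trans h3; rewrite divr_gt0.
  by rewrite pmulr_rgt0 ?expR_gt0// => /ltW.
have h5 : L ^+ N / 2 <= expR (N%:R * (s / 2)) * q.
  apply: (@le_trans _ _ (psi rho ^+ N / 2)); first by rewrite ler_pM2r// invr_gt0.
  apply: (le_trans h3); rewrite ler_wpM2r// ler_expR mulrCA ler_wpM2l//.
  by apply: le_trans Kd; rewrite ler_pM2r.
have LE : L = expR (s - a) by rewrite /s addrAC subrr add0r lnK.
have h6 : expR (- (N%:R * a)) * expR (N%:R * s) <= 2 * expR (N%:R * (s / 2)) * q.
  rewrite -expRD -mulrN -mulrDr [- a + s]addrC expRM_natl -LE; lra.
have h7 : 2 * expR (N%:R * (s / 2)) <= expR (N%:R * s).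
  have -> : N%:R * s = N%:R * (s / 2) + N%:R * (s / 2) by field.
  rewrite expRD ler_pM2r ?expR_gt0//.
  move: sN; rewrite -expRM_natl mulrN expRN => sN.
  by rewrite -lef_pV2 ?posrE ?expR_gt0// ltW.
have h8 : 2 * expR (N%:R * (s / 2)) * q <= expR (N%:R * s) * q by rewrite ler_wpM2r.
have := le_trans h6 h8; rewrite mulrC ler_pM2l ?expR_gt0//.
Unshelve. all: by end_near. Qed.

End Elementary.

(** A slope t may be replaced by a rational th * t with th close to 1: by
    convexity the value t x - L t is multiplied by at least th. Shrinking
    towards 0 rather than approximating keeps the slope in the domain D, whose
    end points may be irrational. *)
Lemma rational_slope (R : realType) (D : R -> Prop) (L : R -> R) (c t x : R) :
  (forall u th, D u -> 0 <= th <= 1 -> D (th * u) /\ L (th * u) <= th * L u) ->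
  D t -> c < t * x - L t ->
  exists2 q : rat, D (ratr q) & c < ratr q * x - L (ratr q).
Proof.
move=> scale ht; set v := t * x - _ => cv.
have [t0|t0] := eqVneq t 0.
  exists 0; rewrite rmorph0; first by rewrite -t0.
  by rewrite -t0.
have [e e01 he] : exists2 e, 0 < e <= 1 & forall th, 1 - e < th < 1 -> c < th * v.
  pose e := Num.min 1 ((v - c) / (`|v| + 1)).
  have v1 : 0 < `|v| + 1 by rewrite ltr_pwDr.
  have e0 : 0 < e by rewrite lt_min ltr01 divr_gt0// subr_gt0.
  have ev : e * (`|v| + 1) <= v - c by rewrite -ler_pdivlMr// ge_min lexx orbT.
  exists e; first by rewrite e0 ge_min lexx.
  move=> th /andP[h1 h2]; have := ler_norm v; have := ler_norm (- v); rewrite normrN; nra.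
have [q hq] : exists q : rat, exists2 th, ratr q = th * t & 1 - e < th < 1.
  have [tp|tn] := ltP 0 t.
    have : (1 - e) * t < 1 * t by rewrite ltr_pM2r//; lra.
    move=> /rat_in_itvoo[q]; rewrite in_itv/= => /andP[q1 q2]; exists q.
    exists (ratr q / t); first by rewrite divfK.
    by rewrite ltr_pdivlMr// q1 ltr_pdivrMr.
  have {}tn : t < 0 by rewrite lt_neqAle t0.
  have : 1 * t < (1 - e) * t by rewrite ltr_nM2r//; lra.
  move=> /rat_in_itvoo[q]; rewrite in_itv/= => /andP[q1 q2]; exists q.
  exists (ratr q / t); first by rewrite divfK.
  by rewrite ltr_ndivlMr// q2 ltr_ndivrMr.
have [th Eq th1] := hq.
have th01 : 0 <= th <= 1 by lra.
have [h1 h2] := scale _ _ ht th01.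
exists q; rewrite Eq//; have := he _ th1; rewrite /v; lra.
Qed.

(** * Moment generating functions and the rate function *)

Section LogMgf.
Variable R : realType.
Implicit Type lam : probability R R.

Definition mgf lam (t : R) : \bar R := (\int[lam]_x (expR (t * x))%:E)%E.
(** Meaningful where mgf is finite, and only used there. *)
Definition lmgf lam (t : R) : R := ln (fine (mgf lam t)).

Lemma log_mgfE lam t : log_mgf lam t = lne (mgf lam t).
Proof.
rewrite /log_mgf /mmt_gen_fun unlock /mgf; congr lne.
by apply: eq_integral => x _ /=; rewrite mulrC.
Qed.

Lemma measurable_expRM (t : R) : measurable_fun [set: R] (fun x : R => expR (t * x)).
Proof. by apply: measurableT_comp => //; exact: measurable_funM. Qed.

Lemma measurable_EexpRM (t : R) : measurable_fun [set: R] (fun x : R => (expR (t * x))%:E).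
Proof. by apply/measurable_EFinP; exact: measurable_expRM. Qed.

Lemma mgf_gt0 lam t : (0 < mgf lam t)%E.
Proof.
rewrite lt_neqAle integral_ge0 ?andbT; last by move=> x _; rewrite lee_fin expR_ge0.
apply/eqP => /esym I0.
have : (\int[lam]_x `|(expR (t * x))%:E| = 0)%E.
  by rewrite -[RHS]I0; apply: eq_integral => x _; rewrite gee0_abs// lee_fin expR_ge0.
move/(ae_eq_integral_abs lam measurableT (measurable_EexpRM t)) => [N [mN N0 NT]].
have : (lam [set: R] <= lam N)%E.
  apply: le_measure; rewrite ?inE// => x _; apply: NT => /= /(_ I) [].
  by apply/eqP; rewrite gt_eqF// expR_gt0.
by rewrite N0 [X in (X <= _)%E]probability_setT lee_fin ler10.
Qed.

Lemma mgf_fin lam t : (mgf lam t < +oo)%E -> mgf lam t = (expR (lmgf lam t))%:E.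
Proof.
move=> tf; rewrite /lmgf.
have h : mgf lam t \is a fin_num by rewrite ge0_fin_numE// ltW// mgf_gt0.
by rewrite lnK ?posrE ?fineK// fine_gt0// mgf_gt0.
Qed.

Lemma log_mgf_fin lam t : (mgf lam t < +oo)%E -> log_mgf lam t = (lmgf lam t)%:E.
Proof. by move=> /mgf_fin h; rewrite log_mgfE h lne_EFin ?expR_gt0// expRK. Qed.

Lemma log_mgf_lty lam t : (log_mgf lam t < +oo)%E = (mgf lam t < +oo)%E.
Proof.
apply/idP/idP => [|h]; last by rewrite log_mgf_fin// ltry.
by rewrite log_mgfE; case: (mgf lam t) => //= r; rewrite ltry.
Qed.

Lemma mgf0 lam : mgf lam 0 = 1%:E.
Proof.
rewrite /mgf; under eq_integral do rewrite mul0r expR0.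
by rewrite integral_cst// mul1e; exact: probability_setT.
Qed.

Lemma lmgf0 lam : lmgf lam 0 = 0.
Proof. by rewrite /lmgf mgf0 ln1. Qed.

Lemma rate_young lam t x : (mgf lam t < +oo)%E -> ((t * x - lmgf lam t)%:E <= rate lam x)%E.
Proof. by move=> ht; apply: ereal_sup_ubound; exists t => //; rewrite log_mgf_fin. Qed.

Lemma rate_ge0 lam x : (0 <= rate lam x)%E.
Proof.
have := @rate_young lam 0 x; rewrite mgf0 lmgf0 mul0r subrr; apply.
exact: ltry.
Qed.

(** Slopes with infinite log-mgf contribute -oo to the supremum, hence a large
    rate is witnessed by a slope with finite exponential moment. *)
Lemma rate_gtP lam (c : R) x : (c%:E < rate lam x)%E ->
  exists2 t, (mgf lam t < +oo)%E & c < t * x - lmgf lam t.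
Proof.
move=> /ereal_sup_gt[_ [t _ <-] h].
have ht : (mgf lam t < +oo)%E.
  rewrite -log_mgf_lty ltey; apply/eqP => E.
  by move: h; rewrite E.
by exists t => //; move: h; rewrite log_mgf_fin.
Qed.

(** Convexity of the log-mgf between 0, where it vanishes, and t. Dividing
    e^(tx) by its mean e^l first makes the pointwise inequality expR_convex
    integrate to exactly this. *)
Lemma lmgf_scale lam t th : (mgf lam t < +oo)%E -> 0 <= th <= 1 ->
  (mgf lam (th * t) < +oo)%E /\ lmgf lam (th * t) <= th * lmgf lam t.
Proof.
move=> ht th01; have /andP[th0 th1] := th01.
pose l := lmgf lam t.
have h : (mgf lam (th * t) <= (expR (th * l))%:E)%E.
  apply: (@le_trans _ _ (\int[lam]_x ((th * expR (th * l) * expR (- l))%:E * (expR (t * x))%:E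
     + (expR (th * l) * (1 - th))%:E))%E).
    apply: ge0_le_integral => //.
    - exact: measurable_EexpRM.
    - apply: emeasurable_funD => //; apply: measurable_funeM; exact: measurable_EexpRM.
    move=> x _; rewrite lee_fin.
    (* The exponent is centred at l, where the right-hand side has mean 1. *)
    have -> : th * t * x = th * l + th * (t * x - l) by ring.
    have -> : th * expR (th * l) * expR (- l) * expR (t * x) + expR (th * l) * (1 - th)
      = expR (th * l) * (th * (expR (- l) * expR (t * x)) + (1 - th)) by ring.
    rewrite expRD ler_wpM2l ?expR_ge0// -expRD [- l + _]addrC.
    exact: expR_convex.
  rewrite ge0_integralD//; last 3 first.
  - by move=> x _; rewrite mule_ge0 ?lee_fin ?mulr_ge0 ?expR_ge0.
  - by apply: measurable_funeM; exact: measurable_EexpRM.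
  - by move=> x _; rewrite lee_fin mulr_ge0 ?expR_ge0 ?subr_ge0.
  rewrite ge0_integralZl//; [|exact: measurable_EexpRM|by rewrite lee_fin ?mulr_ge0 ?expR_ge0].
  rewrite integral_cst// -/(mgf lam t) mgf_fin// [X in (_ + _ * X)%E]probability_setT mule1.
  rewrite -EFinM -EFinD lee_fin -[_ * expR (- l) * _]mulrA -expRD addNr expR0.
  lra.
have hf : (mgf lam (th * t) < +oo)%E by apply: le_lt_trans h (ltry _).
split => //; move: h; rewrite (mgf_fin hf) lee_fin ler_expR//.
Qed.

Lemma rate_gt_rat lam (c : R) x : (c%:E < rate lam x)%E ->
  exists2 q : rat, (mgf lam (ratr q) < +oo)%E & c < ratr q * x - lmgf lam (ratr q).
Proof.
move=> /rate_gtP[t ht ct].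
apply: (@rational_slope _ (fun t => (mgf lam t < +oo)%E) (lmgf lam) _ _ _ _ ht ct).
by move=> u th; exact: lmgf_scale.
Qed.

End LogMgf.

Section Mean.
Variables (R : realType) (lam : probability R R) (t0 : R).
Hypotheses (t0_gt0 : 0 < t0) (mgfp : (mgf lam t0 < +oo)%E)
  (mgfm : (mgf lam (- t0) < +oo)%E).

Let integrable_exp t : (mgf lam t < +oo)%E ->
  lam.-integrable [set: R] (fun x => (expR (t * x))%:E).
Proof.
move=> ht; apply/integrableP; split; first exact: measurable_EexpRM.
by under eq_integral do rewrite gee0_abs ?lee_fin ?expR_ge0//.
Qed.

Let expR_norm_le (x : R) : expR (t0 * `|x|) <= expR (t0 * x) + expR (- t0 * x).
Proof.
have := expR_ge0 (t0 * x); have := expR_ge0 (- t0 * x).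
by case: (ger0P x) => _ h1 h2; rewrite ?mulrN -?mulNr; lra.
Qed.

Lemma integrable_id : lam.-integrable [set: R] (fun x : R => x%:E).
Proof.
apply: (@le_integrable _ _ R lam _ measurableT _
  (fun x : R => (t0^-1)%:E * ((expR (t0 * x))%:E + (expR (- t0 * x))%:E))%E) => //=.
- exact/measurable_EFinP.
- move=> x _; rewrite lee_fin [leRHS]ger0_norm; last first.
    by rewrite mulr_ge0 ?addr_ge0 ?expR_ge0// invr_ge0 ltW.
  rewrite ler_pdivlMl//; apply: le_trans (expR_norm_le x).
  by apply: le_trans (expR_ge1Dx _); rewrite lerDr.
- apply: integrableZl => //; apply: integrableD => //; exact: integrable_exp.
Qed.

Definition mean : R := fine (\int[lam]_x x%:E)%E.

Lemma integral_affine (a b : R) :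
  (\int[lam]_x (a + b * x)%:E = (a + b * mean)%:E)%E.
Proof.
have E : (\int[lam]_x x%:E = mean%:E)%E.
  by rewrite fineK//; exact: integrable_fin_num integrable_id.
under eq_integral do rewrite EFinD EFinM.
rewrite integralD//=.
- rewrite integralZl//; last exact: integrable_id.
  rewrite integral_cst// E; rewrite [X in (_ * X + _)%E]probability_setT mule1.
  by rewrite EFinD EFinM.
- exact: finite_measure_integrable_cst.
- by apply: integrableZl => //; exact: integrable_id.
Qed.

Lemma integrable_affine (a b : R) :
  lam.-integrable [set: R] (fun x => (a + b * x)%:E).
Proof.
under eq_fun do rewrite EFinD EFinM.
apply: integrableD => //; first exact: finite_measure_integrable_cst.
by apply: integrableZl => //; exact: integrable_id.
Qed.

(** Jensen's inequality: e^(t (x - mean)) >= 1 + t (x - mean) is integrated. *)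
Lemma mean_young t : (mgf lam t < +oo)%E -> t * mean <= lmgf lam t.
Proof.
move=> ht; set l := lmgf lam t.
have : (\int[lam]_x (expR (- (t * mean)) * expR (t * x))%:E = (expR (l - t * mean))%:E)%E.
  under eq_integral do rewrite EFinM.
  rewrite ge0_integralZl//; last exact: measurable_EexpRM.
  by rewrite -/(mgf lam t) mgf_fin// -EFinM -expRD addrC.
move=> h.
have : ((1 - t * mean + t * mean)%:E <= (expR (l - t * mean))%:E)%E.
  rewrite -h -integral_affine; apply: le_integral => //.
  - exact: integrable_affine.
  - by under eq_fun do rewrite EFinM; apply: integrableZl => //; exact: integrable_exp.
  move=> x _; rewrite lee_fin -expRD.
  by apply: le_trans (expR_ge1Dx _); lra.
rewrite lee_fin subrK -[X in X <= _ -> _]expR0 ler_expR; lra.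
Qed.

(** The remainder 4 (tx)^2 e^|tx| of the expansion of e^(tx) is dominated by
    the two exponential moments at t0 and - t0. *)
Lemma lmgf_quadratic : exists2 C, 0 <= C & forall t, `|t| <= t0 / 2 ->
  (mgf lam t < +oo)%E /\ lmgf lam t <= t * mean + C * t ^+ 2.
Proof.
(* 64 = 4 * 16: the factor 4 of expR_le_quadratic, and x^2 <= (16 / t0^2)
   e^(t0 |x| / 2); the other half of the exponent t0 |x| absorbs e^|tx|. *)
pose c := 64 / t0 ^+ 2.
have t02 : 0 < t0 ^+ 2 by rewrite exprn_gt0.
have c0 : 0 < c by rewrite divr_gt0.
pose D := expR (lmgf lam t0) + expR (lmgf lam (- t0)).
have D0 : 0 < D by rewrite addr_gt0 ?expR_gt0.
exists (c * D); first by rewrite ltW// mulr_gt0.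
move=> t tt0.
have t2 : 0 <= t ^+ 2 by exact: sqr_ge0.
have pw (x : R) : expR (t * x) <= 1 + t * x + c * t ^+ 2 * (expR (t0 * x) + expR (- t0 * x)).
  apply: (le_trans (expR_le_quadratic _)); rewrite lerD2l.
  apply: (@le_trans _ _ (c * t ^+ 2 * expR (t0 * `|x|))); last first.
    by rewrite ler_wpM2l ?expR_norm_le// mulr_ge0// ltW.
  pose v := expR (t0 * `|x| / 2).
  have Ev : expR (t0 * `|x|) = v * v by rewrite -expRD; congr expR; field.
  have x0 : 0 <= `|x| by [].
  have h1 : expR `|t * x| <= v.
    by rewrite ler_expR normrM mulrAC ler_wpM2r.
  have h2 : x ^+ 2 <= (16 / t0 ^+ 2) * v.
    rewrite mulrAC ler_pdivlMr//.
    have -> : v = expR (t0 * `|x| / 4) ^+ 2 by rewrite -expRM_natl; congr expR; field.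
    have h3 : t0 * `|x| / 4 <= expR (t0 * `|x| / 4).
      by apply: le_trans (expR_ge1Dx _); rewrite lerDr.
    have h4 : (t0 * `|x| / 4) ^+ 2 <= expR (t0 * `|x| / 4) ^+ 2.
      by rewrite lerXn2r// nnegrE ?expR_ge0// !mulr_ge0// ltW.
    have E : (t0 * `|x| / 4) ^+ 2 * 16 = x ^+ 2 * t0 ^+ 2.
      by rewrite -[x ^+ 2]real_normK ?num_real//; field.
    lra.
  rewrite Ev exprMn.
  have : x ^+ 2 * expR `|t * x| <= (16 / t0 ^+ 2 * v) * v.
    by apply: ler_pM => //; exact: sqr_ge0.
  move=> /(ler_wpM2l t2) h3; rewrite /c; lra.
have h : (mgf lam t <= (1 + t * mean + c * t ^+ 2 * D)%:E)%E.
  pose K := c * t ^+ 2; pose G (x : R) := 1 + t * x + K * (expR (t0 * x) + expR (- t0 * x)).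
  have GE x : (G x)%:E = ((1 + t * x)%:E + K%:E * ((expR (t0 * x))%:E + (expR (- t0 * x))%:E))%E.
    by rewrite EFinD EFinM [X in (_ * X)%E]EFinD.
  have IE := integrableD measurableT (integrable_exp mgfp) (integrable_exp mgfm).
  have IK := integrableZl measurableT K IE.
  have IG := integrableD measurableT (integrable_affine 1 t) IK.
  apply: (@le_trans _ _ (\int[lam]_x (G x)%:E)%E).
    apply: ge0_le_integral => //; first exact: measurable_EexpRM.
    - by under eq_fun do rewrite GE; exact: measurable_int IG.
    by move=> x _; rewrite lee_fin; exact: pw.
  under eq_integral do rewrite GE.
  rewrite (integralD measurableT (integrable_affine 1 t) IK).
  rewrite (integralZl measurableT IE).
  rewrite (integralD measurableT (integrable_exp mgfp) (integrable_exp mgfm)).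
  rewrite integral_affine -/(mgf lam t0) -/(mgf lam (- t0)) (mgf_fin mgfp) (mgf_fin mgfm).
  by rewrite -[X in (_ * X)%E]EFinD -EFinM -EFinD lexx.
have hf : (mgf lam t < +oo)%E by apply: le_lt_trans h (ltry _).
split => //; move: h; rewrite mgf_fin// lee_fin => h.
rewrite -ler_expR (le_trans h)//; apply: le_trans (expR_ge1Dx _); lra.
Qed.

(** The rate has no other zero than the mean: for small t with the sign of x -
    mean, t (x - mean) exceeds the quadratic correction C t^2. *)
Lemma rate_gt0_witness x : x != mean ->
  exists2 t, (mgf lam t < +oo)%E & 0 < t * x - lmgf lam t.
Proof.
move=> xm; have [C C0 hC] := lmgf_quadratic.
pose e := `|x - mean|.
have e0 : 0 < e by rewrite normr_gt0 subr_eq0.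
pose s := Num.min (t0 / 2) (e / (2 * (C + 1))).
have C1 : 0 < 2 * (C + 1) by lra.
have s0 : 0 < s by rewrite lt_min !divr_gt0.
have s1 : s * (2 * (C + 1)) <= e by rewrite -ler_pdivlMr// ge_min lexx orbT.
have s2 : s <= t0 / 2 by rewrite ge_min lexx.
pose t := Num.sg (x - mean) * s.
have tn : `|t| = s by rewrite normrM normr_sg subr_eq0 xm mul1r gtr0_norm.
have tle : `|t| <= t0 / 2 by rewrite tn.
have [ht hl] := hC t tle.
exists t => //.
have : t * (x - mean) = s * e by rewrite /t mulrAC -normrEsg mulrC.
have : t ^+ 2 = s ^+ 2 by rewrite -tn real_normK ?num_real.
move=> E1 E2; rewrite E1 in hl.
have : 0 < s * e by rewrite mulr_gt0.
have : s * (s * (2 * (C + 1))) <= s * e by rewrite ler_pM2l.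
have : 0 < s ^+ 2 by rewrite exprn_gt0.
nra.
Qed.

Lemma mgf_le_of_null x t : lam [set y | (t * x < t * y)%R] = 0%E ->
  (mgf lam t <= (expR (t * x))%:E)%E.
Proof.
move=> h0.
apply: (@le_trans _ _ (\int[lam]_y (cst (expR (t * x))%:E y))%E).
  apply: ae_ge0_le_integral => //.
    exact: measurable_EexpRM.
    by move=> y _; rewrite lee_fin expR_ge0.
  exists [set y | t * x < t * y]; split => //.
    by apply: measurable_gt_cst; exact: measurable_funM.
  move=> y /= /not_implyP[_ /negP]; rewrite lee_fin ler_expR => h.
  by rewrite ltNge.
by rewrite integral_cst// [X in (_ * X)%E]probability_setT mule1.
Qed.

End Mean.

(** * Cramer's lower bound for sample means *)

Section SampleMean.
Variables (R : realType) (lam : probability R R).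
Local Open Scope ereal_scope.

Lemma sample_integral_prod d (T : measurableType d) (Q : probability T R) N
    (X : 'I_N -> {RV Q >-> R}) (g : R -> R) (c : R) :
  mutually_independent [set: 'I_N] X ->
  (forall i (A : set R), measurable A -> distribution Q (X i) A = lam A) ->
  measurable_fun [set: R] g -> (forall x, 0 <= g x)%R ->
  \int[lam]_x (g x)%:E = c%:E ->
  \int[Q]_w (\prod_(i < N) g (X i w))%:E = (c ^+ N)%:E.
Proof.
move=> indep law mg g0 gc.
have Eg i : \int[Q]_w (g (X i w))%:E = c%:E.
  have mEg : measurable_fun [set: R] (EFin \o g) by exact/measurable_EFinP.
  rewrite -gc -[LHS](@ge0_integral_distribution _ _ _ _ _ Q (X i) (EFin \o g))//.
  by apply: eq_measure_integral => A mA _; exact: law.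
have fin i : i \in index_enum 'I_N -> \int[Q]_w (g (X i w))%:E < +oo.
  by move=> _; rewrite Eg ltry.
rewrite (@integral_prod R _ T Q _ _ X (fun=> g) (index_enum 'I_N) indep
  (fun=> mg) (fun=> g0) fin (index_enum_uniq _) (fun _ _ => Logic.I)).
rewrite (eq_bigr (fun=> c%:E))// prodEFin; congr EFin.
by rewrite prodr_const card_ord.
Qed.

Lemma sample_mgf N (mu : {measure set R -> \bar R}) t : (0 < N)%N ->
  is_sample_mean_law lam N mu -> mgf lam t < +oo ->
  \int[mu]_x (expR (t * (N%:R * x)))%:E = (expR (N%:R * lmgf lam t))%:E.
Proof.
move=> N0 [d [T [Q [X [indep law muE]]]]] ht.
have mS : measurable_fun [set: T] (fun w => N%:R^-1 * \sum_(i < N) X i w)%R.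
  by apply: measurable_funM => //; apply: measurable_sum => i.
pose S : {RV Q >-> R} := mfun_Sub (mem_set mS).
transitivity (\int[distribution Q S]_x (expR (t * (N%:R * x)))%:E).
  by apply: eq_measure_integral => A mA _; exact: muE.
have mE : measurable_fun [set: R] (fun x : R => (expR (t * (N%:R * x)))%:E).
  apply/measurable_EFinP; apply: measurableT_comp => //.
  by apply: measurable_funM => //; apply: measurable_funM.
rewrite ge0_integral_distribution//.
have := sample_integral_prod indep law (measurable_expRM t)
  (fun x => expR_ge0 (t * x)%R) (mgf_fin ht).
rewrite -expRM_natl => <-; apply: eq_integral => w _ /=; congr EFin.
by rewrite -expR_sum; congr expR; rewrite mulVKf ?pnatr_eq0 -?lt0n// mulr_sumr.
Qed.

(** The truncation |x - x0| <= M makes the tilted moments finite for all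
    slopes, whatever the tails of lam. *)
Definition trunc_exp (x0 : R) (M : nat) (r x : R) : R :=
  (expR (r * (x - x0)) * (`|x - x0| <= M%:R)%R%:R)%R.

Definition trunc_mgf (x0 : R) (M : nat) (r : R) : R :=
  fine (\int[lam]_x (trunc_exp x0 M r x)%:E).

Lemma measurable_trunc (x0 : R) (M : nat) (r : R) : measurable_fun [set: R] (trunc_exp x0 M r).
Proof.
rewrite /trunc_exp; apply: measurable_funM.
  apply: measurableT_comp => //; apply: measurable_funM => //.
  exact: measurable_funB.
rewrite (_ : (fun _ => _) = \1_[set x : R | (`|x - x0| <= M%:R)%R]); last first.
  by apply/funext => x; rewrite indicE/= mem_setE.
apply: measurable_indic.
rewrite (_ : [set x | _] = `[(x0 - M%:R)%R, (x0 + M%:R)%R]%classic)//.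
by apply/seteqP; split => x /=; rewrite in_itv/= ler_distl.
Qed.

Lemma trunc_ge0 (x0 : R) (M : nat) (r x : R) :
  (0 <= trunc_exp x0 M r x)%R.
Proof. by rewrite mulr_ge0 ?expR_ge0. Qed.

Lemma trunc_mgfE (x0 : R) (M : nat) (r : R) :
  \int[lam]_x (trunc_exp x0 M r x)%:E
  = (trunc_mgf x0 M r)%:E.
Proof.
rewrite /trunc_mgf fineK// ge0_fin_numE; last first.
  by apply: integral_ge0 => x _; rewrite lee_fin trunc_ge0.
apply: (@le_lt_trans _ _ (\int[lam]_x (cst (expR (`|r| * M%:R))%:E x))); last first.
  by rewrite integral_cst// [X in _ * X]probability_setT mule1 ltry.
apply: ge0_le_integral => //.
- by move=> x _; rewrite lee_fin trunc_ge0.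
- by apply/measurable_EFinP; exact: measurable_trunc.
move=> x _; rewrite lee_fin /trunc_exp; case: (leP _ M%:R) => h; rewrite ?mulr0 ?expR_ge0//.
rewrite mulr1 ler_expR (le_trans (ler_norm _))// normrM ler_wpM2l//.
Qed.

(** The inequality expR_window_le for the sum of N variables, multiplied by
    the indicator that none of them is truncated and integrated: by
    independence each tilted term becomes a power of trunc_mgf. *)
Lemma sample_window N (mu : {measure set R -> \bar R}) (x0 D r t : R) (M : nat) :
  (0 < N)%N -> is_sample_mean_law lam N mu -> (0 <= t)%R ->
  ((trunc_mgf x0 M r) ^+ N <= expR (`|r| * (N%:R * D)) *
     fine (mu [set x | `|x - x0| < D])
   + expR (- (t * (N%:R * D))) * (trunc_mgf x0 M (r + t) ^+ N + trunc_mgf x0 M (r - t) ^+ N))%R.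
Proof.
move=> N0 [d [T [Q [X [indep law muE]]]]] t0.
have N0' : (0 < N%:R :> R)%R by rewrite ltr0n.
have mS : measurable_fun [set: T] (fun w => N%:R^-1 * \sum_(i < N) X i w)%R.
  by apply: measurable_funM => //; apply: measurable_sum => i.
have mA := measurable_window x0 D.
rewrite muE//; set E := [set w | _].
have mE : measurable E by rewrite -[E]setTI; exact: mS.
pose g := trunc_exp x0 M.
have Ig s := sample_integral_prod indep law (measurable_trunc x0 M s)
  (trunc_ge0 x0 M s) (trunc_mgfE x0 M s).
have mG s : measurable_fun [set: T] (fun w => (\prod_(i < N) g s (X i w))%:E).
  apply/measurable_EFinP; apply: measurable_prod => i _.
  by apply: measurableT_comp => //; exact: measurable_trunc.
have G0 s w : 0 <= (\prod_(i < N) g s (X i w))%:E.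
  by rewrite lee_fin prodr_ge0// => i _; exact: trunc_ge0.
have Qfin : Q E = (fine (Q E))%:E by rewrite fineK// fin_num_measure.
rewrite -lee_fin EFinD !EFinM -Qfin EFinD -!Ig.
pose F w := (expR (`|r| * (N%:R * D)))%:E * (\1_E w)%:E +
  (expR (- (t * (N%:R * D))))%:E * ((\prod_(i < N) g (r + t) (X i w))%:E +
    (\prod_(i < N) g (r - t) (X i w))%:E).
have m1 : measurable_fun [set: T] (fun w => (expR (`|r| * (N%:R * D)))%:E * (\1_E w)%:E).
  by apply: measurable_funeM; apply/measurable_EFinP; exact: measurable_indic.
have m2 : measurable_fun [set: T] (fun w => (\prod_(i < N) g (r + t) (X i w))%:E +
    (\prod_(i < N) g (r - t) (X i w))%:E).
  by apply: emeasurable_funD; exact: mG.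
have IF : \int[Q]_w F w = (expR (`|r| * (N%:R * D)))%:E * Q E
   + (expR (- (t * (N%:R * D))))%:E *
    (\int[Q]_w (\prod_(i < N) g (r + t) (X i w))%:E
     + \int[Q]_w (\prod_(i < N) g (r - t) (X i w))%:E).
  rewrite ge0_integralD//.
  - rewrite ge0_integralZl//; last by apply/measurable_EFinP; exact: measurable_indic.
    rewrite integral_indic// setIT ge0_integralZl//; last first.
      by move=> w _; rewrite adde_ge0.
    by rewrite ge0_integralD.
  - by move=> w _; rewrite mule_ge0// adde_ge0.
  - exact: measurable_funeM.
rewrite -IF; apply: ge0_le_integral => //.
  by apply: emeasurable_funD => //; exact: measurable_funeM.
move=> w _.
pose S := (\sum_(i < N) (X i w - x0))%R.
pose b := (\prod_(i < N) (`|X i w - x0| <= M%:R)%R%:R : R)%R.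
(* b is the indicator that no variable is truncated; in the window term it is
   bounded by 1. *)
have gE s : (\prod_(i < N) g s (X i w) = expR (s * S) * b)%R.
  by rewrite big_split/= -expR_sum -mulr_sumr.
have b01 : (0 <= b <= 1)%R.
  rewrite prodr_ge0//=; apply: prodr_ile1 => i _.
  by case: (`|X i w - x0| <= M%:R)%R; rewrite /= ?lexx ?ler01.
have SN : (S = N%:R * (N%:R^-1 * \sum_(i < N) X i w - x0))%R.
  rewrite /S sumrB sumr_const card_ord mulrBr mulVKf ?gt_eqF//.
  by rewrite mulr_natl.
have SE : (\1_E w = (`|S| < N%:R * D)%R%:R :> R)%R.
  rewrite indicE; congr (nat_of_bool _)%:R; apply/idP/idP.
    by rewrite inE /E /= SN normrM gtr0_norm// ltr_pM2l.
  by rewrite inE /E /= SN normrM gtr0_norm// ltr_pM2l.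
have -> : F w = (expR (`|r| * (N%:R * D)) * \1_E w + expR (- (t * (N%:R * D))) *
    (\prod_(i < N) g (r + t) (X i w) + \prod_(i < N) g (r - t) (X i w)))%:E.
  by rewrite /F EFinD 2!EFinM [X in _ + _ * X]EFinD.
rewrite lee_fin !gE SE.
have := expR_window_le r S (N%:R * D) t0.
move=> /(ler_wpM2r (proj1 (andP b01))) /le_trans; apply.
rewrite mulrDl lerD//; last by rewrite -mulrA mulrDl.
by apply: ler_piMr; [rewrite mulr_ge0 ?expR_ge0|case/andP: b01].
Qed.
End SampleMean.

Section Cramer.
Variables (R : realType) (lam : probability R R) (x0 : R).

Local Notation psi := (trunc_mgf lam x0).

Lemma measurable_Etrunc M r : measurable_fun [set: R] (fun x => (trunc_exp x0 M r x)%:E).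
Proof. by apply/measurable_EFinP; exact: measurable_trunc. Qed.

Lemma trunc_exp_nd M M' r x : (M <= M')%N ->
  trunc_exp x0 M r x <= trunc_exp x0 M' r x.
Proof.
move=> MM; rewrite /trunc_exp ler_wpM2l ?expR_ge0//.
have [h1|//] := leP `|x - x0| M%:R.
by rewrite (le_trans h1)// ler_nat.
Qed.

Lemma trunc_mgf_nd M M' r : (M <= M')%N -> psi M r <= psi M' r.
Proof.
move=> MM; rewrite -lee_fin -!trunc_mgfE; apply: ge0_le_integral => //.
- by move=> x _; rewrite lee_fin trunc_ge0.
- exact: measurable_Etrunc.
- exact: measurable_Etrunc.
by move=> x _; rewrite lee_fin trunc_exp_nd.
Qed.

(** Monotone convergence in the truncation level; the limit may be infinite,
    so the statement compares with reals below it. *)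
Lemma trunc_mgf_cvg r v :
  (v%:E < \int[lam]_x (expR (r * (x - x0)))%:E)%E -> exists M, v < psi M r.
Proof.
move=> h; apply: contrapT => /forallNP H.
have C : (\int[lam]_x (trunc_exp x0 M r x)%:E)%E @[M --> \oo] -->
    (\int[lam]_x limn (fun M => (trunc_exp x0 M r x)%:E))%E.
  apply: cvg_monotone_convergence => //.
  - by move=> M; exact: measurable_Etrunc.
  - by move=> M x _; rewrite lee_fin trunc_ge0.
  by move=> x _ M M' MM; rewrite lee_fin trunc_exp_nd.
have limE : (\int[lam]_x limn (fun M => (trunc_exp x0 M r x)%:E) =
    \int[lam]_x (expR (r * (x - x0)))%:E)%E.
  apply: eq_integral => x _; apply/cvg_lim => //.
  apply: (@cvg_near_cst _ _ (expR (r * (x - x0)))%:E).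
  exists (Num.truncn `|x - x0|).+1 => // M /= hM.
  rewrite /trunc_exp (_ : _ <= _) ?mulr1//.
  by rewrite (le_trans (ltW (truncnS_gt _)))// ler_nat.
rewrite limE in C.
move: h; rewrite -(cvg_lim _ C)// ltNge => /negP; apply.
apply: lime_le; first by apply/cvg_ex; eexists; exact: C.
by apply: nearW => M; rewrite trunc_mgfE lee_fin leNgt; apply/negP/H.
Qed.

(** Continuity in the slope at a fixed truncation level, in the multiplicative
    form which transports lower bounds to nearby slopes. *)
Lemma trunc_mgf_lip M r r' : expR (- (`|r' - r| * M%:R)) * psi M r <= psi M r'.
Proof.
have mt := measurable_trunc x0 M; have t0 := trunc_ge0 x0 M.
rewrite -lee_fin EFinM -!trunc_mgfE -integralZl_EFin ?expR_ge0//.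
apply: le_integral_EFin => //; first exact: measurable_funM.
  by move=> x; rewrite mulr_ge0 ?expR_ge0.
move=> x; rewrite /trunc_exp mulrA -expRD.
have [xM|_] := leP `|x - x0| M%:R; last by rewrite !mulr0.
rewrite !mulr1 ler_expR.
have : - ((r' - r) * (x - x0)) <= `|r' - r| * M%:R.
  rewrite (le_trans (ler_norm _))// normrN normrM ler_wpM2l//.
lra.
Qed.

Lemma trunc_mgf_cosh M r t : 0 <= t <= 1 ->
  psi M (r + t) + psi M (r - t) <= (2 + (8 * M%:R ^+ 2 * expR M%:R) * t ^+ 2) * psi M r.
Proof.
move=> t01; have t2 := sqr_ge0 t.
have mt := measurable_trunc x0 M; have tr0 := trunc_ge0 x0 M.
rewrite -lee_fin EFinD EFinM -!trunc_mgfE -integralZl_EFin//; last first.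
  by rewrite addr_ge0// (mulr_ge0 _ t2)// !mulr_ge0 ?expR_ge0.
rewrite -ge0_integralD_EFin//.
apply: le_integral_EFin => //; first exact: measurable_funD.
- exact: measurable_funM.
- by move=> x; rewrite addr_ge0.
move=> x; rewrite /trunc_exp.
have [xM|_] := leP `|x - x0| M%:R; last by rewrite !mulr0 addr0.
rewrite !mulr1 mulrDl mulrBl !expRD -mulrDr mulrC ler_wpM2r ?expR_ge0//.
exact: expR_cosh_le.
Qed.

(** Mass at distance at least eta from x0, on the side given by the sign s,
    makes the moments grow like e^(|r| eta) for slopes of that sign. The
    constants are uniform in the truncation level. *)
Lemma trunc_mgf_coercive (s : R) : `|s| = 1 -> (0 < lam [set x | (0 < s * (x - x0))%R])%E ->
  exists2 eta, 0 < eta & exists2 c, 0 < c & exists M0, forall M, (M0 <= M)%N ->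
    forall r, 0 <= s * r -> c * expR (`|r| * eta) <= psi M r.
Proof.
move=> s1 lam0.
have ss : s * s = 1 by rewrite -expr2 -[LHS]real_normK ?num_real// s1 expr1n.
pose A k := [set x : R | (k.+1%:R)^-1 <= s * (x - x0) <= k.+1%:R].
have mf : measurable_fun [set: R] (fun x : R => s * (x - x0)).
  by apply: measurable_funM => //; exact: measurable_funB.
have mA k : measurable (A k).
  rewrite (_ : A k = [set: R] `&` (fun x => s * (x - x0)) @^-1` `[(k.+1%:R)^-1, k.+1%:R]%classic).
    exact: mf.
  by rewrite setTI; apply/seteqP; split => x; rewrite /A/= in_itv.
have [k Ak] : exists k, (0 < lam (A k))%E.
  apply: contrapT => /forallNP H.
  have N0 : lam.-negligible (\bigcup_k A k).
    apply: negligible_bigcup => k; apply/negligibleP => //.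
    apply/eqP; rewrite eq_le measure_ge0 andbT leNgt; exact/negP/H.
  have mB : measurable [set x : R | 0 < s * (x - x0)].
    exact: measurable_gt_cst.
  have : lam.-negligible [set x : R | 0 < s * (x - x0)].
    apply: negligibleS N0 => x /= x1.
    set y := s * (x - x0) in x1 *.
    exists (maxn (Num.truncn y) (Num.truncn y^-1)) => //=.
    rewrite /A/= -/y.
    have h1 := truncnS_gt y; have h2 := truncnS_gt y^-1.
    apply/andP; split.
      rewrite -[leRHS]invrK lef_pV2 ?posrE ?invr_gt0//.
      by rewrite (le_trans (ltW h2))// ler_nat ltnS leq_maxr.
    by rewrite (le_trans (ltW h1))// ler_nat ltnS leq_maxl.
  by move/negligibleP => /(_ mB) E; rewrite E ltxx in lam0.
exists (k.+1%:R)^-1; first by rewrite invr_gt0.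
exists (fine (lam (A k))).
  by rewrite fine_gt0// Ak/= (le_lt_trans (probability_le1 _ _))// ltry.
exists k.+1 => M kM r sr.
rewrite -lee_fin mulrC EFinM -trunc_mgfE fineK ?fin_num_measure//.
have nr : `|r| = s * r by rewrite -[RHS]ger0_norm// normrM s1 mul1r.
have mI : measurable_fun [set: R] (\1_(A k) : R -> R) by exact: measurable_indic.
rewrite -[X in lam X]setIT -integral_indic// -integralZl_EFin ?expR_ge0//.
apply: le_integral_EFin; first exact: measurable_funM.
- exact: measurable_trunc.
- by move=> x; rewrite mulr_ge0 ?expR_ge0.
move=> x; rewrite indicE.
have [|_] := boolP (x \in A k); last by rewrite mulr0 trunc_ge0.
rewrite inE /A/= => /andP[h1 h2].
have y0 : 0 <= s * (x - x0) by apply: le_trans h1; rewrite invr_ge0.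
have ny : `|x - x0| = s * (x - x0) by rewrite -[RHS]ger0_norm// normrM s1 mul1r.
rewrite /trunc_exp ny (le_trans h2) ?ler_nat// !mulr1 ler_expR.
have -> : r * (x - x0) = `|r| * (s * (x - x0)).
  by rewrite nr mulrACA ss mul1r.
exact: ler_wpM2l.
Qed.

End Cramer.

Section CramerLower.
Variables (R : realType) (lam : probability R R) (x0 : R).
Local Notation psi := (trunc_mgf lam x0).

Lemma integral_expRB_gt r (a : R) : (rate lam x0 < a%:E)%E ->
  ((expR (- a))%:E < \int[lam]_x (expR (r * (x - x0)))%:E)%E.
Proof.
move=> ra.
have -> : (\int[lam]_x (expR (r * (x - x0)))%:E = (expR (- (r * x0)))%:E * mgf lam r)%E.
  rewrite /mgf -integralZl_EFin ?expR_ge0//; last exact: measurable_expRM.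
  by apply: eq_integral => x _; rewrite -expRD; congr (expR _)%:E; ring.
have [h|] := ltP (mgf lam r) +oo%E.
  rewrite mgf_fin// -EFinM lte_fin -expRD ltr_expR.
  have := le_lt_trans (rate_young x0 h) ra; rewrite lte_fin; lra.
by rewrite leye_eq => /eqP ->; rewrite gt0_muley ?ltry// lte_fin expR_gt0.
Qed.

(** The rate at x0 being below a means that e^(-a) is below all the moments E
    e^(r (X - x0)). For a suitable truncation level this persists for all
    slopes at once: for large slopes because of the mass on both sides of x0,
    on a compact set of slopes by monotone convergence. The infimum of the
    truncated moments is then nearly attained at a bounded slope, and
    tilt_lower applies. *)
Lemma cramer_lower (d a : R) : 0 < d ->
  (0 < lam [set x | (x0 < x)%R])%E -> (0 < lam [set x | (x < x0)%R])%E ->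
  (rate lam x0 < a%:E)%E ->
  \forall N \near \oo, forall mu : probability R R,
    is_sample_mean_law lam N mu ->
    expR (- (N%:R * a)) <= fine (mu [set x | (`|x - x0| < d)%R]).
Proof.
move=> d0 lamp lamm ra.
have rfin : rate lam x0 \is a fin_num by rewrite ge0_fin_numE ?rate_ge0// (lt_trans ra (ltry _)).
pose rr := fine (rate lam x0).
have rE : rate lam x0 = rr%:E by rewrite fineK.
have r0 : 0 <= rr by rewrite -lee_fin -rE rate_ge0.
have rra : rr < a by rewrite -lte_fin -rE.
pose a' := (rr + a) / 2.
have a'1 : (rate lam x0 < a'%:E)%E by rewrite rE lte_fin /a'; lra.
have a'a : a' < a by rewrite /a'; lra.
have a'0 : 0 <= a' by rewrite /a'; lra.
have lamp' : (0 < lam [set x | (0 < 1 * (x - x0))%R])%E.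
  by rewrite (_ : [set x | _] = [set x | x0 < x])//; apply/seteqP; split => x /=; rewrite mul1r subr_gt0.
have lamm' : (0 < lam [set x | (0 < (-1) * (x - x0))%R])%E.
  by rewrite (_ : [set x | _] = [set x | x < x0])//; apply/seteqP; split => x /=; rewrite mulN1r oppr_gt0 subr_lt0.
have [e1 e10 [c1 c10 [M1 H1]]] := trunc_mgf_coercive (normr1 _) lamp'.
have [e2 e20 [c2 c20 [M2 H2]]] := trunc_mgf_coercive (normrN1 _) lamm'.
pose e := Num.min e1 e2; pose c := Num.min c1 c2.
have e0 : 0 < e by rewrite lt_min e10.
have c0 : 0 < c by rewrite lt_min c10.
have H M r : (maxn M1 M2 <= M)%N -> c * expR (`|r| * e) <= psi M r.
  rewrite geq_max => /andP[m1 m2].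
  have [r1|r1] := leP 0 r.
    apply: le_trans (H1 M m1 r _); last by rewrite mul1r.
    apply: ler_pM; rewrite ?expR_ge0 ?(ltW c0)// ?ge_min ?lexx//.
    by rewrite ler_expR ler_wpM2l// ge_min lexx.
  apply: le_trans (H2 M m2 r _); last by rewrite mulN1r oppr_ge0 ltW.
  apply: ler_pM; rewrite ?expR_ge0 ?(ltW c0)// ?ge_min ?lexx ?orbT//.
  by rewrite ler_expR ler_wpM2l// ge_min lexx orbT.
(* Beyond K the moments exceed 2, while the infimum is at most psi M 0 <= 1,
   so nearly minimal slopes are at most K. *)
pose K := 2 / (c * e).
have ce0 : 0 < c * e by rewrite mulr_gt0.
have K0 : 0 <= K by rewrite ltW// divr_gt0.
have HK M r : (maxn M1 M2 <= M)%N -> K < `|r| -> 2 < psi M r.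
  move=> hM; rewrite /K ltr_pdivrMr// => hK.
  apply: lt_le_trans (H M r hM); apply: (lt_le_trans hK).
  rewrite mulrCA ler_wpM2l ?(ltW c0)//.
  by apply: le_trans (expR_ge1Dx _); rewrite lerDr.
(* Dini's argument: the moments increase with M and each of them varies
   continuously with the slope. *)
have KM : \forall M \near \oo, `[- K, K]%classic `<=` [set r | expR (- a') < psi M r].
  have := @segment_compact R (- K) K.
  move/compact_near_coveringP => /(_ nat \oo (fun M r => expR (- a') < psi M r)); apply.
  move=> r _.
  have [M hM] := trunc_mgf_cvg (integral_expRB_gt r a'1).
  have p0 : 0 < psi M r by apply: lt_trans hM; rewrite expR_gt0.
  pose g := ln (psi M r) + a'.
  have g0 : 0 < g by rewrite /g -ltrBlDr sub0r -ltr_expR lnK.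
  have gM0 : 0 < g / (M.+1)%:R by rewrite divr_gt0.
  exists ([set r' | `|r - r'| < g / M.+1%:R], [set M' | (M <= M')%N]).
    split => /=; last by exists M.
    exact: (@nbhsx_ballx _ _ r (g / M.+1%:R) gM0).
  move=> [r' M'] /= [rr' MM'].
  apply: lt_le_trans (trunc_mgf_nd _ _ _ MM').
  apply: lt_le_trans (trunc_mgf_lip _ _ _ r _).
  rewrite -[psi M r in X in _ < X]lnK ?posrE// -expRD ltr_expR.
  move: rr'; rewrite ltr_pdivlMr// distrC => h.
  have : `|r' - r| * M%:R <= `|r' - r| * M.+1%:R by rewrite ler_wpM2l// ler_nat.
  rewrite /g in h *; lra.
have [M [MM KM']] : exists M, (maxn M1 M2 <= M)%N /\
    `[- K, K]%classic `<=` [set r | expR (- a') < psi M r].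
  case: KM => m _ hm; exists (maxn m (maxn M1 M2)); split; first by rewrite leq_maxr.
  by apply: hm => /=; rewrite leq_maxl.
have Hl r : expR (- a') <= psi M r.
  have [rK|rK] := leP `|r| K.
    by apply/ltW/KM'; rewrite /= in_itv/= -ler_norml.
  rewrite (le_trans _ (ltW (HK _ _ MM rK)))//.
  by rewrite (@le_trans _ _ 1)// ?ler1n// expR_le1 oppr_le0.
pose L := inf (range (psi M)).
have Lh : has_inf (range (psi M)).
  split; first by exists (psi M 0); exists 0.
  by exists (expR (- a')) => _ [r _ <-]; exact: Hl.
have LaE : expR (- a') <= L.
  by apply: lb_le_inf; [exact: Lh.1|move=> _ [r _ <-]; exact: Hl].
have Lpsi r : L <= psi M r by apply: ge_inf; [exact: Lh.2|exists r].
have L0 : 0 < L by apply: lt_le_trans LaE; rewrite expR_gt0.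
have psi1 : psi M 0 <= 1.
  rewrite -lee_fin -trunc_mgfE.
  apply: (@le_trans _ _ (\int[lam]_x 1%:E)%E).
    apply: (@le_integral_EFin _ _ _ _ _ (cst 1)) => //; first exact: measurable_trunc.
    - by move=> x; exact: trunc_ge0.
    by move=> x; rewrite /trunc_exp mul0r expR0 mul1r /cst; case: (`|x - x0| <= M%:R).
  by rewrite integral_cst// mul1e probability_le1.
have := @tilt_lower R (psi M) K (8 * M%:R ^+ 2 * expR M%:R) L d a.
case.
- by move=> r; apply: lt_le_trans (Hl r); rewrite expR_gt0.
- by rewrite !mulr_ge0 ?expR_ge0.
- by [].
- exact: trunc_mgf_cosh.
- exact: Lpsi.
- move=> ee ee0.
  pose ee' := Num.min ee 1.
  have ee'0 : 0 < ee' by rewrite lt_min ee0 ltr01.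
  have [_ [r _ <-] hr] := inf_adherent (mulr_gt0 ee'0 L0) Lh.
  have hr' : psi M r <= (1 + ee') * L by rewrite mulrDl mul1r ltW.
  exists r.
    rewrite leNgt; apply/negP => /(HK _ _ MM).
    have L1 : L <= 1 by apply: le_trans psi1; exact: Lpsi.
    have ee1 : ee' <= 1 by rewrite ge_min lexx orbT.
    rewrite ltNge => /negP; apply; apply: (le_trans hr').
    have : ee' * L <= 1 by rewrite mulr_ile1// ltW.
    lra.
  apply: (le_trans hr'); rewrite ler_wpM2r ?(ltW L0)// lerD2l ge_min lexx//.
- by [].
- by apply: lt_le_trans LaE; rewrite ltr_expR ltrN2.
move=> d' /andP[d'0 d'd] [rho [t [t0 hN]]].
have mB e' := measurable_window x0 e'.
apply: filterS2 (nbhs_infty_gt 0) hN => N N0 hN mu hmu.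
apply: (@le_trans _ _ (fine (mu [set x | `|x - x0| < d']))).
  by apply: hN; apply: sample_window => //; exact: ltW.
apply: fine_le; [by apply: fin_num_measure; exact: mB|by apply: fin_num_measure; exact: mB|].
apply: le_measure; rewrite ?inE; [exact: mB|exact: mB|].
by move=> x /= /lt_le_trans; exact.
Qed.

End CramerLower.

Section SampleLower.
Variables (R : realType) (lam : probability R R).

Lemma sample_chernoff N (mu : probability R R) (t c : R) : (0 < N)%N ->
  is_sample_mean_law lam N mu -> (mgf lam t < +oo)%E ->
  (mu [set x | (c <= t * x)%R] <= (expR (- (c - lmgf lam t)) ^+ N)%:E)%E.
Proof.
move=> N0 hmu ht.
have mA : measurable [set x : R | c <= t * x].
  by apply: measurable_ge_cst; exact: measurable_funM.
have mE : measurable_fun [set: R] (fun x : R => expR (t * (N%:R * x))).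
  apply: measurableT_comp => //.
  by apply: measurable_funM => //; apply: measurable_funM.
have -> : (expR (- (c - lmgf lam t)) ^+ N)%:E
   = (\int[mu]_x (expR (- (N%:R * c)) * expR (t * (N%:R * x)))%:E)%E.
  rewrite integralZl_EFin ?expR_ge0//.
  rewrite (sample_mgf N0 hmu ht) -EFinM -expRD -expRM_natl; congr (expR _)%:E; ring.
rewrite -[X in mu X]setIT -integral_indic//.
apply: le_integral_EFin.
- exact: measurable_indic.
- exact: measurable_funM.
- by move=> x; rewrite indicE.
move=> x; rewrite indicE; have [|_] := boolP (x \in _); last by rewrite mulr_ge0 ?expR_ge0.
rewrite inE /= => h; rewrite -expRD -[leLHS]expR0 ler_expR.
have : N%:R * c <= N%:R * (t * x) by rewrite ler_wpM2l.
lra.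
Qed.

Variable t0 : R.
Hypotheses (t0_gt0 : 0 < t0) (mgfp : (mgf lam t0 < +oo)%E)
  (mgfm : (mgf lam (- t0) < +oo)%E).
Local Notation m := (mean lam).

(** Every slope has t * mean - lmgf t <= 0 (mean_young), so moving towards the
    mean only loses a factor 1 - e in each term of the supremum. *)
Lemma rate_shrink (x e r : R) : 0 <= e <= 1 -> (rate lam x <= r%:E)%E ->
  (rate lam ((1 - e) * x + e * m) <= ((1 - e) * r)%:E)%E.
Proof.
move=> /andP[e0 e1] xr; rewrite leNgt; apply/negP => /rate_gtP[t ht].
have h1 := mean_young t0_gt0 mgfp mgfm ht.
have := le_trans (rate_young x ht) xr; rewrite lee_fin => h2.
have h3 : e * (t * m) <= e * lmgf lam t by rewrite ler_wpM2l.
have h4 : (1 - e) * (t * x - lmgf lam t) <= (1 - e) * r by rewrite ler_wpM2l// subr_ge0.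
lra.
Qed.

(** The weak law of large numbers, from the positivity of the rate away from
    the mean: both tails are exponentially small by Chernoff's bound. *)
Lemma mean_window_lower (d : R) : 0 < d ->
  \forall N \near \oo, forall mu : probability R R,
    is_sample_mean_law lam N mu ->
    2^-1 <= fine (mu [set x | (`|x - m| < d)%R]).
Proof.
move=> d0.
have H s : `|s| = 1 -> exists2 r, 0 <= r < 1 & forall N (mu : probability R R), (0 < N)%N ->
    is_sample_mean_law lam N mu -> (mu [set x | (d <= s * (x - m))%R] <= (r ^+ N)%:E)%E.
  move=> s1.
  have s0 : s != 0 by rewrite -normr_gt0 s1.
  have sm : m + s * d != m by rewrite -subr_eq0 addrAC subrr add0r mulf_neq0// gt_eqF.
  have ss : s * s = 1 by rewrite -expr2 -[LHS]real_normK ?num_real// s1 expr1n.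
  have [t ht tx] := rate_gt0_witness t0_gt0 mgfp mgfm sm.
  have ty := mean_young t0_gt0 mgfp mgfm ht.
  have st : 0 < s * t.
    have : 0 < (s * t) * d by lra.
    by rewrite pmulr_lgt0.
  exists (expR (- (t * (m + s * d) - lmgf lam t))).
    by rewrite expR_ge0 expR_lt1; lra.
  move=> N mu N0 hmu; apply: le_trans (sample_chernoff _ N0 hmu ht).
  apply: le_measure; rewrite ?inE.
  - by apply: measurable_ge_cst; apply: measurable_funM => //; exact: measurable_funB.
  - by apply: measurable_ge_cst; exact: measurable_funM.
  move=> x /= h.
  have := ler_wpM2l (ltW st) h.
  have -> : s * t * (s * (x - m)) = (s * s) * (t * (x - m)) by ring.
  by rewrite ss mul1r; lra.
have [r1 r1b H1] := H _ (normr1 _).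
have [r2 r2b H2] := H _ (normrN1 _).
have i4 : (0 : R) < 4^-1 by [].
apply: filterS3 (nbhs_infty_gt 0) (near_expr_lt r1b i4) (near_expr_lt r2b i4).
move=> N N0 h1 h2 mu hmu.
have {}H1 := H1 N mu N0 hmu; have {}H2 := H2 N mu N0 hmu.
pose A := [set x | (`|x - m| < d)%R].
pose B1 := [set x : R | (d <= 1 * (x - m))%R].
pose B2 := [set x : R | (d <= (-1) * (x - m))%R].
have mA : measurable A by exact: measurable_window.
have mB (s : R) : measurable [set x : R | (d <= s * (x - m))%R].
  by apply: measurable_ge_cst; apply: measurable_funM => //; exact: measurable_funB.
have cover : ~` A `<=` B1 `|` B2.
  move=> x /= /negP; rewrite -leNgt ler_normr => /orP[h|h]; [left|right].
    by rewrite /B1/= mul1r.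
  by rewrite /B2/= mulN1r.
have : (mu (~` A) <= (r1 ^+ N + r2 ^+ N)%:E)%E.
  apply: (@le_trans _ _ (mu (B1 `|` B2))).
    apply: le_measure; rewrite ?inE//; first exact: measurableC.
    by apply: measurableU; exact: mB.
  apply: (le_trans (measureU2 _ _ _)); [exact: mB|exact: mB|].
  by rewrite EFinD leeD.
rewrite probability_setC// -[mu A]fineK ?fin_num_measure// -EFinB lee_fin; lra.
Qed.

(** At x itself all the mass may lie on one side, where cramer_lower says
    nothing. The point y moved towards the mean is strictly between x and the
    mean: no mass beyond y on the side of x would make the rate at x infinite,
    and no mass on the other side would put the mean at y or nearer to x. *)
Lemma sample_lower (x e r d a : R) : 0 < e < 1 -> (rate lam x <= r%:E)%E -> 0 < d ->
  (1 - e) * r < a ->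
  \forall N \near \oo, forall mu : probability R R,
    is_sample_mean_law lam N mu ->
    expR (- (N%:R * a)) <= fine (mu [set z | (`|z - ((1 - e) * x + e * m)| < d)%R]).
Proof.
move=> e01 xr d0 ra; have /andP[e0 e1] := e01.
have r0 : 0 <= r by rewrite -lee_fin (le_trans (rate_ge0 lam x)).
have a0 : 0 < a by rewrite (le_lt_trans _ ra)// mulr_ge0// subr_ge0 ltW.
have [xm|xm] := eqVneq x m.
  have -> : (1 - e) * x + e * m = m by rewrite xm; ring.
  have ra1 : 0 <= expR (- a) < 1 by rewrite expR_ge0 expR_lt1; lra.
  have i2 : (0 : R) < 2^-1 by [].
  apply: filterS2 (near_expr_lt ra1 i2) (mean_window_lower d0) => N h1 h2 mu hmu.
  by rewrite (le_trans _ (h2 mu hmu))// -mulrN expRM_natl ltW.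
set y := (1 - e) * x + e * m.
have ye01 : 0 <= e <= 1 by rewrite !ltW.
have mem1 : (rate lam y < a%:E)%E.
  by apply: le_lt_trans (rate_shrink ye01 xr) _; rewrite lte_fin.
have side (s : R) : `|s| = 1 -> 0 < s * (x - m) ->
    (0 < lam [set w | (0 < s * (w - y))%R])%E /\ (0 < lam [set w | (s * (w - y) < 0)%R])%E.
  move=> s1 sx.
  have ss : s * s = 1 by rewrite -expr2 -[LHS]real_normK ?num_real// s1 expr1n.
  have sxy : 0 < s * (x - y).
    have -> : s * (x - y) = e * (s * (x - m)) by rewrite /y; ring.
    by rewrite mulr_gt0.
  have sym : 0 < s * (y - m).
    have -> : s * (y - m) = (1 - e) * (s * (x - m)) by rewrite /y; ring.
    by rewrite mulr_gt0// subr_gt0.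
  split; rewrite lt_neqAle measure_ge0 andbT; apply/eqP => /esym h0.
    (* With no mass beyond y, lmgf (s u) <= s u y for every u >= 0, whence
       rate x >= u (s (x - y)); this u makes the right-hand side r + 1. *)
    pose u := (r + 1) / (s * (x - y)).
    have u0 : 0 < u by rewrite divr_gt0// ltr_wpDl.
    have h : lam [set w | (s * u * y < s * u * w)%R] = 0%E.
      rewrite -[RHS]h0; congr (lam _); apply/funext => w /=; congr is_true.
      by rewrite -subr_gt0 -mulrBr mulrAC pmulr_lgt0.
    have hm := mgf_le_of_null h.
    have ht := le_lt_trans hm (ltry _).
    move: hm; rewrite mgf_fin// lee_fin ler_expR => hm.
    have := le_trans (rate_young x ht) xr; rewrite lee_fin => hr.
    have E : u * (s * (x - y)) = r + 1 by rewrite /u divfK// gt_eqF.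
    lra.
  have h : lam [set w | (- s * y < - s * w)%R] = 0%E.
    rewrite -[RHS]h0; congr (lam _); apply/seteqP; split => w /=; lra.
  have hm := mgf_le_of_null h.
  have ht := le_lt_trans hm (ltry _).
  move: hm; rewrite mgf_fin// lee_fin ler_expR => hm.
  have := mean_young t0_gt0 mgfp mgfm ht; lra.
have [lp lm] : (0 < lam [set w | (y < w)%R])%E /\ (0 < lam [set w | (w < y)%R])%E.
  have eq1 : [set w : R | (0 < 1 * (w - y))%R] = [set w | (y < w)%R].
    by apply/seteqP; split => w /=; rewrite mul1r subr_gt0.
  have eq2 : [set w : R | (1 * (w - y) < 0)%R] = [set w | (w < y)%R].
    by apply/seteqP; split => w /=; rewrite mul1r subr_lt0.
  have eq3 : [set w : R | (0 < (-1) * (w - y))%R] = [set w | (w < y)%R].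
    by apply/seteqP; split => w /=; rewrite mulN1r oppr_gt0 subr_lt0.
  have eq4 : [set w : R | ((-1) * (w - y) < 0)%R] = [set w | (y < w)%R].
    by apply/seteqP; split => w /=; rewrite mulN1r oppr_lt0 subr_gt0.
  have [xm0|xm0] := ltP m x.
    by have := side 1 (normr1 _); rewrite mul1r subr_gt0 eq1 eq2 => /(_ xm0).
  have [|h1 h2] := side (-1) (normrN1 _).
    by rewrite mulN1r oppr_gt0 subr_lt0 lt_neqAle xm.
  by rewrite -eq4 -eq3.
exact: cramer_lower.
Qed.
End SampleLower.

(** * The rate function of a fair spin *)

Section Rate0.
Variable R : realType.
Implicit Types (u v y c e r : R).

(** The logarithmic moment generating function of a fair spin, of which rate0
    is the Legendre transform. *)
Definition lcosh u : R := ln ((expR u + expR (- u)) / 2).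

Let cosh_gt0 u : 0 < (expR u + expR (- u)) / 2.
Proof. by rewrite divr_gt0// addr_gt0 ?expR_gt0. Qed.

Lemma expR_lcosh u : expR (lcosh u) = (expR u + expR (- u)) / 2.
Proof. by rewrite /lcosh lnK// posrE. Qed.

Lemma lcoshN u : lcosh (- u) = lcosh u.
Proof. by rewrite /lcosh opprK addrC. Qed.

Lemma lcosh0 : lcosh 0 = 0.
Proof.
rewrite /lcosh oppr0 expR0; have -> : (1 + 1) / 2 = 1 :> R by field.
exact: ln1.
Qed.

Lemma lcosh_ge0 u : 0 <= lcosh u.
Proof.
have h1 := expR_ge1Dx u; have h2 := expR_ge1Dx (- u).
rewrite -ler_expR expR0 expR_lcosh; lra.
Qed.

(** The convexity argument of lmgf_scale, for the fair spin. *)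
Lemma lcosh_scale u th : 0 <= th <= 1 -> lcosh (th * u) <= th * lcosh u.
Proof.
move=> th01; have /andP[th0 th1] := th01.
set l := lcosh u.
have El : expR l = (expR u + expR (- u)) / 2 := expR_lcosh u.
have h1 := expR_convex (u - l) th01; have h2 := expR_convex (- u - l) th01.
rewrite -ler_expR expR_lcosh.
have E1 : expR (th * u) = expR (th * l) * expR (th * (u - l)).
  by rewrite -expRD; congr expR; ring.
have E2 : expR (- (th * u)) = expR (th * l) * expR (th * (- u - l)).
  by rewrite -expRD; congr expR; ring.
rewrite E1 E2 -mulrDr -mulrA; apply: ler_piMr; first exact: expR_ge0.
have E3 : expR (u - l) + expR (- u - l) = 2.
  by rewrite !expRD -mulrDl (expRN l) El; field; rewrite gt_eqF// addr_gt0 ?expR_gt0.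
have E4 : th * expR (u - l) + th * expR (- u - l) = th * 2 by rewrite -mulrDr E3.
lra.
Qed.

Lemma rate0_in y : `|y| < 1 -> rate0 y =
  ((1 + y) / 2 * ln (1 + y) + (1 - y) / 2 * ln (1 - y))%:E.
Proof. by rewrite /rate0 => ->. Qed.

(** This is artanh y, the slope at which the Legendre transform is attained
    for |y| < 1. *)
Definition tilt0 y : R := (ln (1 + y) - ln (1 - y)) / 2.

Lemma rate0_tilt0 y : `|y| < 1 -> rate0 y = (tilt0 y * y - lcosh (tilt0 y))%:E.
Proof.
move=> y1; rewrite rate0_in//; move: y1; rewrite ltr_norml => /andP[y1 y2].
have a0 : 0 < 1 + y by lra.
have b0 : 0 < 1 - y by lra.
have -> : lcosh (tilt0 y) = - ((ln (1 + y) + ln (1 - y)) / 2).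
  rewrite -[RHS]expRK -/(lcosh _) /lcosh; congr ln.
  apply: (mulfI (lt0r_neq0 (expR_gt0 ((ln (1 + y) + ln (1 - y)) / 2)))).
  rewrite mulrA mulrDr -!expRD subrr expR0 /tilt0.
  have -> : (ln (1 + y) + ln (1 - y)) / 2 + (ln (1 + y) - ln (1 - y)) / 2 = ln (1 + y) by field.
  have -> : (ln (1 + y) + ln (1 - y)) / 2 - (ln (1 + y) - ln (1 - y)) / 2 = ln (1 - y) by field.
  by rewrite !lnK ?posrE//; field.
by congr EFin; rewrite /tilt0; field.
Qed.

(** For |y| < 1 this is Gibbs' inequality between the laws of mean y and the
    law tilted by u, obtained from the tangent to the exponential at each of
    the two spin values; for |y| = 1 it is 2 cosh u >= e^|u|. *)
Lemma rate0_young u y : ((u * y - lcosh u)%:E <= rate0 y)%E.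
Proof.
have C0 := cosh_gt0 u; set C := (_ / 2) in C0.
have lC : expR (lcosh u) = C := expR_lcosh u.
rewrite /rate0; case: ifPn => [|y1].
  rewrite ltr_norml => /andP[y1 y2]; rewrite lee_fin.
  have a0 : 0 < 1 + y by lra.
  have b0 : 0 < 1 - y by lra.
  have h a w : 0 < a -> a / 2 * (w - lcosh u - ln a) <= expR w / (2 * C) - a / 2.
    move=> a1; have := expR_ge1Dx (w - lcosh u - ln a).
    rewrite !expRD expRN lC expRN lnK ?posrE// => hh.
    have : a / 2 * (1 + (w - lcosh u - ln a)) <= a / 2 * (expR w / C / a).
      by rewrite ler_wpM2l// divr_ge0// ltW.
    have -> : a / 2 * (expR w / C / a) = expR w / (2 * C) by field; rewrite !gt_eqF.
    lra.
  have h1 := h _ u a0; have h2 := h _ (- u) b0.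
  have E : expR u / (2 * C) + expR (- u) / (2 * C) = 1.
    rewrite -mulrDl /C; field; rewrite gt_eqF// addr_gt0 ?expR_gt0//.
  lra.
case: ifPn => [/eqP y1'|_]; last exact: leey.
rewrite lee_fin lerBlDr -ler_expR expRD lC lnK ?posrE//.
have -> : 2 * C = expR u + expR (- u) by rewrite /C; field.
have := expR_ge0 u; have := expR_ge0 (- u).
move: y1'; case: (ger0P y) => _; first by move=> ->; rewrite mulr1; lra.
by move=> /(congr1 -%R); rewrite opprK => ->; rewrite mulrN1; lra.
Qed.

(** The asymptote v - log 2 with an explicit error: it yields the value log 2
    of rate0 at the end points, where the supremum is not attained. *)
Lemma lcosh_le_asymptote v : lcosh v <= v - ln 2 + expR (- (v + v)).
Proof.
have -> : lcosh v = v - ln 2 + ln (1 + expR (- (v + v))).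
  have e0 : 0 < 1 + expR (- (v + v)) by rewrite addr_gt0 ?expR_gt0.
  rewrite -[RHS]expRK /lcosh; congr ln.
  rewrite !expRD (expRN (ln 2)) !lnK ?posrE//.
  have -> : expR (- (v + v)) = (expR v)^-1 * (expR v)^-1 by rewrite opprD expRD expRN.
  rewrite expRN; field; rewrite gt_eqF// expR_gt0//.
by rewrite lerD2l le_ln1Dx// (lt_trans _ (expR_gt0 _)).
Qed.

(** The supremum of the Legendre transform is attained for |y| < 1, approached
    for |y| = 1 along the asymptote of lcosh, and infinite for |y| > 1 because
    lcosh v <= v for v >= 0. *)
Lemma rate0_gtP c y : (c%:E < rate0 y)%E -> exists u, c < u * y - lcosh u.
Proof.
have [y1|y1] := ltP `|y| 1.
  by rewrite rate0_tilt0// lte_fin => h; exists (tilt0 y).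
have h v : exists u, u * y - lcosh u = v * `|y| - lcosh v.
  case: (ger0P y) => _; first by exists v.
  by exists (- v); rewrite lcoshN mulNr mulrN.
have ltNge_y1 : (`|y| < 1) = false by rewrite ltNge y1.
rewrite /rate0 ltNge_y1 /=; case: ifPn => [/eqP y1'|y1'].
  rewrite lte_fin => h2.
  have e0 : 0 < ln 2 - c by rewrite subr_gt0.
  (* This slope makes the error e^(- 2 v) of the asymptote smaller than ln 2
     - c. *)
  have [u Eu] := h ((1 - ln (ln 2 - c)) / 2).
  exists u; rewrite Eu y1' mulr1.
  set v := (_ / 2); have := lcosh_le_asymptote v.
  have : expR (- (v + v)) < ln 2 - c.
    rewrite -[ltRHS]lnK// ltr_expR /v; lra.
  lra.
move=> _; have y2 : 1 < `|y| by rewrite lt_neqAle eq_sym y1'.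
have y0 : 0 < `|y| - 1 by lra.
pose v := `|c| / (`|y| - 1) + 1.
have v0 : 0 < v by rewrite /v ltr_wpDl// divr_ge0// ltW.
have [u Eu] := h v; exists u; rewrite Eu.
have l2 : lcosh v <= v.
  rewrite -ler_expR expR_lcosh.
  have : expR (- v) <= expR v by rewrite ler_expR; lra.
  lra.
have E : v * (`|y| - 1) = `|c| + (`|y| - 1) by rewrite /v mulrDl mul1r divfK// gt_eqF.
have := ler_norm c; lra.
Qed.

Lemma rate0_ge0 y : (0 <= rate0 y)%E.
Proof. by have := rate0_young 0 y; rewrite mul0r lcosh0 subrr. Qed.

Lemma rate0_shrink y e r : 0 <= e <= 1 -> (rate0 y <= r%:E)%E ->
  (rate0 ((1 - e) * y) <= ((1 - e) * r)%:E)%E.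
Proof.
move=> /andP[e0 e1] yr; rewrite leNgt; apply/negP => /rate0_gtP[u hu].
have := le_trans (rate0_young u y) yr; rewrite lee_fin => h.
have h4 : (1 - e) * (u * y - lcosh u) <= (1 - e) * r by rewrite ler_wpM2l// subr_ge0.
have h3 : 0 <= e * lcosh u by rewrite mulr_ge0// lcosh_ge0.
lra.
Qed.

Lemma rate0_fin y r : (rate0 y <= r%:E)%E -> `|y| <= 1.
Proof.
rewrite /rate0; case: ifPn => [/ltW//|_]; case: ifPn => [/eqP ->//|_].
by rewrite leye_eq.
Qed.

End Rate0.

(** * Sums over configurations, block by block *)

Section Blocks.
Variable R : realType.

Lemma big_tuple_cons k (G : seq bool -> R) :
  \sum_(t : k.+1.-tuple bool) G t = \sum_(b : bool) \sum_(t : k.-tuple bool) G (b :: t).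
Proof.
rewrite pair_bigA /=.
rewrite (reindex (fun p : bool * k.-tuple bool => [tuple of p.1 :: p.2])) //=.
exists (fun t : k.+1.-tuple bool => (thead t, [tuple of behead t])).
  by move=> [b t] _; congr pair; apply/val_inj.
by move=> t _; apply/val_inj; case/tupleP: t.
Qed.

Lemma big_tuple0 (G : seq bool -> R) : \sum_(t : 0.-tuple bool) G t = G [::].
Proof.
rewrite (big_pred1 [tuple])//.
by move=> t; apply/esym/eqP/val_inj; rewrite tuple0.
Qed.

Lemma big_tuple_cat a b (G : seq bool -> R) :
  \sum_(t : (a + b).-tuple bool) G t
  = \sum_(t : a.-tuple bool) \sum_(u : b.-tuple bool) G (t ++ u).
Proof.
elim: a G => [|a IH] G.
  by rewrite [RHS](@big_tuple0 (fun s => \sum_(u : b.-tuple bool) G (s ++ u))).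
rewrite [LHS](@big_tuple_cons (a + b)).
rewrite [RHS](@big_tuple_cons a (fun s => \sum_(u : b.-tuple bool) G (s ++ u))).
by apply: eq_bigr => x _; rewrite (IH (fun s => G (x :: s))).
Qed.

Lemma big_tuple_prod k (F : bool -> R) :
  \sum_(t : k.-tuple bool) \prod_(b <- t) F b = (F true + F false) ^+ k.
Proof.
elim: k => [|k IH]; first by rewrite [LHS](big_tuple0 (fun s => \prod_(b <- s) F b)) big_nil.
rewrite [LHS](@big_tuple_cons k (fun s => \prod_(b <- s) F b)) big_bool exprS mulrDl -IH !mulr_sumr.
by congr (_ + _); apply: eq_bigr => t _; rewrite big_cons.
Qed.

(** Cutting a configuration into blocks of prescribed sizes is a bijection;
    peeling off the first block proves the factorisation without exhibiting
    it. *)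
Lemma big_reshape (sh : seq nat) (F : nat -> seq bool -> R) :
  \sum_(t : (sumn sh).-tuple bool) \prod_(0 <= i < size sh) F i (nth [::] (reshape sh t) i)
  = \prod_(0 <= i < size sh) \sum_(t : (nth 0%N sh i).-tuple bool) F i t.
Proof.
elim: sh F => [|a sh IH] F.
  rewrite big_geq//.
  under eq_bigr do rewrite big_geq//.
  by rewrite [LHS](big_tuple0 (fun=> 1)).
rewrite [size _]/=.
rewrite [LHS](@big_tuple_cat a (sumn sh) (fun t => \prod_(0 <= i < (size sh).+1)
  F i (nth [::] (reshape (a :: sh) t) i))).
rewrite big_nat_recl//= mulr_suml; apply: eq_bigr => t _.
rewrite -(IH (fun i => F i.+1)) mulr_sumr; apply: eq_bigr => u _.
rewrite big_nat_recl//= take_size_cat ?size_tuple//; congr (_ * _).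
by apply: eq_bigr => i _; rewrite drop_size_cat ?size_tuple.
Qed.

Variables (n : nat) (k : 'I_n -> nat) (N : nat).
Hypothesis kN : (\sum_(i < n) k i)%N = N.

Lemma sumn_codom : sumn (codom k) = N.
Proof. by rewrite sumnE big_map -kN big_enum. Qed.

Lemma nth_codom_ord (T : Type) (x0 : T) (f : 'I_n -> T) (i : 'I_n) : nth x0 (codom f) i = f i.
Proof. by rewrite (nth_map i) ?size_enum_ord// nth_ord_enum. Qed.

Lemma big_blocks (F : 'I_n -> seq bool -> R) :
  \sum_(t : N.-tuple bool) \prod_(i < n) F i (block k t i)
  = \prod_(i < n) \sum_(t : (k i).-tuple bool) F i t.
Proof.
rewrite -sumn_codom.
pose F' j s := if insub j is Some i then F i s else 0.
have F'E (i : 'I_n) s : F' i s = F i s by rewrite /F' valK.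
have := big_reshape (codom k) F'.
rewrite size_codom card_ord big_mkord => E.
transitivity (\prod_(i < n) \sum_(t : (nth 0%N (codom k) i).-tuple bool) F' i t); last first.
  apply: eq_bigr => i _; rewrite nth_codom_ord.
  by apply: eq_bigr => t _; rewrite F'E.
rewrite -E; apply: eq_bigr => t _; rewrite big_mkord; apply: eq_bigr => i _.
by rewrite F'E.
Qed.

Lemma size_block (t : N.-tuple bool) i : size (block k t i) = k i.
Proof.
have h : shape (reshape (codom k) t) = codom k.
  by apply: reshapeKl; rewrite sumn_codom size_tuple.
have := congr1 (fun s => nth 0%N s i) h; rewrite nth_codom_ord => <-.
by rewrite /shape (nth_map [::])// size_reshape size_codom card_ord.
Qed.

Lemma sum_blocks (F : bool -> R) (t : N.-tuple bool) :
  \sum_(b <- t) F b = \sum_(i < n) \sum_(b <- block k t i) F b.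
Proof.
rewrite -[X in \sum_(b <- X) _ = _](@reshapeKr _ (codom k)); last first.
  by rewrite sumn_codom size_tuple.
rewrite big_flatten /= (big_nth [::]) size_reshape size_codom card_ord big_mkord.
by [].
Qed.

End Blocks.

(** * Counting the spins of a block with a given magnetisation *)

Section SpinCount.
Variable R : realType.

Lemma sum_spin_exp k (u : R) :
  \sum_(t : k.-tuple bool) expR (u * \sum_(b <- t) spin R b) = expR (k%:R * (ln 2 + lcosh u)).
Proof.
rewrite expRM_natl expRD lnK ?posrE// expR_lcosh.
have -> : 2 * ((expR u + expR (- u)) / 2) = expR (u * spin R true) + expR (u * spin R false).
  by rewrite /spin mulr1 mulrN1; field.
rewrite -(big_tuple_prod k (fun b => expR (u * spin R b))); apply: eq_bigr => t _.
by rewrite mulr_sumr expR_sum.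
Qed.

Definition spin_window (v D : R) (t : seq bool) : bool :=
  `|\sum_(b <- t) spin R b - v| < D.

(** tilt_lower for the uniform law on spin sequences, with psi r = e^(lcosh r
    - r v). Its minimiser is tilt0 v exactly, so no truncation is needed; the
    2^k between counts and probabilities gives the ln 2. *)
Lemma spin_count (v d a : R) : `|v| < 1 -> 0 < d -> (rate0 v < a%:E)%E ->
  \forall k \near \oo, expR (k%:R * (ln 2 - a)) <=
    \sum_(t : k.-tuple bool) (spin_window (k%:R * v) (k%:R * d) t)%:R.
Proof.
move=> v1 d0; rewrite rate0_tilt0// lte_fin => va.
pose psi r := expR (lcosh r - r * v).
have psiE r : psi r = (expR (r * (1 - v)) + expR (r * (- 1 - v))) / 2.
  rewrite /psi expRD expR_lcosh mulrAC mulrDl -!expRD.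
  by congr ((expR _ + expR _) / 2); ring.
pose L := psi (tilt0 v).
(* The constant of expR_cosh_le for the values 1 - v and - 1 - v, bounded by
   2. It is kept abstract for the linear arithmetic below. *)
have [K K0 KE] : exists2 K : R, 0 <= K & K = 8 * 2 ^+ 2 * expR 2.
  by exists (8 * 2 ^+ 2 * expR 2); rewrite // mulr_ge0 ?expR_ge0.
have := @tilt_lower R psi `|tilt0 v| K L d a.
have vb : -1 < v < 1 by rewrite -ltr_norml.
case.
- by move=> r; rewrite expR_gt0.
- by [].
- by [].
- move=> r t t01.
  have h1 := @expR_cosh_le R 2 (1 - v) t; have h2 := @expR_cosh_le R 2 (- 1 - v) t.
  rewrite -KE in h1 h2.
  have b1 : `|1 - v| <= 2 by rewrite ler_norml; lra.
  have b2 : `|-1 - v| <= 2 by rewrite ler_norml; lra.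
  have {}h1 := ler_wpM2l (expR_ge0 (r * (1 - v))) (h1 b1 t01).
  have {}h2 := ler_wpM2l (expR_ge0 (r * (- 1 - v))) (h2 b2 t01).
  rewrite !psiE [(r + t) * (1 - v)]mulrDl [(r + t) * (-1 - v)]mulrDl.
  rewrite [(r - t) * (1 - v)]mulrDl [(r - t) * (-1 - v)]mulrDl !expRD !mulNr.
  lra.
- move=> r; rewrite /L /psi ler_expR.
  have := rate0_young r v; rewrite rate0_tilt0// lee_fin; lra.
- move=> e e0; exists (tilt0 v) => //; rewrite -/L ler_peMl ?expR_ge0//; lra.
- by [].
- by rewrite /L /psi ltr_expR; lra.
move=> d' /andP[d'0 d'd] [rho [t [t0 hN]]].
apply: filterS2 (nbhs_infty_gt 0) hN => k k0 hN.
pose cnt D := \sum_(t : k.-tuple bool) (spin_window (k%:R * v) (k%:R * D) t)%:R : R.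
have psik r : psi r ^+ k = 2 ^- k *
   \sum_(t : k.-tuple bool) expR (r * (\sum_(b <- t) spin R b - k%:R * v)).
  under eq_bigr do rewrite mulrBr expRD.
  rewrite -mulr_suml sum_spin_exp -expRD /psi -expRM_natl.
  have -> : (2 : R) ^- k = expR (- (k%:R * ln 2)) by rewrite expRN expRM_natl lnK ?posrE.
  by rewrite -expRD; congr expR; ring.
have h : psi rho ^+ k <= expR (`|rho| * (k%:R * d')) * (2 ^- k * cnt d') +
    expR (- (t * (k%:R * d'))) * (psi (rho + t) ^+ k + psi (rho - t) ^+ k).
  rewrite !psik -mulrDr [X in _ <= X + _]mulrCA [X in _ <= _ + X]mulrCA -mulrDr.
  rewrite ler_pM2l ?invr_gt0 ?exprn_gt0// -big_split/= /cnt !mulr_sumr -big_split/=.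
  apply: ler_sum => s _.
  exact: expR_window_le (ltW t0).
have {}h := hN _ h.
have E : expR (k%:R * (ln 2 - a)) = 2 ^+ k * expR (- (k%:R * a)).
  by rewrite mulrBr expRD expRM_natl lnK ?posrE.
rewrite E; apply: (@le_trans _ _ (cnt d')).
  by rewrite -ler_pdivlMl ?exprn_gt0.
apply: ler_sum => s _; rewrite ler_nat /spin_window.
case: ltP => // h1; rewrite (lt_le_trans h1)//.
by rewrite ler_wpM2l.
Qed.

(** A block has length k N, close to p N, and its magnetisation is normalised
    by N: the rate at y / p counts k N times, that is p N times up to an error
    absorbed by the gap between rate and a. *)
Lemma block_count (k : nat -> nat) (p y d a : R) : 0 < p ->
  ((k N)%:R / N%:R : R) @[N --> \oo] --> p -> `|y| < p -> 0 < d ->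
  (p%:E * rate0 (y / p) < a%:E)%E ->
  \forall N \near \oo, expR (N%:R * (p * ln 2 - a)) <=
    \sum_(t : (k N).-tuple bool) (`|N%:R^-1 * (\sum_(b <- t) spin R b) - y| < d)%R%:R.
Proof.
move=> p0 kp yp d0; set v := y / p => va.
have v1 : `|v| < 1 by rewrite normrM normfV (gtr0_norm p0) ltr_pdivrMr// mul1r.
have yE : y = p * v by rewrite /v mulrC divfK// gt_eqF.
rewrite rate0_tilt0// -EFinM lte_fin in va; set r := (_ - _) in va.
have rE : rate0 v = r%:E by rewrite rate0_tilt0.
pose a' := (r + a / p) / 2.
have ra : r < a / p by rewrite ltr_pdivlMr// mulrC.
have ra' : r < a' by rewrite /a'; lra.
have a'a : p * a' < a by rewrite mulrC -ltr_pdivlMr// /a'; lra.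
pose d' := d / (2 * (p + 1)).
have p1 : 0 < 2 * (p + 1) by lra.
have d'0 : 0 < d' by rewrite divr_gt0.
have := @spin_count v d' a' v1 d'0; rewrite rE lte_fin => /(_ ra') [k0 _ hk0].
(* The four terms: k N / N is at most p + 1, the error on p v is at most d /
   2, k N tends to infinity with N, and replacing k N by p N changes the
   exponent by at most N (a - p a'). *)
pose e := Num.min (Num.min 1 (d / 2)) (Num.min (p / 2) ((a - p * a') / (`|ln 2 - a'| + 1))).
have l0 : 0 < `|ln 2 - a'| + 1 by rewrite ltr_pwDr.
have e0 : 0 < e.
  by rewrite !lt_min ltr01 !divr_gt0// subr_gt0.
have e1 : e <= 1 by rewrite /e !ge_min lexx.
have e2 : e <= d / 2 by rewrite /e !ge_min lexx orbT.
have e3 : e <= p / 2 by rewrite /e !ge_min lexx !orbT.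
have e4 : e * (`|ln 2 - a'| + 1) <= a - p * a'.
  by rewrite -ler_pdivlMr// /e !ge_min lexx !orbT.
have near1 : \forall N \near \oo, `|(k N)%:R / N%:R - p| < e.
  by move/cvgrPdist_lt : kp => /(_ _ e0); apply: filterS => N; rewrite distrC.
near=> N.
have N0 : (0 < N)%N by near: N; exact: nbhs_infty_gt.
have N0' : 0 < N%:R :> R by rewrite ltr0n.
have hN : `|(k N)%:R / N%:R - p| < e by near: N.
have NE : (k N)%:R = N%:R * ((k N)%:R / N%:R) :> R by rewrite mulrC divfK// gt_eqF.
set x := (_ / _) in hN NE.
have hx : p - e < x < p + e by rewrite -ltr_distl.
have kN0 : (k0 <= k N)%N.
  rewrite -(ler_nat R) NE.
  have : k0%:R * (2 / p) <= N%:R.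
    near: N; exists (Num.truncn (k0%:R * (2 / p))).+1 => // N' /= hN'.
    by rewrite (le_trans (ltW (truncnS_gt _)))// ler_nat.
  rewrite mulrA ler_pdivrMr// => h.
  have : N%:R * (p / 2) <= N%:R * x by rewrite ler_pM2l//; lra.
  lra.
apply: (@le_trans _ _ (expR ((k N)%:R * (ln 2 - a')))).
  rewrite ler_expR NE -mulrA ler_pM2l//.
  have : (p - x) * (ln 2 - a') <= e * (`|ln 2 - a'| + 1).
    rewrite (le_trans (ler_norm _))// normrM; apply: ler_pM => //.
      by rewrite distrC ltW.
    by rewrite lerDl.
  lra.
apply: (le_trans (hk0 _ kN0)); apply: ler_sum => t _; rewrite ler_nat /spin_window.
case: ltP => // h1; rewrite lt0b.
set S := \sum_(b <- t) _ in h1 *.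
have -> : N%:R^-1 * S - y = N%:R^-1 * (S - (k N)%:R * v) + (x - p) * v.
  by rewrite yE NE; field; rewrite gt_eqF.
rewrite (le_lt_trans (ler_normD _ _))// [X in X + _]normrM [X in _ + X]normrM (gtr0_norm (_ : 0 < N%:R^-1)) ?invr_gt0//.
have h2 : N%:R^-1 * `|S - (k N)%:R * v| < x * d'.
  by rewrite mulrC ltr_pdivrMr// mulrAC [x * _]mulrC -NE.
have h3 : x * d' <= d / 2.
  have E : (p + 1) * d' = d / 2 by rewrite /d'; field; rewrite gt_eqF//; lra.
  by rewrite -E ler_wpM2r ?(ltW d'0)//; lra.
have h4 : `|x - p| * `|v| <= e * 1 by rewrite ler_pM// ltW.
lra.
Unshelve. all: by end_near. Qed.

End SpinCount.

(** * Boxes and compactness *)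

Section Boxes.
Variables (R : realType) (K : finType).

(** As K is finite, these sup-norm balls form a base of neighbourhoods for
    pointwise convergence. *)
Definition box (z : K -> R) (e : R) : set {ptws K -> R} :=
  [set z' | forall j, `|z' j - z j| < e].

Lemma nbhs_box (z : {ptws K -> R}) (e : R) : 0 < e -> nbhs z (box z e).
Proof.
move=> e0; rewrite /box.
have H (j : K) : \forall z' \near z, `|z' j - z j| < e.
  have C : (fun z' : {ptws K -> R} => (z' j : R)) @ z --> (z j : R).
    exact: (@proj_continuous K (fun=> R) j z).
  move/cvgrPdist_lt : C => /(_ e e0).
  by apply: filterS => z'; rewrite distrC.
exact: (@filter_forall _ _ (fun j (z' : {ptws K -> R}) => `|z' j - z j| < e) _ _ H).
Qed.

Lemma continuous_box (f : {ptws K -> R} -> R) : continuous f ->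
  forall (x : K -> R) (e : R), 0 < e -> exists2 d, 0 < d &
    forall x', (forall j, `|x' j - x j| < d) -> `|f x' - f x| < e.
Proof.
move=> cf x e e0; apply: contrapT => H.
have {}H (n : nat) : exists x' : K -> R, (forall j, `|x' j - x j| < n.+1%:R^-1) /\ ~ (`|f x' - f x| < e).
  apply: contrapT => /forallNP h; apply: H; exists (n.+1%:R^-1); first by rewrite invr_gt0.
  by move=> x' hx'; apply: contrapT => h'; exact: (h x').
have [u Hu] := choice H.
have cu : {ptws, u n @[n --> \oo] --> (x : {ptws K -> R})}.
  apply/cvg_sup => j.
  rewrite cvg_image; last by rewrite eqEsubset; split=> v // _; exists (fun=> v).
  suff cj : u n j @[n --> \oo] --> x j.
    move=> W /cj; rewrite /= ?nbhs_simpl => Q; exists (@^~ j @^-1` W) => //.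
    by rewrite eqEsubset; split => [v [? + <-//]|v Wv]; exists (fun=> v).
  apply/cvgrPdist_lt => d d0; near=> n.
  rewrite distrC (lt_trans ((Hu n).1 j))//.
  near: n; exists (Num.truncn d^-1) => // n /= hn.
  rewrite -[ltRHS]invrK ltf_pV2 ?posrE ?invr_gt0//.
  by rewrite (lt_le_trans (truncnS_gt _))// ler_nat ltnS.
have : f (u n) @[n --> \oo] --> f x.
  exact: (cvg_comp _ _ cu (cf x)).
move=> /cvgrPdist_lt /(_ _ e0) [m _ /(_ m (leqnn m))] h.
by apply: (Hu m).2; rewrite distrC.
Unshelve. all: by end_near. Qed.

(** Compactness of a product of segments, used in its near-covering form: it
    applies directly to any property Q of boxes, and no cover indexed by a set
    has to be built. *)
Lemma compact_box_cover (M : K -> R) (Q : set {ptws K -> R} -> Prop) :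
  (forall z, (forall j, `|z j| <= M j) -> exists2 e, 0 < e & Q (box z e)) ->
  exists s : seq (set {ptws K -> R}), (forall U, List.In U s -> Q U) /\
    (forall z, (forall j, `|z j| <= M j) -> exists2 U, List.In U s & U z).
Proof.
have cA := @tychonoff K (fun=> R) (fun j => `[- M j, M j]%classic)
  (fun j => @segment_compact R (- M j) (M j)).
set A := [set _ | _] in cA.
move=> H.
have AE z : A z = forall j, `|z j| <= M j.
  by rewrite /A /=; apply/propext; split => h j; have := h j; rewrite in_itv/= ler_norml.
have {}H (z : {ptws K -> R}) : exists e, A z -> 0 < e /\ Q (box z e).
  have [Az|nAz] := pselect (A z); last by exists 0.
  by move: (Az); rewrite AE => /H[e e0 Qe]; exists e.
(* Along this filter lists grow by members of Q, so that a single list will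
   eventually serve all the points. *)
pose F : set_system (seq (set {ptws K -> R})) := fun E => exists s0,
  (forall U, List.In U s0 -> Q U) /\
  forall s, (forall U, List.In U s0 -> List.In U s) -> E s.
have FF : Filter F.
  split.
  - by exists [::].
  - move=> E1 E2 [s1 [Q1 H1]] [s2 [Q2 H2]]; exists (s1 ++ s2); split.
      by move=> U /List.in_app_iff[/Q1|/Q2].
    by move=> s hs; split; [apply: H1|apply: H2] => U hU; apply: hs;
      apply/List.in_app_iff; [left|right].
  - move=> E1 E2 E12 [s1 [Q1 H1]]; exists s1; split => // s /H1; exact: E12.
have := (@compact_near_coveringP {ptws K -> R} A).1 cA _ F (fun s z => exists2 U, List.In U s & U z) FF.
case.
  move=> z Az; have [e /(_ Az)[e0 Qe]] := H z.
  exists (box z e, [set s | List.In (box z e) s]); last first.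
    by move=> [z' s] /= [h1 h2]; exists (box z e).
  split => /=; first exact: nbhs_box.
  exists [:: box z e]; split; first by move=> U /= [<-|//].
  by move=> s /=; apply; left.
move=> s0 [Qs0 /(_ s0 (fun _ h => h)) hs]; exists s0; split => // z hz.
by apply: hs; rewrite AE.
Qed.

(** If some term is infinite it can be replaced by a large real, which allows
    - 1 for the others; otherwise every term is lowered by a fraction of the
    gap. *)
Lemma lte_sum_real (P : pred K) (g : K -> \bar R) (b : R) :
  (forall j, (0 <= g j)%E) -> (b%:E < \sum_(j | P j) g j)%E ->
  exists c : K -> R, (forall j, P j -> ((c j)%:E < g j)%E) /\ b < \sum_(j | P j) c j.
Proof.
move=> g0 bg.
have [/existsP[j0 /andP[Pj0 /eqP gj0]]|/existsPn fin] := boolP [exists j, P j && (g j == +oo%E)].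
  (* The value at j0 makes up for the - 1 of all the other terms. *)
  pose c j := if j == j0 then `|b| + 1 + \sum_(i | P i && (i != j0)) 1 else -1 : R.
  exists c; split.
    move=> j Pj; rewrite /c; case: eqP => [->|_]; first by rewrite gj0 ltry.
    by apply: lt_le_trans (g0 j); rewrite lte_fin.
  rewrite (bigD1 j0)//= {1}/c eqxx.
  rewrite [X in _ < _ + X](eq_bigr (fun=> -1)); last first.
    by move=> i /andP[_ /negbTE ij]; rewrite /c ij.
  rewrite sumrN -addrA addrN addr0 (le_lt_trans (ler_norm b))//.
  by rewrite ltrDl.
have gE j : P j -> g j = (fine (g j))%:E.
  move=> Pj; rewrite fineK// ge0_fin_numE// ltey.
  by have := fin j; rewrite Pj.
rewrite (eq_bigr _ gE) sumEFin lte_fin in bg.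
set s := \sum_(j | P j) _ in bg.
pose n := \sum_(j | P j) 1 : R.
have n0 : 0 <= n by apply: sumr_ge0.
pose k := (s - b) / (n + 1).
have n1 : 0 < n + 1 by lra.
have k0 : 0 < k by rewrite divr_gt0// subr_gt0.
exists (fun j => fine (g j) - k); split.
  by move=> j Pj; rewrite [ltRHS]gE// lte_fin; lra.
rewrite sumrB -/s (_ : \sum_(j | P j) k = n * k); last first.
  by rewrite /n mulr_suml; apply: eq_bigr => j _; rewrite mul1r.
have E : k * (n + 1) = s - b by rewrite /k divfK// gt_eqF.
lra.
Qed.

End Boxes.

(** * From exponential sums to an upper bound *)

(** A deterministic Laplace principle for points zeta s of R^K. As for
    Legendre transforms, values below the rate g j are exceeded by tau z - L j
    tau for some rational slope tau; KA a is the set of the coordinates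
    subject to the constraint a, and top is the constraint on all of them. The
    probabilistic input consists of linear_upper (no configuration violates a
    linear consequence of a constraint) and expmoment_upper (the exponential
    sums), for rational slopes. *)
Section DeterministicUpper.
Variables (R : realType) (K A : finType) (KA : A -> pred K) (top : A) (b : A -> R).
Variables (dom : K -> R -> Prop) (L : K -> R -> R) (g : K -> R -> \bar R).
Hypothesis KAtop : forall j, KA top j.
Hypothesis dom0 : forall j, dom j 0.
Hypothesis L0 : forall j, L j 0 = 0.
Hypothesis g_ge0 : forall j z, (0 <= g j z)%E.
Hypothesis g_gt : forall j c z, (c%:E < g j z)%E ->
  exists2 q : rat, dom j (ratr q) & c < ratr q * z - L j (ratr q).
Hypothesis dom_pos : forall j, exists2 q : rat, 0 < (ratr q : R) & dom j (ratr q).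
Hypothesis dom_neg : forall j, exists2 q : rat, (ratr q : R) < 0 & dom j (ratr q).
Variables (cfg : nat -> finType) (zeta : forall N, cfg N -> K -> R).
Hypothesis linear_upper : forall a (tau : {ffun K -> rat}),
  (forall j, KA a j -> dom j (ratr (tau j))) -> forall e, 0 < e ->
  \forall N \near \oo, forall s : cfg N,
    \sum_(j | KA a j) (ratr (tau j) * zeta s j - L j (ratr (tau j))) <= b a + e.
Hypothesis expmoment_upper : forall tau : {ffun K -> rat},
  (forall j, dom j (ratr (tau j))) -> forall e, 0 < e ->
  \forall N \near \oo,
    \sum_(s : cfg N) expR (N%:R * \sum_j ratr (tau j) * zeta s j) <=
    expR (N%:R * (\sum_j L j (ratr (tau j)) + b top + e)).

Definition domain (z : K -> R) : Prop :=
  forall a, (\sum_(j | KA a j) g j (z j) <= (b a)%:E)%E.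

Lemma zeta_bounded : exists M : K -> R, \forall N \near \oo,
  forall (s : cfg N) j, `|zeta s j| <= M j.
Proof.
have H j (q : rat) : dom j (ratr q) -> \forall N \near \oo, forall s : cfg N,
    ratr q * zeta s j <= L j (ratr q) + b top + 1.
  move=> dq; pose tau := [ffun i => if i == j then q else 0] : {ffun K -> rat}.
  have := @linear_upper top tau _ 1 ltr01; case.
    by move=> i _; rewrite ffunE; case: eqP => [->//|_]; rewrite rmorph0.
  move=> N0 _ HN; exists N0 => // N hN s.
  have := HN N hN s; rewrite (bigD1 j)//= ffunE eqxx big1; first lra.
  by move=> i /andP[_ /negbTE ij]; rewrite ffunE ij rmorph0 mul0r L0 subrr.
have B j : exists M, \forall N \near \oo, forall s : cfg N, `|zeta s j| <= M.
  have [q1 q10 dq1] := dom_pos j; have [q2 q20 dq2] := dom_neg j.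
  pose M1 := (L j (ratr q1) + b top + 1) / ratr q1.
  pose M2 := (L j (ratr q2) + b top + 1) / (- ratr q2).
  exists (Num.max M1 M2).
  apply: filterS2 (H j q1 dq1) (H j q2 dq2) => N h1 h2 s.
  have nq2 : 0 < - (ratr q2 : R) by rewrite oppr_gt0.
  rewrite ler_norml lerNl !le_max; apply/andP; split; apply/orP; [right|left].
    by rewrite /M2 ler_pdivlMr// mulrNN mulrC; exact: h2.
  by rewrite /M1 ler_pdivlMr// mulrC; exact: h1.
have [M HM] := choice B; exists M.
have : \forall N \near \oo, forall j, forall s : cfg N, `|zeta s j| <= M j.
  exact: (@filter_forall _ _ (fun j N => forall s : cfg N, `|zeta s j| <= M j)).
by apply: filterS => N h s j.
Qed.

Lemma linear_box (tau : K -> R) (P : pred K) (z z' : K -> R) (d : R) :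
  (forall j, `|z' j - z j| < d) ->
  `|\sum_(j | P j) tau j * z' j - \sum_(j | P j) tau j * z j| <= d * \sum_j `|tau j|.
Proof.
move=> h; rewrite -sumrB mulr_sumr [leRHS](bigID P)/= -[leLHS]addr0 lerD//; last first.
  by apply: sumr_ge0 => j _; rewrite mulr_ge0// (le_trans _ (ltW (h j))).
apply: le_trans (ler_norm_sum _ _ _) _; apply: ler_sum => j _.
by rewrite -mulrBr normrM mulrC ler_wpM2r// ltW.
Qed.

Variable G : (K -> R) -> R.
Hypothesis G_cont : forall z e, 0 < e -> exists2 d, 0 < d &
  forall z', (forall j, `|z' j - z j| < d) -> `|G z' - G z| < e.

(** Inside the domain, an exponential Chebyshev inequality with slopes that
    nearly attain the rates: near z the energy and the linear form of the
    slopes are almost constant. Outside the domain, some constraint fails at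
    z, hence a linear consequence of it fails in a whole neighbourhood and
    eventually the sum is empty. *)
Lemma local_upper (c : R) (z : K -> R) :
  (domain z -> ((G z + b top)%:E - \sum_j g j (z j) < c%:E)%E) ->
  exists2 d, 0 < d & \forall N \near \oo,
    \sum_(s : cfg N | `[< box z d (zeta s) >]) expR (N%:R * G (zeta s)) <= expR (N%:R * c).
Proof.
move=> Hc; have [Dz|nDz] := pselect (domain z).
  have {}Hc := Hc Dz.
  have sfin : (\sum_j g j (z j) <= (b top)%:E)%E.
    have := Dz top; rewrite (eq_bigl xpredT)// => j; exact: KAtop.
  have gle j : (g j (z j) <= \sum_i g i (z i))%E.
    by rewrite (bigD1 j)//= leeDl// sume_ge0.
  have gE j : g j (z j) = (fine (g j (z j)))%:E.
    by rewrite fineK// ge0_fin_numE// (le_lt_trans (le_trans (gle j) sfin))// ltry.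
  rewrite (eq_bigr _ (fun j _ => gE j)) sumEFin -EFinB lte_fin in Hc.
  set Sg := \sum_j _ in Hc.
  (* Of this gap one quarter each goes to the slopes, to the variation of G,
     to the variation of the linear form and to the exponential sum. *)
  pose s := c - (G z + b top - Sg).
  have s0 : 0 < s by rewrite /s; lra.
  pose n := \sum_(j : K) 1 : R.
  have n0 : 0 <= n by apply: sumr_ge0.
  pose k := s / 4 / (n + 1).
  have n1 : 0 < n + 1 by lra.
  have k0 : 0 < k by rewrite !divr_gt0.
  have kn : n * k <= s / 4.
    have : k * (n + 1) = s / 4 by rewrite /k divfK// gt_eqF.
    lra.
  have H j : exists q : rat, dom j (ratr q) /\ fine (g j (z j)) - k < ratr q * z j - L j (ratr q).
    have : ((fine (g j (z j)) - k)%:E < g j (z j))%E by rewrite [ltRHS]gE lte_fin; lra.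
    by move=> /g_gt[q]; exists q.
  have [tau0 Htau] := choice H.
  pose tau := [ffun j => tau0 j] : {ffun K -> rat}.
  have dtau j : dom j (ratr (tau j)) by rewrite ffunE; exact: (Htau j).1.
  have gtau : Sg - n * k <= \sum_j ratr (tau j) * z j - \sum_j L j (ratr (tau j)).
    rewrite /Sg /n mulr_suml -!sumrB; apply: ler_sum => j _.
    by rewrite mul1r ffunE ltW// (Htau j).2.
  have s4 : 0 < s / 4 by lra.
  have [d1 d10 Hd1] := @G_cont z (s / 4) s4.
  pose T := \sum_j `|ratr (tau j) : R|.
  have T0 : 0 <= T by apply: sumr_ge0.
  pose d := Num.min d1 (s / 4 / (T + 1)).
  have T1 : 0 < T + 1 by lra.
  have d0 : 0 < d by rewrite lt_min d10 !divr_gt0.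
  have dT : d * T <= s / 4.
    have : d <= s / 4 / (T + 1) by rewrite ge_min lexx orbT.
    rewrite ler_pdivlMr// => h.
    have : d * T <= d * (T + 1) by rewrite ler_pM2l//; lra.
    lra.
  exists d => //.
  apply: filterS (expmoment_upper dtau s4) => N hN.
  apply: (@le_trans _ _ (expR (N%:R * (G z + s / 2 - \sum_j ratr (tau j) * z j)) *
     \sum_(x : cfg N) expR (N%:R * \sum_j ratr (tau j) * zeta x j))).
    rewrite mulr_sumr big_mkcond/=; apply: ler_sum => x _.
    case: asboolP => [hx|_]; last by rewrite mulr_ge0 ?expR_ge0.
    rewrite -expRD ler_expR -mulrDr ler_wpM2l//.
    have h1 : `|G (zeta x) - G z| < s / 4.
      by apply: Hd1 => j; rewrite (lt_le_trans (hx j))// ge_min lexx.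
    have := @linear_box (fun j => ratr (tau j)) xpredT z (zeta x) d hx.
    rewrite -/T => h2.
    have := ler_norm (G (zeta x) - G z).
    have h3 := le_trans h2 dT.
    rewrite ler_norml in h3; lra.
  apply: (@le_trans _ _ (expR (N%:R * (G z + s / 2 - \sum_j ratr (tau j) * z j)) *
     expR (N%:R * (\sum_j L j (ratr (tau j)) + b top + s / 4)))).
    by rewrite ler_wpM2l ?expR_ge0.
  rewrite -expRD ler_expR -mulrDr ler_wpM2l//; rewrite /s in kn *; lra.
have /existsNP[a /negP] := nDz; rewrite -ltNge => ba.
have [c' [cg bc]] := lte_sum_real (fun j => g_ge0 j (z j)) ba.
have H j : exists q : rat, KA a j -> dom j (ratr q) /\ c' j < ratr q * z j - L j (ratr q).
  have [aj|naj] := boolP (KA a j); last by exists 0.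
  by have [q h1 h2] := g_gt (cg j aj); exists q.
have [tau0 Htau] := choice H.
pose tau := [ffun j => tau0 j] : {ffun K -> rat}.
have dtau j : KA a j -> dom j (ratr (tau j)) by rewrite ffunE => /Htau[].
pose s := \sum_(j | KA a j) ratr (tau j) * z j - \sum_(j | KA a j) L j (ratr (tau j)) - b a.
have s0 : 0 < s.
  rewrite /s subr_gt0 (lt_le_trans bc)// -sumrB; apply: ler_sum => j aj.
  by rewrite ffunE ltW// (Htau j aj).2.
pose T := \sum_j `|ratr (tau j) : R|.
have T0 : 0 <= T by apply: sumr_ge0.
have T1 : 0 < T + 1 by lra.
pose d := s / 4 / (T + 1).
have s4 : 0 < s / 4 by lra.
have d0 : 0 < d by rewrite !divr_gt0.
have dT : d * T <= s / 4.
  have E : d * (T + 1) = s / 4 by rewrite /d divfK// gt_eqF.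
  by rewrite -E ler_wpM2l ?lerDl// ltW.
exists d => //.
apply: filterS (linear_upper dtau s4) => N hN.
rewrite big1 ?expR_ge0// => x /asboolP hx; exfalso.
have := hN x; rewrite sumrB.
have h2 := @linear_box (fun j => ratr (tau j)) (KA a) z (zeta x) d hx.
have := le_trans h2 dT; rewrite ler_norml; move: s0; rewrite /s /=; lra.
Qed.

(** The points stay in a compact set, which finitely many boxes of local_upper
    cover; their number is beaten by e^(N (c' - c)). *)
Lemma upper_bound (c c' : R) : c < c' ->
  (forall z, domain z -> ((G z + b top)%:E - \sum_j g j (z j) < c%:E)%E) ->
  \forall N \near \oo, \sum_(s : cfg N) expR (N%:R * G (zeta s)) <= expR (N%:R * c').
Proof.
move=> cc' Hc; have [M HM] := zeta_bounded.
pose Q (U : set {ptws K -> R}) := \forall N \near \oo,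
    \sum_(s : cfg N | `[< U (zeta s) >]) expR (N%:R * G (zeta s)) <= expR (N%:R * c).
have [|S [SQ cov]] := @compact_box_cover R K M Q.
  by move=> z _; apply: local_upper; exact: Hc.
have HS : \forall N \near \oo, forall U, List.In U S ->
    \sum_(s : cfg N | `[< U (zeta s) >]) expR (N%:R * G (zeta s)) <= expR (N%:R * c).
  elim: S SQ {cov} => [|U S IH] SQ; first by apply: nearW.
  have h1 := SQ U (or_introl erefl); have h2 := IH (fun V hV => SQ V (or_intror hV)).
  rewrite /Q in h1; apply: filterS2 h1 h2 => N hU hS V [<-|/hS]; [exact: hU|exact].
have [N1 hN1] : exists N1 : nat, forall N, (N1 <= N)%N -> (List.length S)%:R <= expR (N%:R * (c' - c)).
  exists (Num.truncn ((List.length S)%:R / (c' - c))).+1 => N hN.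
  apply: le_trans (expR_ge1Dx _); rewrite ler_wpDl// -ler_pdivrMr ?subr_gt0//.
  by rewrite (le_trans (ltW (truncnS_gt _)))// ler_nat.
apply: filterS3 HM HS (nbhs_infty_ge N1) => N hM hS hN.
apply: (@le_trans _ _ ((List.length S)%:R * expR (N%:R * c))); last first.
  have -> : N%:R * c' = N%:R * (c' - c) + N%:R * c by ring.
  by rewrite expRD ler_wpM2r ?expR_ge0// hN1.
apply: (@le_trans _ _ (\sum_(U <- S) \sum_(s : cfg N | `[< U (zeta s) >]) expR (N%:R * G (zeta s)))).
  under [leRHS]eq_bigr do rewrite big_mkcond/=.
  rewrite exchange_big/=; apply: ler_sum => x _.
  have [U US Ux] := cov (zeta x) (hM x).
  elim: S US {SQ cov hN1 hS} => [//|V S IH] /= [->|US]; rewrite big_cons.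
    by rewrite asboolT// lerDl sumr_ge0// => W _; case: ifP => // _; rewrite expR_ge0.
  by apply: (le_trans (IH US)); rewrite lerDr; case: ifP => // _; rewrite expR_ge0.
elim: S hS {SQ cov hN1} => [|U S IH] hS; first by rewrite big_nil mul0r.
rewrite big_cons /= -natr1 mulrDl mul1r addrC lerD//.
  by apply: IH => V hV; apply: hS; right.
by apply: hS; left.
Qed.

End DeterministicUpper.

(** * Exponential moments of the sums over configurations *)

Section ExponentialMoments.
Variables (R : realType) (n : nat) (S : {fset seq 'I_n}) (k : 'I_n -> nat) (N : nat).
Hypothesis kN : (\sum_(i < n) k i)%N = N.
Context d (T : measurableType d) (P : probability T R).
Variable xi : S -> seq (seq bool) -> {RV P >-> R}.
Hypothesis xi_indep : mutually_independent (possible_values S k N)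
  (fun sw : S * seq (seq bool) => xi sw.1 sw.2).

Local Notation cfg := (N.-tuple bool).
Local Notation word t s := (word_spins k t (val s)).

Lemma possible_word (t : cfg) (s : S) : possible_values S k N (s, word t s).
Proof. by exists t. Qed.

Lemma word_pairs_uniq (t : cfg) (W : seq S) : uniq W -> uniq [seq (s, word t s) | s <- W].
Proof. by move=> uW; rewrite map_inj_uniq// => s s' [->]. Qed.

Variable lam : S -> probability R R.
Hypothesis xi_law : forall s w, possible_values S k N (s, w) ->
  is_sample_mean_law (lam s) N (distribution P (xi s w)).

Definition block_mean (t : seq bool) (i : 'I_n) : R :=
  N%:R^-1 * \sum_(b <- block k t i) spin R b.

Definition exp_weight (tt : S -> R) (u : 'I_n -> R) (t : cfg) (w : T) : R :=
  expR (N%:R * (\sum_s tt s * xi s (word t s) w + \sum_i u i * block_mean t i)).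

Hypothesis N0 : (0 < N)%N.

Lemma measurable_exp_weight tt u t : measurable_fun [set: T] (exp_weight tt u t).
Proof.
apply: measurableT_comp => //; apply: measurable_funM => //.
apply: measurable_funD => //; apply: measurable_sum => s.
exact: measurable_funM.
Qed.

(** For a single configuration distinct words give distinct pairs (s, t(s)),
    hence independent energies, whatever symbols the words have in common. *)
Lemma integral_exp_weight tt u (t : cfg) : (forall s, (mgf (lam s) (tt s) < +oo)%E) ->
  (\int[P]_w (exp_weight tt u t w)%:E =
   (expR (N%:R * \sum_s lmgf (lam s) (tt s)) * expR (\sum_i u i * \sum_(b <- block k t i) spin R b))%:E)%E.
Proof.
move=> htt.
pose J := [seq (s, word t s) | s <- index_enum S].
pose g (x : S * seq (seq bool)) (v : R) := expR (tt x.1 * (N%:R * v)).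
have mg x : measurable_fun [set: R] (g x).
  by apply: measurableT_comp => //; apply: measurable_funM => //; exact: measurable_funM.
have Eg s : (\int[P]_w (g (s, word t s) (xi s (word t s) w))%:E = (expR (N%:R * lmgf (lam s) (tt s)))%:E)%E.
  have <- := sample_mgf N0 (xi_law (possible_word t s)) (htt s).
  rewrite ge0_integral_distribution//.
  by apply/measurable_EFinP; exact: (mg (s, word t s)).
have E w : exp_weight tt u t w = expR (\sum_i u i * \sum_(b <- block k t i) spin R b) *
    \prod_(x <- J) g x (xi x.1 x.2 w).
  rewrite big_map /g /= -expR_sum -expRD addrC; congr expR.
  rewrite mulrDr !mulr_sumr; congr (_ + _); last first.
    by apply: eq_bigr => i _; rewrite /block_mean mulrCA mulVKf// pnatr_eq0 -lt0n.
  by apply: eq_bigr => s _; rewrite mulrCA.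
under eq_integral do rewrite E.
rewrite integralZl_EFin ?expR_ge0//; last 2 first.
- by apply: measurable_prod => x _; apply: (measurableT_comp (mg x)).
- by move=> w; apply: prodr_ge0 => x _; exact: expR_ge0.
rewrite (@integral_prod R _ T P _ _ (fun sw : S * seq (seq bool) => xi sw.1 sw.2) g J xi_indep)//.
- rewrite big_map (eq_bigr _ (fun s _ => Eg s)) prodEFin -EFinM mulrC.
  by rewrite -expR_sum mulr_sumr.
- by move=> x v; exact: expR_ge0.
- by move=> x /mapP[s _ ->]; rewrite Eg ltry.
- by apply: word_pairs_uniq; exact: index_enum_uniq.
- by move=> x /mapP[s _ ->]; exact: possible_word.
Qed.

Definition exp_moment (tt : S -> R) (u : 'I_n -> R) (w : T) : R :=
  \sum_(t : cfg) exp_weight tt u t w.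

Lemma integral_exp_moment tt u : (forall s, (mgf (lam s) (tt s) < +oo)%E) ->
  (\int[P]_w (exp_moment tt u w)%:E =
   (expR (N%:R * \sum_s lmgf (lam s) (tt s) + N%:R * ln 2 + \sum_i (k i)%:R * lcosh (u i)))%:E)%E.
Proof.
move=> htt; rewrite integral_sum_EFin; last 2 first.
- exact: measurable_exp_weight.
- by move=> t w; exact: expR_ge0.
rewrite (eq_bigr _ (fun t _ => integral_exp_weight u t htt)) sumEFin -mulr_sumr; congr EFin.
rewrite -addrA expRD; congr (_ * _).
under eq_bigr do rewrite expR_sum.
rewrite (big_blocks kN (fun i t => expR (u i * \sum_(b <- t) spin R b))).
under eq_bigr do rewrite sum_spin_exp.
rewrite -expR_sum; congr expR; under eq_bigr do rewrite mulrDr.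
by rewrite big_split/= -mulr_suml -natr_sum kN.
Qed.

Lemma exp_moment_markov tt u (e : R) : (forall s, (mgf (lam s) (tt s) < +oo)%E) ->
  (P [set w | (expR (N%:R * \sum_s lmgf (lam s) (tt s) + N%:R * ln 2 + \sum_i (k i)%:R * lcosh (u i) + N%:R * e) < exp_moment tt u w)%R]
   <= (expR (- e) ^+ N)%:E)%E.
Proof.
move=> htt; set M := (_ + _ + \sum_i _).
have mW : measurable_fun [set: T] (exp_moment tt u).
  by apply: measurable_sum => t; exact: measurable_exp_weight.
have mA : measurable [set w | expR (M + N%:R * e) < exp_moment tt u w] by exact: measurable_gt_cst.
rewrite -[X in P X]setIT -integral_indic//.
apply: (@le_trans _ _ (\int[P]_w (expR (- (M + N%:R * e)) * exp_moment tt u w)%:E)%E).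
  apply: le_integral_EFin.
  - exact: measurable_indic.
  - exact: measurable_funM.
  - by move=> x; rewrite indicE.
  have W0 x : 0 <= exp_moment tt u x by apply: sumr_ge0 => t _; exact: expR_ge0.
  move=> x; rewrite indicE; have [|_] := boolP (x \in _); last by rewrite mulr_ge0 ?expR_ge0.
  by rewrite inE /= => h; rewrite expRN mulrC ler_pdivlMr ?expR_gt0// mul1r ltW.
rewrite integralZl_EFin ?expR_ge0//; last first.
  by move=> x; apply: sumr_ge0 => t _; exact: expR_ge0.
rewrite integral_exp_moment// -/M -EFinM -expRD -expRM_natl lee_fin ler_expR; lra.
Qed.

End ExponentialMoments.

(** * Second moment of the number of configurations in a cell *)

Section SecondMoment.
Variables (R : realType) (n : nat) (S : {fset seq 'I_n}) (k : 'I_n -> nat) (N : nat).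
Hypothesis kN : (\sum_(i < n) k i)%N = N.
Context d (T : measurableType d) (P : probability T R).
Variable xi : S -> seq (seq bool) -> {RV P >-> R}.
Hypothesis xi_indep : mutually_independent (possible_values S k N)
  (fun sw : S * seq (seq bool) => xi sw.1 sw.2).

Local Notation cfg := (N.-tuple bool).
Local Notation word t s := (word_spins k t (val s)).

(** Configurations are counted for which all the energies of the words in W
    lie in the sets U and all the blocks satisfy Gi. C is the number of
    admissible values of a block, q the probability that an energy lies in its
    set, ql a lower bound for it. *)
Variables (W : pred S) (U : S -> set R) (ql : S -> R).
Hypothesis W_nonempty : forall s, W s -> val s != [::].
Hypothesis mU : forall s, measurable (U s).
Hypothesis ql_gt0 : forall s, 0 < ql s.
Let q s w := fine (P (xi s w @^-1` U s)).
Hypothesis ql_le : forall s (t : cfg), W s -> ql s <= q s (word t s).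
Variable Gi : 'I_n -> pred (seq bool).
Let C i : R := \sum_(t : (k i).-tuple bool) (Gi i t)%:R.
Hypothesis C_gt0 : forall i, 0 < C i.

Definition good (t : cfg) : bool := [forall i, Gi i (block k t i)].
Definition agree (t t' : cfg) : {set 'I_n} := [set i | block k t i == block k t' i]%SET.

Lemma word_agree (t t' : cfg) (s : S) :
  (word t s == word t' s) = (symbols (val s) \subset agree t t').
Proof.
apply/idP/idP => [/eqP/eq_in_map h|/fintype.subsetP h].
  by apply/fintype.subsetP => i; rewrite !inE => /h ->.
apply/eqP/eq_in_map => i si; have := h i.
by rewrite !inE => /(_ si)/eqP.
Qed.

Lemma good_prod (t : cfg) : (good t)%:R = \prod_(i < n) (Gi i (block k t i))%:R :> R.
Proof.
rewrite /good; case: forallP => [h|/forallP].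
  by rewrite big1// => i _; rewrite h.
rewrite negb_forall => /existsP[i hi].
by rewrite (bigD1 i)//= (negbTE hi) mul0r.
Qed.

Lemma card_good : \sum_(t : cfg) (good t)%:R = \prod_(i < n) C i.
Proof.
under eq_bigr do rewrite good_prod.
exact: (big_blocks kN (fun i t => (Gi i t)%:R)).
Qed.

(** A configuration that agrees with t on B has free choice on the other
    blocks only. *)
Lemma card_good_agree (t : cfg) (B : {set 'I_n}) :
  \sum_(t' : cfg | agree t t' == B) (good t')%:R <= \prod_(i in ~: B) C i.
Proof.
pose F i (s : seq bool) : R := (Gi i s)%:R * (if i \in B then (s == block k t i)%:R else 1).
have F0 i s : 0 <= F i s by rewrite mulr_ge0//; case: ifP.
apply: (@le_trans _ _ (\sum_(t' : cfg) \prod_(i < n) F i (block k t' i))).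
  rewrite big_mkcond/=; apply: ler_sum => t' _.
  case: ifP => [/eqP aB|_]; last by apply: prodr_ge0.
  rewrite good_prod le_eqVlt; apply/orP; left; apply/eqP; apply: eq_bigr => i _.
  rewrite /F; case: ifP => [|_]; last by rewrite mulr1.
  by rewrite -aB inE eq_sym => ->; rewrite mulr1.
rewrite (big_blocks kN F) (bigID [in B])/=.
have E : \prod_(i in ~: B) C i = \prod_(i < n | i \notin B) \sum_(s : (k i).-tuple bool) F i s.
  apply: eq_big => i; first by rewrite inE.
  rewrite inE => /negbTE iB; apply: eq_bigr => s _.
  by rewrite /F iB mulr1.
rewrite -E -[leRHS]mul1r ler_wpM2r//.
  by apply: prodr_ge0 => i _; rewrite ltW.
apply: prodr_ile1 => i iB; apply/andP; split; first by apply: sumr_ge0.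
have sb : size (block k t i) == k i by rewrite (size_block kN).
rewrite (bigD1 (Tuple sb))//= big1 ?addr0.
  by rewrite /F iB mulr_ile1//; [case: (Gi _ _)|case: (_ == _)].
move=> s st; rewrite /F iB.
have -> : (tval s == block k t i) = false.
  by apply: contra_neqF st => /eqP h; apply/val_inj.
by rewrite mulr0.
Qed.

(** Bound for the correlation of two configurations agreeing exactly on B: the
    energies of the words inside B are common to both. *)
Let r (B : {set 'I_n}) : R := \prod_(s : S | W s && (symbols (val s) \subset B)) (ql s)^-1.

Let hit s w (x : T) : R := \1_(U s) (xi s w x).
(** Normalised by the probabilities, this product has mean 1 for each
    configuration even if they depend on it, so that lower bounds for them
    suffice in the estimate of the second moment. *)
Let A (t : cfg) (x : T) : R := \prod_(s | W s) (hit s (word t s) x / q s (word t s)).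

Let q_gt0 s (t : cfg) : W s -> 0 < q s (word t s).
Proof. by move=> Ws; apply: lt_le_trans (ql_le t Ws). Qed.

Let integral_hits (J : seq (S * seq (seq bool))) : uniq J ->
  (forall x, x \in J -> exists2 t : cfg, x.2 = word t x.1 & W x.1) ->
  (\int[P]_w (\prod_(x <- J) (hit x.1 x.2 w / q x.1 x.2))%:E = 1)%E.
Proof.
move=> uJ HJ.
pose g (x : S * seq (seq bool)) (v : R) := \1_(U x.1) v / `|q x.1 x.2|.
have mg x : measurable_fun [set: R] (g x).
  by apply: measurable_funM; [exact: measurable_indic|exact: measurable_cst].
have g0 x v : 0 <= g x v by rewrite mulr_ge0// invr_ge0.
have Eg x : x \in J -> (\int[P]_w (g x (xi x.1 x.2 w))%:E = 1)%E.
  move=> /HJ[t xt Wx]; have q0 := q_gt0 t Wx.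
  rewrite /g xt gtr0_norm//.
  under eq_integral do rewrite mulrC.
  rewrite integralZl_EFin ?invr_ge0 ?(ltW q0)//; last first.
    by apply: measurableT_comp => //; exact: measurable_indic.
  have -> : (\int[P]_w (\1_(U x.1) (xi x.1 (word t x.1) w))%:E = (q x.1 (word t x.1))%:E)%E.
    rewrite /q fineK ?fin_num_measure//; last by rewrite -[X in measurable X]setTI; exact: measurable_funP.
    rewrite -[X in P X]setIT -integral_indic//.
    by rewrite -[X in measurable X]setTI; exact: measurable_funP.
  by rewrite -EFinM mulVf// gt_eqF.
have E w : \prod_(x <- J) (hit x.1 x.2 w / q x.1 x.2) = \prod_(x <- J) g x (xi x.1 x.2 w).
  apply: eq_big_seq => x /HJ[t xt Wx]; rewrite /g xt gtr0_norm//; exact: q_gt0.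
under eq_integral do rewrite E.
rewrite (@integral_prod R _ T P _ _ (fun sw : S * seq (seq bool) => xi sw.1 sw.2) g J xi_indep)//.
- by rewrite big_seq big1// => x /Eg.
- by move=> x /Eg ->; exact: ltry.
- by move=> x /HJ[t xt _]; exists t.
Qed.

Let integral_A (t : cfg) : (\int[P]_w (A t w)%:E = 1)%E.
Proof.
pose J := [seq (s, word t s) | s <- index_enum S & W s].
rewrite -(@integral_hits J).
- by apply: eq_integral => w _; rewrite big_map big_filter.
- by apply: word_pairs_uniq; rewrite filter_uniq// index_enum_uniq.
- move=> x /mapP[s]; rewrite mem_filter => /andP[Ws _] ->.
  by exists t.
Qed.

Let mA (t : cfg) : measurable_fun [set: T] (A t).
Proof.
rewrite /A; under eq_fun do rewrite -big_filter.
apply: measurable_prod => s _; apply: measurable_funM; last exact: measurable_cst.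
by apply: measurableT_comp => //; exact: measurable_indic.
Qed.

Let A_ge0 (t : cfg) w : 0 <= A t w.
Proof.
apply: prodr_ge0 => s Ws; rewrite mulr_ge0 ?invr_ge0 ?(ltW (q_gt0 _ Ws))//.
Qed.

(** For a word inside the agreement set both products contain the same
    indicator, whose square is itself: one inverse probability remains. All
    the other factors belong to distinct pairs (s, w), so they are independent
    of mean 1. *)
Let integral_AA (t t' : cfg) : (\int[P]_w (A t w * A t' w)%:E <= (r (agree t t'))%:E)%E.
Proof.
pose D s := W s && ~~ (symbols (val s) \subset agree t t').
pose J := [seq (s, word t s) | s <- index_enum S & W s] ++
          [seq (s, word t' s) | s <- index_enum S & D s].
pose Z := \prod_(s | W s && (symbols (val s) \subset agree t t')) (q s (word t s))^-1.
have E w : A t w * A t' w = Z * \prod_(x <- J) (hit x.1 x.2 w / q x.1 x.2).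
  pose sub (s : S) := symbols (val s) \subset agree t t'.
  pose f t1 (s : S) := hit s (word t1 s) w / q s (word t1 s).
  have AE t1 : A t1 w = (\prod_(s | W s && sub s) f t1 s) * (\prod_(s | W s && ~~ sub s) f t1 s).
    by rewrite /A (bigID sub).
  have -> : \prod_(x <- J) (hit x.1 x.2 w / q x.1 x.2) = A t w * \prod_(s | W s && ~~ sub s) f t' s.
    by rewrite big_cat !big_map !big_filter.
  have key : (\prod_(s | W s && sub s) f t s) * (\prod_(s | W s && sub s) f t' s) =
      Z * \prod_(s | W s && sub s) f t s.
    rewrite /Z -!big_split/=; apply: eq_bigr => s /andP[Ws].
    rewrite /sub -word_agree => /eqP ts; rewrite /f -ts /hit indicE.
    by case: (_ \in _); rewrite ?mul0r ?mulr0// !mul1r.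
  rewrite !AE mulrACA key; ring.
have HJ x : x \in J -> exists2 t0 : cfg, x.2 = word t0 x.1 & W x.1.
  rewrite mem_cat => /orP[] /mapP[s]; rewrite mem_filter => /andP[].
    by move=> Ws _ ->; exists t.
  by move=> /andP[Ws _] _ ->; exists t'.
have Z0 : 0 <= Z by apply: prodr_ge0 => s /andP[Ws _]; rewrite invr_ge0 ltW// q_gt0.
under eq_integral do rewrite E.
rewrite integralZl_EFin//; last 2 first.
- apply: measurable_prod => x _; apply: measurable_funM; last exact: measurable_cst.
  by apply: measurableT_comp => //; exact: measurable_indic.
- move=> w; rewrite big_seq; apply: prodr_ge0 => x xJ; rewrite mulr_ge0 ?indicE//.
  by rewrite invr_ge0; have [t1 -> Wx] := HJ x xJ; rewrite ltW// q_gt0.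
rewrite integral_hits//.
- rewrite mule1 lee_fin; apply: ler_prod => s /andP[Ws _].
  by rewrite invr_ge0 (ltW (q_gt0 _ Ws))/= lef_pV2 ?posrE ?q_gt0// ql_le.
- rewrite cat_uniq !word_pairs_uniq ?filter_uniq ?index_enum_uniq// andbT /=.
  apply/hasPn => x /mapP[s]; rewrite mem_filter => /andP[/andP[Ws h] _] ->.
  apply/negP => /mapP[s' _ [ss' ws]]; move: h; rewrite -word_agree.
  by rewrite ws ss' eqxx.
Qed.

Definition hits (t : cfg) (w : T) : bool :=
  [forall s : S, W s ==> (xi s (word t s) w \in U s)].

Let Ctot : R := \prod_(i < n) C i.
(** The relative variance: the pairs agreeing on B contribute r B over the
    number of values of the blocks in B. The empty B, where no word is shared,
    accounts for the square of the mean. *)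
Let V : R := \sum_(B : {set 'I_n} | B != finset.set0) r B / \prod_(i in B) C i.
Let M (w : T) : R := \sum_(t : cfg) (good t)%:R * A t w.

Let Ctot_gt0 : 0 < Ctot.
Proof. by apply: prodr_gt0. Qed.

Let r_ge0 B : 0 <= r B.
Proof. by apply: prodr_ge0 => s _; rewrite invr_ge0 ltW. Qed.

Let M_ge0 w : 0 <= M w.
Proof. by apply: sumr_ge0 => t _; rewrite mulr_ge0. Qed.

Let mM : measurable_fun [set: T] M.
Proof.
apply: measurable_sum => t; apply: measurable_funM; first exact: measurable_cst.
exact: mA.
Qed.

Let integral_M : (\int[P]_w (M w)%:E = Ctot%:E)%E.
Proof.
rewrite integral_sum_EFin; last 2 first.
- move=> t; apply: measurable_funM; first exact: measurable_cst.
  exact: mA.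
- by move=> t w; rewrite mulr_ge0.
rewrite /Ctot -card_good -sumEFin; apply: eq_bigr => t _.
by rewrite integralZl_EFin// integral_A mule1.
Qed.

Let r_set0 : r finset.set0 = 1.
Proof.
rewrite /r big_pred0// => s; apply/negP => /andP[Ws].
move/fintype.subsetP => h; have := W_nonempty Ws.
case E : (val s) => [//|i l] _.
by have := h i; rewrite !inE E inE eqxx => /(_ isT).
Qed.

(** Pairs of configurations are sorted by the set of blocks on which they
    agree. *)
Let integral_M2 : (\int[P]_w (M w ^+ 2)%:E <= (Ctot ^+ 2 * (1 + V))%:E)%E.
Proof.
pose F (tt : cfg * cfg) w := (good tt.1)%:R * (good tt.2)%:R * (A tt.1 w * A tt.2 w) : R.
have E w : M w ^+ 2 = \sum_(tt : cfg * cfg) F tt w.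
  rewrite expr2 /M mulr_suml; under eq_bigr do rewrite mulr_sumr.
  by rewrite pair_bigA /=; apply: eq_bigr => -[t t'] _; rewrite /F/= mulrACA.
have mAA tt : measurable_fun [set: T] (fun w => A tt.1 w * A tt.2 w).
  by apply: measurable_funM; exact: mA.
have AA0 tt w : 0 <= A tt.1 w * A tt.2 w by rewrite mulr_ge0.
under eq_integral do rewrite E.
rewrite integral_sum_EFin; last 2 first.
- by move=> tt; apply: measurable_funM; [exact: measurable_cst|exact: mAA].
- by move=> tt w; rewrite /F mulr_ge0.
apply: (@le_trans _ _ (\sum_(tt : cfg * cfg)
   ((good tt.1)%:R * (good tt.2)%:R * r (agree tt.1 tt.2))%:E)%E).
  apply: lee_sum => tt _; rewrite /F integralZl_EFin// [leRHS]EFinM.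
  by apply: lee_wpmul2l; [rewrite lee_fin|exact: integral_AA].
rewrite sumEFin lee_fin.
have -> : \sum_(tt : cfg * cfg) (good tt.1)%:R * (good tt.2)%:R * r (agree tt.1 tt.2)
   = \sum_(t : cfg) (good t)%:R * \sum_(t' : cfg) (good t')%:R * r (agree t t').
  under [RHS]eq_bigr do rewrite mulr_sumr.
  by rewrite pair_bigA /=; apply: eq_bigr => -[t t'] _ /=; rewrite mulrA.
apply: (@le_trans _ _ (\sum_(t : cfg) (good t)%:R * (Ctot * (1 + V)))); last first.
  by rewrite -mulr_suml card_good -/Ctot expr2 mulrA.
apply: ler_sum => t _; rewrite ler_wpM2l//.
rewrite (partition_big (agree t) xpredT)//=.
apply: (@le_trans _ _ (\sum_(B : {set 'I_n}) r B * \prod_(i in ~: B) C i)).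
  apply: ler_sum => B _.
  have -> : \sum_(t' : cfg | agree t t' == B) (good t')%:R * r (agree t t') =
      r B * \sum_(t' : cfg | agree t t' == B) (good t')%:R.
    by rewrite mulr_sumr; apply: eq_bigr => t' /eqP ->; rewrite mulrC.
  by rewrite ler_wpM2l// card_good_agree.
have CE B : \prod_(i in ~: B) C i = Ctot / \prod_(i in B) C i.
  rewrite /Ctot [\prod_(i < n) C i](bigID [in B])/= [X in X / _]mulrC mulfK//; last first.
    by rewrite gt_eqF// prodr_gt0.
  by apply: eq_bigl => i; rewrite inE.
under eq_bigr do rewrite CE.
rewrite (bigD1 finset.set0)//= r_set0 big_set0 invr1 mulr1 mul1r mulrDr mulr1 lerD2l.
by rewrite /V mulr_sumr; apply: ler_sum => B _; rewrite mulrCA.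
Qed.

Lemma measurable_hits_count : measurable_fun [set: T]
  (fun w => \sum_(t : cfg) (good t && hits t w)%:R : R).
Proof.
apply: measurable_sum => t.
have -> : (fun w => (good t && hits t w)%:R) =
    (fun w => (good t)%:R * \prod_(s <- index_enum S) (if W s then hit s (word t s) w else 1)).
  apply/funext => w; case: (good t); rewrite ?mul0r// mul1r /= /hits.
  case: forallP => [h|/forallP].
    rewrite big1// => s _; case: ifP => // Ws; rewrite /hit indicE.
    by have := h s; rewrite Ws /= => ->.
  rewrite negb_forall => /existsP[s]; rewrite negb_imply => /andP[Ws hs].
  by rewrite (bigD1 s)//= Ws /hit indicE (negbTE hs) mul0r.
apply: measurable_funM; first exact: measurable_cst.
apply: measurable_prod => s _; case: (W s); last exact: measurable_cst.
exact: measurableT_comp (measurable_indic (mU s)) (measurable_funP _).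
Qed.

(** Chebyshev's inequality for the normalised count M, of mean Ctot and
    variance at most Ctot^2 V, at distance Ctot / 2 from the mean. Each
    configuration that is counted contributes at most the inverse of the
    product of the ql to M, which turns a lower bound for M into one for the
    count. *)
Lemma second_moment :
  (P [set w | (\sum_(t : cfg) (good t && hits t w)%:R < (\prod_(s | W s) ql s) * Ctot / 2)%R]
   <= (4 * V)%:E)%E.
Proof.
pose Z := \prod_(s | W s) ql s.
have Z0 : 0 < Z by apply: prodr_gt0.
pose cnt := fun w : T => \sum_(t : cfg) ((good t && hits t w)%:R : R).
have Mcnt w : M w <= cnt w / Z.
  rewrite /cnt mulr_suml; apply: ler_sum => t _.
  have [gt|_] := boolP (good t); last by rewrite !mul0r.
  rewrite mul1r /= /hits; case: forallP => [h|/forallP].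
    rewrite mul1r /Z -prodfV; apply: ler_prod => s Ws.
    rewrite /hit indicE; have := h s; rewrite Ws /= => ->.
    by rewrite mul1r invr_ge0 (ltW (q_gt0 _ Ws))/= lef_pV2 ?posrE ?q_gt0// ql_le.
  rewrite negb_forall => /existsP[s]; rewrite negb_imply => /andP[Ws hs].
  by rewrite /A (bigD1 s)//= /hit indicE (negbTE hs) !mul0r.
have sub : [set w | cnt w < Z * Ctot / 2] `<=` [set w | M w < Ctot / 2].
  move=> w /= h; apply: le_lt_trans (Mcnt w) _.
  by rewrite ltr_pdivrMr//; have -> : Ctot / 2 * Z = Z * Ctot / 2 by ring.
have mB : measurable [set w | M w < Ctot / 2] := measurable_lt_cst _ mM.
have mcnt : measurable [set w | cnt w < Z * Ctot / 2] := measurable_lt_cst _ measurable_hits_count.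
apply: (@le_trans _ _ (P [set w | M w < Ctot / 2])).
  by apply: le_measure; rewrite ?inE.
set B := [set w | M w < Ctot / 2] in mB *.
(* (M - Ctot)^2 >= Ctot^2 / 4 on B, expanded and with the negative term moved
   to the left: all the integrands are then nonnegative. *)
have key : ((Ctot ^+ 2 / 4)%:E * P B + (2 * Ctot)%:E * \int[P]_w (M w)%:E <=
    \int[P]_w (M w ^+ 2)%:E + (Ctot ^+ 2)%:E)%E.
  have mI : measurable_fun [set: T] (\1_B : T -> R) by exact: measurable_indic.
  have C4 : 0 <= Ctot ^+ 2 / 4 by rewrite divr_ge0// sqr_ge0.
  have C2 : 0 <= 2 * Ctot by rewrite mulr_ge0// ltW.
  have m1 : measurable_fun [set: T] (fun w => Ctot ^+ 2 / 4 * \1_B w).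
    by apply: measurable_funM; [exact: measurable_cst|exact: mI].
  have m2 : measurable_fun [set: T] (fun w => 2 * Ctot * M w).
    by apply: measurable_funM; [exact: measurable_cst|exact: mM].
  have m3 : measurable_fun [set: T] (fun w => M w ^+ 2) by exact: measurable_funX.
  rewrite -[X in P X]setIT -integral_indic// -!integralZl_EFin//.
  rewrite -ge0_integralD_EFin//; last 2 first.
  - by move=> w; rewrite mulr_ge0// indicE.
  - by move=> w; rewrite mulr_ge0.
  have -> : ((Ctot ^+ 2)%:E = \int[P]_w (cst (Ctot ^+ 2) w)%:E)%E.
    have := integral_cst P measurableT (Ctot ^+ 2)%:E.
    by rewrite [X in (_ = _ * X)%E]probability_setT mule1 => /esym.
  rewrite -ge0_integralD_EFin//; last 2 first.
  - by move=> w; exact: sqr_ge0.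
  - by move=> w; exact: sqr_ge0.
  apply: le_integral_EFin.
  - exact: measurable_funD.
  - by apply: measurable_funD => //; exact: measurable_cst.
  - by move=> w; rewrite addr_ge0// mulr_ge0// indicE.
  move=> w; rewrite indicE /cst.
  have h0 := M_ge0 w; have h1 := Ctot_gt0; have h2 := sqr_ge0 (M w - Ctot).
  have [|_] := boolP (w \in B); last by rewrite mulr0; lra.
  rewrite inE /B /= mulr1 => h3.
  have h4 : 0 <= (Ctot / 2 - M w) * (Ctot / 2 - M w + Ctot).
    by rewrite mulr_ge0//; lra.
  lra.
rewrite integral_M in key.
have {key} := le_trans key (leeD2r _ integral_M2).
rewrite -[P B]fineK ?fin_num_measure// -!EFinM -!EFinD !lee_fin => h.
have C2 : 0 < Ctot ^+ 2 by rewrite exprn_gt0.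
rewrite -(ler_pM2l C2); nra.
Qed.

End SecondMoment.

(** * Almost sure bounds *)

Lemma finite_pos_lower_bound (R : realType) (I : finType) (Q : pred I) (f : I -> R) :
  (forall i, Q i -> 0 < f i) -> exists2 e, 0 < e & forall i, Q i -> e <= f i.
Proof.
move=> f0; exists (\big[Num.min/1]_(i | Q i) f i).
  by elim/big_ind: _ => // x y x0 y0; rewrite lt_min x0.
by move=> i Qi; rewrite (bigD1 i)//= ge_min lexx.
Qed.

Section AlmostSure.
Variables (R : realType) (n : nat) (S : {fset seq 'I_n}) (k : nat -> 'I_n -> nat).
Hypothesis k_sum : forall N, (n <= N)%N -> (\sum_(i < n) k N i)%N = N.
Context d (T : measurableType d) (P : probability T R).
Variable xi : nat -> S -> seq (seq bool) -> {RV P >-> R}.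
Hypothesis xi_indep : forall N, (n <= N)%N ->
  mutually_independent (possible_values S (k N) N)
    (fun sw : S * seq (seq bool) => xi N sw.1 sw.2).
Variable lam : S -> probability R R.
Hypothesis xi_law : forall N, (n <= N)%N ->
  forall s w, possible_values S (k N) N (s, w) ->
  is_sample_mean_law (lam s) N (distribution P (xi N s w)).

Lemma exp_moment_as (tt : S -> R) (u : 'I_n -> R) (e : R) :
  (forall s, (mgf (lam s) (tt s) < +oo)%E) -> 0 < e ->
  {ae P, forall w, \forall N \near \oo,
    exp_moment (k N) N (xi N) tt u w <=
    expR (N%:R * \sum_s lmgf (lam s) (tt s) + N%:R * ln 2 +
          \sum_i (k N i)%:R * lcosh (u i) + N%:R * e)}.
Proof.
move=> htt e0.
pose B N := expR (N%:R * \sum_s lmgf (lam s) (tt s) + N%:R * ln 2 +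
          \sum_i (k N i)%:R * lcosh (u i) + N%:R * e).
pose E N := [set w | B N < exp_moment (k N) N (xi N) tt u w].
have mE N : measurable (E N).
  by apply: measurable_gt_cst; apply: measurable_sum => t; exact: measurable_exp_weight.
have := @borel_cantelli_geometric R _ T P E 1 (expR (- e)) (maxn n 1) mE ler01.
case.
- by rewrite expR_ge0 expR_lt1 oppr_lt0.
- move=> N; rewrite geq_max mul1r => /andP[nN N0].
  exact: (exp_moment_markov (k_sum nN) (xi_indep nN) (xi_law nN) N0).
move=> A [mA A0 hA]; exists A; split => // w nE; apply: hA => /= h; apply: nE.
by apply: filterS h => N; rewrite /E /= => /negP; rewrite -leNgt.
Qed.

Variable p : 'I_n -> R.
Local Notation nonempty := (fun s : S => val s != [::]).

Definition cell_count (c : S + 'I_n -> R) (r : R) (N : nat) (w : T) : R :=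
  \sum_(t : N.-tuple bool)
    (good (k N) (fun i t => `|N%:R^-1 * \sum_(b <- t) spin R b - c (inr i)| < r) t &&
     hits (k N) (xi N) nonempty (fun s => [set v | (`|v - c (inl s)| < r)%R]) t w)%:R.

(** The strict constraint of each nonempty B says that its term in the
    relative variance of second_moment is at most e^(- kap N) for a common kap
    > 0. *)
Lemma cell_count_as (c : S + 'I_n -> R) (r : R) (a : S + 'I_n -> R) :
  (\forall N \near \oo, forall s (t : N.-tuple bool),
     expR (- (N%:R * a (inl s))) <=
     fine (P (xi N s (word_spins (k N) t (val s)) @^-1` [set v | (`|v - c (inl s)| < r)%R]))) ->
  (forall i, \forall N \near \oo, expR (N%:R * (p i * ln 2 - a (inr i))) <=
     \sum_(t : (k N i).-tuple bool) (`|N%:R^-1 * \sum_(b <- t) spin R b - c (inr i)| < r)%R%:R) ->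
  (forall B : {set 'I_n}, B != finset.set0 ->
     \sum_(s : S | (val s != [::]) && (symbols (val s) \subset B)) a (inl s) +
     \sum_(i in B) a (inr i) < \sum_(i in B) p i * ln 2) ->
  {ae P, forall w, \forall N \near \oo,
    expR (N%:R * (\sum_i p i * ln 2 - \sum_(s : S | val s != [::]) a (inl s) - \sum_i a (inr i))) / 2
    <= cell_count c r N w}.
Proof.
move=> hs hi hB.
pose gap (B : {set 'I_n}) := \sum_(i in B) p i * ln 2 - \sum_(i in B) a (inr i) -
  \sum_(s : S | (val s != [::]) && (symbols (val s) \subset B)) a (inl s).
have [kap kap0 hkap] : exists2 kap, 0 < kap & forall B : {set 'I_n}, B != finset.set0 -> kap <= gap B.
  apply: (@finite_pos_lower_bound R {set 'I_n} (fun B => B != finset.set0) gap) => B /hB.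
  by rewrite /gap; lra.
have hi' : \forall N \near \oo, forall i, expR (N%:R * (p i * ln 2 - a (inr i))) <=
     \sum_(t : (k N i).-tuple bool) (`|N%:R^-1 * \sum_(b <- t) spin R b - c (inr i)| < r)%R%:R.
  exact: (@filter_forall _ _ (fun i N => expR (N%:R * (p i * ln 2 - a (inr i))) <=
     \sum_(t : (k N i).-tuple bool) (`|N%:R^-1 * \sum_(b <- t) spin R b - c (inr i)| < r)%R%:R)).
have : \forall N \near \oo, [/\ (n <= N)%N, (0 < N)%N,
   forall s (t : N.-tuple bool),
     expR (- (N%:R * a (inl s))) <=
     fine (P (xi N s (word_spins (k N) t (val s)) @^-1` [set v | (`|v - c (inl s)| < r)%R])) &
   forall i, expR (N%:R * (p i * ln 2 - a (inr i))) <=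
     \sum_(t : (k N i).-tuple bool) (`|N%:R^-1 * \sum_(b <- t) spin R b - c (inr i)| < r)%R%:R].
  apply: filterS3 hs hi' (nbhs_infty_ge (maxn n 1)) => N h1 h2.
  by rewrite /= geq_max => /andP[h3 h4]; split.
move=> [N0 _ HN].
have mU s := measurable_window (c (inl s)) r.
pose lo N := expR (N%:R * (\sum_i p i * ln 2 - \sum_(s : S | val s != [::]) a (inl s) - \sum_i a (inr i))) / 2.
pose E N := [set w | cell_count c r N w < lo N].
have mcell N : measurable_fun [set: T] (cell_count c r N) by exact: measurable_hits_count.
have mE N : measurable (E N) := measurable_lt_cst _ (mcell N).
have := @borel_cantelli_geometric R _ T P E (4 * #|{set 'I_n}|%:R) (expR (- kap)) N0 mE.
case.
- by rewrite mulr_ge0.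
- by rewrite expR_ge0 expR_lt1 oppr_lt0.
- move=> N /HN [nN N1 h1 h2].
  pose ql s := expR (- (N%:R * a (inl s))).
  pose Gi (i : 'I_n) (t : seq bool) := `|N%:R^-1 * \sum_(b <- t) spin R b - c (inr i)| < r.
  pose C i : R := \sum_(t : (k N i).-tuple bool) (Gi i t)%:R.
  have Cge i : expR (N%:R * (p i * ln 2 - a (inr i))) <= C i := h2 i.
  have C0 i : 0 < C i by apply: lt_le_trans (Cge i); exact: expR_gt0.
  have Cprod (B : pred 'I_n) : expR (N%:R * (\sum_(i | B i) p i * ln 2 - \sum_(i | B i) a (inr i))) <= \prod_(i | B i) C i.
    rewrite -sumrB mulr_sumr expR_sum; apply: ler_prod => i _.
    by rewrite expR_ge0 /=; exact: Cge.
  have := @second_moment R n S (k N) N (k_sum nN) _ T P (xi N) (xi_indep nN) nonempty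
    (fun s => [set v | (`|v - c (inl s)| < r)%R]) ql (fun s h => h) mU (fun s => expR_gt0 _)
    (fun s t _ => h1 s t) Gi C0.
  set V := \sum_(B | _) _; set cntle := [set w | _] => hV.
  have V_le : V <= #|{set 'I_n}|%:R * expR (- kap) ^+ N.
    apply: (@le_trans _ _ (\sum_(B : {set 'I_n} | B != finset.set0) expR (- kap) ^+ N)).
      apply: ler_sum => B /hkap hB'.
      apply: (@le_trans _ _ (expR (- (N%:R * gap B)))); last first.
        by rewrite -expRM_natl ler_expR mulrN lerN2 ler_wpM2l.
      have -> : - (N%:R * gap B) =
          N%:R * (\sum_(s : S | (val s != [::]) && (symbols (val s) \subset B)) a (inl s))
          - N%:R * (\sum_(i in B) p i * ln 2 - \sum_(i in B) a (inr i)) by rewrite /gap; ring.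
      rewrite expRD expRN; apply: ler_pM.
      - by apply: prodr_ge0 => s _; rewrite invr_ge0 expR_ge0.
      - by rewrite invr_ge0; apply: prodr_ge0 => i _; exact: ltW (C0 i).
      - by rewrite mulr_sumr expR_sum; apply: ler_prod => s _; rewrite /ql expRN invrK expR_ge0 lexx.
      have PC : 0 < \prod_(i in B) C i by apply: prodr_gt0 => i _; exact: C0.
      by rewrite lef_pV2 ?posrE ?expR_gt0//; exact: (Cprod [in B]).
    rewrite big_mkcond/=; apply: (@le_trans _ _ (\sum_(B : {set 'I_n}) expR (- kap) ^+ N)).
      by apply: ler_sum => B _; case: ifP => // _; rewrite exprn_ge0 ?expR_ge0.
    by rewrite sumr_const mulr_natl lexx.
  apply: (@le_trans _ _ (P cntle)).
    apply: le_measure; rewrite ?inE//.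
      exact: measurable_lt_cst (mcell N).
    move=> w /=; rewrite /E /cntle/= => /lt_le_trans; apply.
    rewrite /lo ler_pM2r ?invr_gt0//.
    have -> : N%:R * (\sum_i p i * ln 2 - \sum_(s : S | val s != [::]) a (inl s) - \sum_i a (inr i))
      = \sum_(s : S | val s != [::]) - (N%:R * a (inl s)) +
        N%:R * (\sum_i p i * ln 2 - \sum_i a (inr i)).
      by rewrite sumrN -mulr_sumr; ring.
    rewrite expRD expR_sum; apply: ler_wpM2l; last exact: (Cprod xpredT).
    by apply: prodr_ge0 => s _; exact: expR_ge0.
  apply: (le_trans hV); rewrite lee_fin -mulrA ler_pM2l//.
move=> A [mA A0 hA]; exists A; split => // w nE; apply: hA => /= h; apply: nE.
by apply: filterS h => N; rewrite /E /= => /negP; rewrite -leNgt.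
Qed.

End AlmostSure.

(** * Rates and constraints in joint coordinates *)

(** Words and blocks are treated alike as coordinates: the sum type S + 'I_n
    indexes them, with p_i lcosh playing the part of the log-mgf for the block
    i. *)
Section CoordinateRates.
Variables (R : realType) (n : nat) (S : {fset seq 'I_n}).
Variables (p : 'I_n -> R) (lam : S -> probability R R).
Hypothesis p_gt0 : forall i, 0 < p i.
Hypothesis lam_mgf : forall s, [set rho : R | (log_mgf (lam s) rho < +oo)%E]° 0.

Local Notation coord := (S + 'I_n)%type.

(** The coordinates that a configuration determines by its blocks in A. *)
Definition inside (A : {set 'I_n}) (j : coord) : bool :=
  match j with inl s => symbols (val s) \subset A | inr i => i \in A end.

Definition budget (A : {set 'I_n}) : R := \sum_(i in A) p i * ln 2.

Definition coord_dom (j : coord) (t : R) : Prop :=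
  match j with inl s => (mgf (lam s) t < +oo)%E | inr _ => True end.

Definition coord_lmgf (j : coord) (t : R) : R :=
  match j with inl s => lmgf (lam s) t | inr i => p i * lcosh t end.

Definition coord_rate (j : coord) (z : R) : \bar R :=
  match j with inl s => rate (lam s) z | inr i => ((p i)%:E * rate0 (z / p i))%E end.

(** The zero of the rate. *)
Definition coord_center (j : coord) : R :=
  match j with inl s => mean (lam s) | inr _ => 0 end.

Lemma mgf_near0 s : exists2 t, 0 < t & (mgf (lam s) t < +oo)%E /\ (mgf (lam s) (- t) < +oo)%E.
Proof.
have := lam_mgf s; rewrite /interior /= => /nbhs_ballP[e /= e0 he].
exists (e / 2); first by rewrite divr_gt0.
by split; rewrite -log_mgf_lty; apply: he; rewrite /ball/= sub0r ?opprK ?normrN gtr0_norm ?divr_gt0//; lra.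
Qed.

Lemma inside_setT j : inside [set: 'I_n]%SET j.
Proof. by case: j => [s|i] /=; rewrite ?subsetT ?inE. Qed.

Lemma coord_dom0 j : coord_dom j 0.
Proof. by case: j => [s|i] //=; rewrite mgf0 ltry. Qed.

Lemma coord_lmgf0 j : coord_lmgf j 0 = 0.
Proof. by case: j => [s|i] /=; rewrite ?lmgf0// lcosh0 mulr0. Qed.

Lemma coord_rate_ge0 j z : (0 <= coord_rate j z)%E.
Proof.
by case: j => [s|i] /=; rewrite ?rate_ge0// mule_ge0 ?rate0_ge0// lee_fin ltW.
Qed.

Lemma coord_rate_gt j c z : (c%:E < coord_rate j z)%E ->
  exists2 q : rat, coord_dom j (ratr q) & c < ratr q * z - coord_lmgf j (ratr q).
Proof.
case: j => [s|i] /=; first exact: rate_gt_rat.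
rewrite muleC -lte_pdivrMr// -EFinM => /rate0_gtP[u hu].
have hc : c < u * z - p i * lcosh u.
  have p0 := p_gt0 i.
  have : p i * (c / p i) < p i * (u * (z / p i) - lcosh u) by rewrite ltr_pM2l.
  have -> : p i * (c / p i) = c by rewrite mulrC divfK// gt_eqF.
  have -> : p i * (u * (z / p i) - lcosh u) = u * z - p i * lcosh u.
    by field; rewrite gt_eqF.
  by [].
apply: (@rational_slope R (fun=> True) (fun u => p i * lcosh u) c u z) => // v th _ th01.
by split => //; rewrite mulrCA ler_wpM2l ?lcosh_scale// ltW.
Qed.

Lemma rational_scale (t : R) : 0 < t -> exists2 q : rat, 0 < (ratr q : R) &
  exists2 th, 0 <= th <= 1 & ratr q = th * t.
Proof.
move=> t0; have [q] := rat_in_itvoo t0; rewrite in_itv/= => /andP[q0 qt].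
exists q => //; exists (ratr q / t); last by rewrite divfK// gt_eqF.
by apply/andP; split; [rewrite divr_ge0// ltW|rewrite ler_pdivrMr// mul1r ltW].
Qed.

Lemma coord_dom_pos j : exists2 q : rat, 0 < (ratr q : R) & coord_dom j (ratr q).
Proof.
case: j => [s|i] /=; last by exists 1 => //; rewrite rmorph1.
have [t t0 [tp _]] := mgf_near0 s.
have [q q0 [th th01 E]] := rational_scale t0.
by exists q => //; rewrite E; have [] := lmgf_scale tp th01.
Qed.

Lemma coord_dom_neg j : exists2 q : rat, (ratr q : R) < 0 & coord_dom j (ratr q).
Proof.
case: j => [s|i] /=; last by exists (-1) => //; rewrite rmorphN1 ltrN10.
have [t t0 [_ tm]] := mgf_near0 s.
have [q q0 [th th01 E]] := rational_scale t0.
exists (- q); first by rewrite rmorphN oppr_lt0.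
by rewrite rmorphN /= E -mulrN; have [] := lmgf_scale tm th01.
Qed.

Lemma coord_rate_shrink j (z e r : R) : 0 <= e <= 1 -> (coord_rate j z <= r%:E)%E ->
  (coord_rate j ((1 - e) * z + e * coord_center j) <= ((1 - e) * r)%:E)%E.
Proof.
case: j => [s|i] /= e01.
  by have [t t0 [tp tm]] := mgf_near0 s; exact: (rate_shrink t0 tp tm).
have p0 := p_gt0 i; move=> h.
have h1 : (rate0 (z / p i) <= ((p i)^-1 * r)%:E)%E.
  by rewrite EFinM lee_pdivlMl.
have -> : ((1 - e) * z + e * 0) / p i = (1 - e) * (z / p i) by ring.
rewrite -lee_pdivlMl// -EFinM [X in (_ <= X%:E)%E]mulrCA.
exact: rate0_shrink.
Qed.

Definition glue (x : S -> R) (y : 'I_n -> R) (j : coord) : R :=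
  match j with inl s => x s | inr i => y i end.

Lemma sum_inside (V : nmodType) (A : {set 'I_n}) (F : coord -> V) :
  \sum_(j | inside A j) F j =
  \sum_(s : S | symbols (val s) \subset A) F (inl s) + \sum_(i in A) F (inr i).
Proof. by rewrite big_sumType. Qed.

Lemma domain_rate (x : S -> R) (y : 'I_n -> R) :
  domain inside budget coord_rate (glue x y) <-> rate_domain p lam (x, y).
Proof.
by split => h A; have := h A; rewrite sum_inside.
Qed.

Lemma rate_sum_coord x y : rate_sum p lam x y = (\sum_j coord_rate j (glue x y j))%E.
Proof. by rewrite big_sumType. Qed.

End CoordinateRates.

(** * The two inputs of the upper bound *)

Section JointCoordinates.
Variables (R : realType) (n : nat) (S : {fset seq 'I_n}) (k : nat -> 'I_n -> nat).
Variable p : 'I_n -> R.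
Hypothesis k_sum : forall N, (n <= N)%N -> (\sum_(i < n) k N i)%N = N.
Hypothesis k_lim : forall i, ((k N i)%:R / N%:R : R) @[N --> \oo] --> p i.
Hypothesis p_gt0 : forall i, 0 < p i.
Variable lam : S -> probability R R.
Hypothesis lam_mgf : forall s, [set rho : R | (log_mgf (lam s) rho < +oo)%E]° 0.
Local Notation coord := (S + 'I_n)%type.
Local Notation inside := (@inside n S).
Local Notation coord_dom := (@coord_dom R n S lam).
Local Notation coord_lmgf := (@coord_lmgf R n S p lam).

Lemma weighted_lim (c : 'I_n -> R) (e : R) : 0 < e ->
  \forall N \near \oo, `|\sum_i (k N i)%:R / N%:R * c i - \sum_i p i * c i| < e.
Proof.
move=> e0.
have C : (\sum_i (k N i)%:R / N%:R * c i) @[N --> \oo] --> \sum_i p i * c i.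
  apply: cvg_big => [|i _]; last exact: cvgMl.
  by apply: add_continuous.
by move/cvgrPdist_lt : C => /(_ e e0); apply: filterS => N; rewrite distrC.
Qed.

Lemma sum_p : \sum_i p i = 1.
Proof.
apply/eqP; rewrite -subr_eq0 -normr_le0 leNgt; apply/negP => h0.
have [N0 _ HN] := weighted_lim (fun=> 1) h0.
have := HN (maxn N0 n.+1); rewrite /= leq_maxl => /(_ isT).
under eq_bigr do rewrite mulr1; under [X in _ - X]eq_bigr do rewrite mulr1.
rewrite -mulr_suml -natr_sum k_sum; last by rewrite leq_max leqnSn orbT.
by rewrite divff ?pnatr_eq0 -?lt0n ?leq_max ?ltnS ?orbT// distrC ltxx.
Qed.

Lemma budget_setT : budget p [set: 'I_n]%SET = ln 2.
Proof.
rewrite /budget -[RHS]mul1r -sum_p mulr_suml; apply: eq_bigl => i.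
by rewrite inE.
Qed.

Section Disorder.
Variable X : forall N : nat, S -> seq (seq bool) -> R.

Definition zeta N (t : N.-tuple bool) (j : coord) : R :=
  match j with
  | inl s => X N s (word_spins (k N) t (val s))
  | inr i => block_mean R (k N) N t i
  end.

Definition exp_sum (N : nat) (tau : {ffun coord -> rat}) : R :=
  \sum_(t : N.-tuple bool) expR (N%:R * (\sum_s ratr (tau (inl s)) * zeta t (inl s)
     + \sum_i ratr (tau (inr i)) * zeta t (inr i))).

Hypothesis exp_sum_le : forall tau : {ffun coord -> rat},
  (forall j, coord_dom j (ratr (tau j))) -> forall m : nat,
  \forall N \near \oo, exp_sum N tau <=
    expR (N%:R * (\sum_s lmgf (lam s) (ratr (tau (inl s)))) + N%:R * ln 2 +
      \sum_i (k N i)%:R * lcosh (ratr (tau (inr i))) + N%:R * (m.+1%:R^-1)).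

Lemma exp_sum_upper (tau : {ffun coord -> rat}) (e : R) :
  (forall j, coord_dom j (ratr (tau j))) -> 0 < e ->
  \forall N \near \oo, exp_sum N tau <=
    expR (N%:R * (\sum_j coord_lmgf j (ratr (tau j)) + budget p [set: 'I_n]%SET + e)).
Proof.
move=> dtau e0; rewrite budget_setT.
have -> : \sum_j coord_lmgf j (ratr (tau j)) = \sum_s lmgf (lam s) (ratr (tau (inl s))) +
    \sum_i p i * lcosh (ratr (tau (inr i))) by rewrite big_sumType.
have e2 : 0 < e / 2 by rewrite divr_gt0.
have em : (Num.truncn (e / 2)^-1).+1%:R^-1 <= e / 2.
  by rewrite -[leRHS]invrK lef_pV2 ?posrE ?invr_gt0// ltW// truncnS_gt.
apply: filterS3 (exp_sum_le dtau (Num.truncn (e / 2)^-1))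
  (weighted_lim (fun i => lcosh (ratr (tau (inr i)))) e2) (nbhs_infty_gt 0) => N h1 h2 N0.
apply: (le_trans h1); rewrite ler_expR.
have N0' : 0 < N%:R :> R by rewrite ltr0n.
have -> : \sum_i (k N i)%:R * lcosh (ratr (tau (inr i))) =
   N%:R * \sum_i (k N i)%:R / N%:R * lcosh (ratr (tau (inr i))) :> R.
  rewrite mulr_sumr; apply: eq_bigr => i _.
  by rewrite mulrA [N%:R * _]mulrC divfK// gt_eqF.
rewrite -!mulrDr ler_pM2l//.
move: h2; rewrite ltr_distl /= => /andP[_ h2].
set A2 := \sum_i p i * lcosh _ in h2 *; set A3 := \sum_i _ / _ * _ in h2 *; set A4 := (_.+1%:R^-1) in em *.
lra.
Qed.

Lemma zeta_expmoment_upper (tau : {ffun coord -> rat}) :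
  (forall j, coord_dom j (ratr (tau j))) -> forall e, 0 < e ->
  \forall N \near \oo,
    \sum_(t : N.-tuple bool) expR (N%:R * \sum_j ratr (tau j) * zeta t j) <=
    expR (N%:R * (\sum_j coord_lmgf j (ratr (tau j)) + budget p [set: 'I_n]%SET + e)).
Proof.
move=> dtau e e0; apply: filterS (exp_sum_upper dtau e0) => N.
by congr (_ <= _); apply: eq_bigr => t _; rewrite big_sumType.
Qed.

(** The blocks outside A are free, and there are 2^(k N i) values for the
    block i. *)
Lemma card_agree N (A : {set 'I_n}) (t : N.-tuple bool) : (n <= N)%N ->
  \sum_(t' : N.-tuple bool | [forall i in A, block (k N) t' i == block (k N) t i]) 1
  = expR ((\sum_(i in ~: A) (k N i)%:R) * ln 2) :> R.
Proof.
move=> nN.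
pose F i (s : seq bool) : R := if i \in A then (s == block (k N) t i)%:R else 1.
transitivity (\sum_(t' : N.-tuple bool) \prod_(i < n) F i (block (k N) t' i)).
  rewrite big_mkcond/=; apply: eq_bigr => t' _; case: ifP => [/forall_inP h|].
    by rewrite big1// => i _; rewrite /F; case: ifP => // /h ->.
  move=> /negbT; rewrite negb_forall_in => /exists_inP[i iA hi].
  by rewrite (bigD1 i)//= /F iA (negbTE hi) mul0r.
rewrite (big_blocks (k_sum nN) F) (bigID [in A])/= [X in X * _]big1 ?mul1r; last first.
  move=> i iA; have sb : size (block (k N) t i) == k N i by rewrite (size_block (k_sum nN)).
  rewrite (bigD1 (Tuple sb))//= big1 ?addr0; first by rewrite /F iA eqxx.
  move=> s st; rewrite /F iA; have -> : (tval s == block (k N) t i) = false => //.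
  by apply: contra_neqF st => /eqP h; apply/val_inj.
rewrite mulr_suml expR_sum; apply: eq_big => i; first by rewrite inE.
move=> /negbTE iA; rewrite (eq_bigr (fun=> 1)); last by move=> s _; rewrite /F iA.
by rewrite sumr_const card_tuple card_bool natrX expRM_natl lnK ?posrE.
Qed.

(** The value of the linear form at t, with slopes supported inside A, is
    shared by all the configurations that agree with t on the blocks of A.
    There are about e^(N (ln 2 - budget A)) of them, while the exponential sum
    is at most e^(N (sum of the log-mgf + ln 2 + o(1))). *)
Lemma zeta_linear_upper (A : {set 'I_n}) (tau : {ffun coord -> rat}) :
  (forall j, inside A j -> coord_dom j (ratr (tau j))) -> forall e, 0 < e ->
  \forall N \near \oo, forall t : N.-tuple bool,
    \sum_(j | inside A j) (ratr (tau j) * zeta t j - coord_lmgf j (ratr (tau j))) <= budget p A + e.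
Proof.
move=> dtau e e0.
pose tau' := [ffun j => if inside A j then tau j else 0] : {ffun coord -> rat}.
have dtau' j : coord_dom j (ratr (tau' j)).
  by rewrite ffunE; case: ifP => [/dtau//|_]; rewrite rmorph0; exact: coord_dom0.
have e2 : 0 < e / 2 by rewrite divr_gt0.
(* With these weights the logarithm of the number of agreeing configurations
   is the sum of the k N i c i, and weighted_lim computes its limit. *)
pose c i : R := if i \in A then 0 else ln 2.
apply: filterS3 (exp_sum_upper dtau' e2) (weighted_lim c e2) (nbhs_infty_ge (maxn n 1)).
move=> N h1 h2; rewrite /= geq_max => /andP[nN N0] t.
have N0' : 0 < N%:R :> R by rewrite ltr0n.
pose l := \sum_(j | inside A j) ratr (tau j) * zeta t j.
have Ec : N%:R * \sum_i (k N i)%:R / N%:R * c i = (\sum_(i in ~: A) (k N i)%:R) * ln 2.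
  rewrite mulr_sumr mulr_suml [RHS]big_mkcond/=; apply: eq_bigr => i _.
  rewrite inE /c; case: (i \in A) => /=; first by rewrite !mulr0.
  by rewrite mulrA [N%:R * _]mulrC divfK// gt_eqF.
have h3 : expR (N%:R * l) * expR ((\sum_(i in ~: A) (k N i)%:R) * ln 2) <= exp_sum N tau'.
  rewrite -(card_agree A t nN) mulr_sumr big_mkcond/=.
  apply: ler_sum => t' _; case: ifP => [/forall_inP ag|_]; last exact: expR_ge0.
  rewrite mulr1 ler_expR ler_pM2l// le_eqVlt; apply/orP; left; apply/eqP.
  rewrite /l big_mkcond/= big_sumType/=; congr (_ + _).
    apply: eq_bigr => s _; rewrite ffunE /=; case: ifP => sA; last by rewrite rmorph0 mul0r.
    congr (_ * X _ _ _); apply/esym/eq_in_map => i si.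
    by apply/eqP/ag; move/fintype.subsetP : sA; apply; rewrite inE.
  apply: eq_bigr => i _; rewrite ffunE /=; case: ifP => iA; last by rewrite rmorph0 mul0r.
  by rewrite /block_mean (eqP (ag i iA)).
have := le_trans h3 h1; rewrite -expRD ler_expR -Ec -mulrDr ler_pM2l// => h4.
have Eg : \sum_j coord_lmgf j (ratr (tau' j)) = \sum_(j | inside A j) coord_lmgf j (ratr (tau j)).
  rewrite [RHS]big_mkcond/=; apply: eq_bigr => j _; rewrite ffunE.
  by case: ifP => // _; rewrite rmorph0 coord_lmgf0.
rewrite Eg in h4; rewrite sumrB -/l.
have Eb : budget p [set: 'I_n]%SET = budget p A + \sum_i p i * c i.
  rewrite /budget (eq_bigl xpredT); last by move=> i; rewrite inE.
  rewrite (bigID [in A])/=; congr (_ + _).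
  rewrite [LHS]big_mkcond/=; apply: eq_bigr => i _; rewrite /c.
  by case: (i \in A); rewrite ?mulr0.
rewrite Eb in h4; move: h2; rewrite ltr_distl => /andP[h2 _].
lra.
Qed.

End Disorder.
End JointCoordinates.

(** * Upper bound for the partition function *)

Lemma ereal_real_between (R : realType) (l : \bar R) (c : R) : (l < c%:E)%E ->
  exists2 c1 : R, (l < c1%:E)%E & c1 < c.
Proof.
case: l => [l| |]//.
  by rewrite lte_fin => lc; exists ((l + c) / 2); rewrite ?lte_fin; lra.
by move=> _; exists (c - 1); [exact: ltNyr|lra].
Qed.

Lemma ereal_cvg_between (R : realType) (x : nat -> R) (l : \bar R) :
  (forall c : R, (l < c%:E)%E -> \forall N \near \oo, x N <= c) ->
  (forall c : R, (c%:E < l)%E -> \forall N \near \oo, c <= x N) ->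
  (x N)%:E @[N --> \oo] --> l.
Proof.
case: l => [l| |] hu hl.
- apply: cvg_EFin; first by apply: nearW.
  apply/cvgrPdist_le => e e0.
  have h1 : (l%:E < (l + e)%:E)%E by rewrite lte_fin ltrDl.
  have h2 : ((l - e)%:E < l%:E)%E by rewrite lte_fin gtrBl.
  apply: filterS2 (hu _ h1) (hl _ h2) => N a1 a2 /=.
  by rewrite ler_distlC a1 a2.
- apply/cvgeyPge => A; apply: filterS (hl A (ltry _)) => N.
  by rewrite lee_fin.
- apply/cvgeNyPle => A; apply: filterS (hu A (ltNyr _)) => N.
  by rewrite lee_fin.
Qed.

Section PartitionUpper.
Variables (R : realType) (n : nat) (S : {fset seq 'I_n}) (k : nat -> 'I_n -> nat).
Variable p : 'I_n -> R.
Hypothesis k_sum : forall N, (n <= N)%N -> (\sum_(i < n) k N i)%N = N.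
Hypothesis k_lim : forall i, ((k N i)%:R / N%:R : R) @[N --> \oo] --> p i.
Hypothesis p_gt0 : forall i, 0 < p i.
Variable lam : S -> probability R R.
Hypothesis lam_mgf : forall s, [set rho : R | (log_mgf (lam s) rho < +oo)%E]° 0.
Local Notation coord := (S + 'I_n)%type.
Local Notation inside := (@inside n S).
Local Notation coord_dom := (@coord_dom R n S lam).
Local Notation coord_lmgf := (@coord_lmgf R n S p lam).
Local Notation coord_rate := (@coord_rate R n S p lam).
Local Notation coord_center := (@coord_center R n S lam).
Local Notation Dom := (domain inside (budget p) coord_rate).

Variables (X : forall N : nat, S -> seq (seq bool) -> R).
Local Notation zeta := (@zeta R n S k X).
Hypothesis exp_sum_le : forall tau : {ffun coord -> rat},
  (forall j, coord_dom j (ratr (tau j))) -> forall m : nat,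
  \forall N \near \oo, exp_sum k X N tau <=
    expR (N%:R * (\sum_s lmgf (lam s) (ratr (tau (inl s)))) + N%:R * ln 2 +
      \sum_i (k N i)%:R * lcosh (ratr (tau (inr i))) + N%:R * (m.+1%:R^-1)).

(** The empty word lies inside the empty set, whose budget is zero: by
    zeta_linear_upper its energy eventually stays below every x above the
    mean, and above every x below it. *)
Lemma empty_word_near (s : S) (d : R) : val s = [::] -> 0 < d ->
  \forall N \near \oo, forall t : N.-tuple bool, `|zeta t (inl s) - mean (lam s)| < d.
Proof.
move=> s0 d0; set m := mean (lam s).
have [t0 t00 [tp tm]] := mgf_near0 lam_mgf s.
have ins : inside finset.set0 (inl s).
  by apply/fintype.subsetP => i; rewrite inE s0.
(* The slope q has the sign of x - m, by mean_young; multiplying by it treats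
   both sides at once. *)
have H (x : R) : x != m -> exists2 q : R, 0 < q * (x - m) &
   \forall N \near \oo, forall t : N.-tuple bool, q * zeta t (inl s) < q * x.
  move=> xm; have [u hu u0] := rate_gt0_witness t00 tp tm xm.
  have : (0%:E < rate (lam s) x)%E by apply: lt_le_trans (rate_young x hu); rewrite lte_fin.
  move=> /rate_gt_rat[q hq q0]; exists (ratr q).
    have := mean_young t00 tp tm hq; rewrite -/m; lra.
  pose tau := [ffun j => if j == inl s then q else 0] : {ffun coord -> rat}.
  have dtau j : inside finset.set0 j -> coord_dom j (ratr (tau j)).
    by move=> _; rewrite ffunE; case: eqP => [->//|_]; rewrite rmorph0; exact: coord_dom0.
  pose e := (ratr q * x - lmgf (lam s) (ratr q)) / 2.
  have e0 : 0 < e by rewrite divr_gt0.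
  apply: filterS (zeta_linear_upper k_sum k_lim exp_sum_le dtau e0) => N hN t.
  have := hN t; rewrite (bigD1 (inl s))//= big1 ?addr0; last first.
    by move=> j /andP[_ /negbTE js]; rewrite ffunE js rmorph0 mul0r coord_lmgf0 subrr.
  rewrite ffunE eqxx /budget big_set0 add0r /e; lra.
have md : m + d != m by rewrite gt_eqF// ltrDl.
have md' : m - d != m by rewrite lt_eqF// gtrBl.
have [q1 q10 H1] := H _ md; have [q2 q20 H2] := H _ md'.
have {}q10 : 0 < q1 by move: q10; rewrite addrAC subrr add0r pmulr_lgt0.
have {}q20 : q2 < 0 by move: q20; rewrite addrAC subrr add0r mulrN oppr_gt0 pmulr_llt0.
apply: filterS2 H1 H2 => N h1 h2 t.
by rewrite ltr_distl -(ltr_nM2l q20) h2 -(ltr_pM2l q10) h1.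
Qed.

Variables (f : {ptws S -> R} -> R) (h beta : R).
Hypothesis f_cont : continuous f.

Definition energy (z : coord -> R) : R :=
  - (beta * f (fun s => z (inl s)) + beta * h * \sum_i z (inr i)).

Lemma energy_cont (z : coord -> R) (e : R) : 0 < e -> exists2 d, 0 < d &
  forall z', (forall j, `|z' j - z j| < d) -> `|energy z' - energy z| < e.
Proof.
move=> e0.
have b1 : 0 < 2 * (`|beta| + 1) by rewrite mulr_gt0// ltr_wpDl.
have b2 : 0 < 2 * (`|beta * h| * n%:R + 1) by rewrite mulr_gt0// ltr_wpDl// mulr_ge0.
have [d1 d10 Hd1] := @continuous_box R S f f_cont (fun s => z (inl s)) _ (divr_gt0 e0 b1).
pose d2 := e / (2 * (`|beta * h| * n%:R + 1)).
have d20 : 0 < d2 by rewrite divr_gt0.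
exists (Num.min d1 d2); first by rewrite lt_min d10.
move=> z' hz.
have hf : `|f (fun s => z' (inl s)) - f (fun s => z (inl s))| < e / (2 * (`|beta| + 1)).
  by apply: Hd1 => s; rewrite (lt_le_trans (hz _))// ge_min lexx.
have hs : `|\sum_i z' (inr i) - \sum_i z (inr i)| <= n%:R * d2.
  rewrite -sumrB (le_trans (ler_norm_sum _ _ _))//.
  apply: (@le_trans _ _ (\sum_(i < n) d2)).
    by apply: ler_sum => i _; rewrite ltW// (lt_le_trans (hz _))// ge_min lexx orbT.
  by rewrite sumr_const card_ord mulr_natl.
have -> : energy z' - energy z = - (beta * (f (fun s => z' (inl s)) - f (fun s => z (inl s)))) +
   - ((beta * h) * (\sum_i z' (inr i) - \sum_i z (inr i))) by rewrite /energy; ring.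
rewrite (le_lt_trans (ler_normD _ _))// !normrN [X in X + _]normrM [X in _ + X]normrM.
have h1 : `|beta| * `|f (fun s => z' (inl s)) - f (fun s => z (inl s))| <= `|beta| * (e / (2 * (`|beta| + 1))).
  by rewrite ler_wpM2l// ltW.
have h2 : `|beta * h| * `|\sum_i z' (inr i) - \sum_i z (inr i)| <= `|beta * h| * (n%:R * d2).
  by rewrite ler_wpM2l.
have h3 : `|beta| * (e / (2 * (`|beta| + 1))) < e / 2.
  have -> : e / 2 = (`|beta| + 1) * (e / (2 * (`|beta| + 1))).
    by field; rewrite gt_eqF// ltr_wpDl.
  by rewrite ltr_pM2r ?divr_gt0// ltrDl.
have h4 : `|beta * h| * (n%:R * d2) < e / 2.
  have -> : e / 2 = (`|beta * h| * n%:R + 1) * d2.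
    by rewrite /d2; field; rewrite gt_eqF// ltr_wpDl// mulr_ge0.
  by rewrite mulrA ltr_pM2r// ltrDl.
lra.
Qed.

Lemma partition_functionE N : (n <= N)%N -> (0 < N)%N ->
  partition_function f (k N) (fun s w => X N s w) h beta N =
  \sum_(t : N.-tuple bool) expR (N%:R * energy (zeta t)).
Proof.
move=> nN N0; apply: eq_bigr => t _; congr expR.
rewrite /hamiltonian /energy.
have -> : \sum_(i < N) spin R (tnth t i) = N%:R * \sum_i zeta t (inr i).
  have -> : \sum_(i < N) spin R (tnth t i) = \sum_(b <- t) spin R b by rewrite big_tuple.
  rewrite (sum_blocks (k_sum nN)) mulr_sumr; apply: eq_bigr => i _.
  by rewrite /= /block_mean mulVKf// pnatr_eq0 -lt0n.
rewrite (_ : energies (k N) _ t = fun s => zeta t (inl s))//; ring.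
Qed.

Lemma partition_upper (c c' : R) : c < c' ->
  (forall z, Dom z -> ((energy z + ln 2)%:E - \sum_j coord_rate j (z j) < c%:E)%E) ->
  \forall N \near \oo, partition_function f (k N) (fun s w => X N s w) h beta N <= expR (N%:R * c').
Proof.
move=> cc' hc.
have := @upper_bound R coord {set 'I_n} inside [set: 'I_n]%SET (budget p) coord_dom coord_lmgf coord_rate
  (@inside_setT n S) (@coord_dom0 R n S lam) (@coord_lmgf0 R n S p lam) (coord_rate_ge0 lam p_gt0)
  (coord_rate_gt p_gt0) (coord_dom_pos lam_mgf) (coord_dom_neg lam_mgf) (fun N => N.-tuple bool)
  (fun N t => zeta t)
  (zeta_linear_upper k_sum k_lim exp_sum_le) (zeta_expmoment_upper k_sum k_lim exp_sum_le)
  energy energy_cont c c' cc'.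
rewrite (budget_setT k_sum k_lim) => /(_ hc) H.
apply: filterS2 H (nbhs_infty_ge (maxn n 1)) => N hN; rewrite /= geq_max => /andP[nN N0].
by rewrite partition_functionE.
Qed.

End PartitionUpper.

(** * Lower bound for the partition function *)

Section PartitionLower.
Variables (R : realType) (n : nat) (S : {fset seq 'I_n}) (k : nat -> 'I_n -> nat).
Variable p : 'I_n -> R.
Hypothesis k_sum : forall N, (n <= N)%N -> (\sum_(i < n) k N i)%N = N.
Hypothesis k_lim : forall i, ((k N i)%:R / N%:R : R) @[N --> \oo] --> p i.
Hypothesis p_gt0 : forall i, 0 < p i.
Variable lam : S -> probability R R.
Hypothesis lam_mgf : forall s, [set rho : R | (log_mgf (lam s) rho < +oo)%E]° 0.
Context d (T : measurableType d) (P : probability T R).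
Variable xi : nat -> S -> seq (seq bool) -> {RV P >-> R}.
Hypothesis xi_law : forall N, (n <= N)%N ->
  forall s w, possible_values S (k N) N (s, w) ->
  is_sample_mean_law (lam s) N (distribution P (xi N s w)).
Local Notation coord := (S + 'I_n)%type.
Local Notation inside := (@inside n S).
Local Notation coord_dom := (@coord_dom R n S lam).
Local Notation coord_rate := (@coord_rate R n S p lam).
Local Notation coord_center := (@coord_center R n S lam).
Local Notation Dom := (domain inside (budget p) coord_rate).

(** The data for which the second moment method works: c is the centre of a
    cell of radius r, and a holds exponential costs of its coordinates. Empty
    words are excluded from cell_budget as they are from the count. *)
Record cell_ok (c a : coord -> R) (r : R) : Prop := CellOk {
  cell_words : \forall N \near \oo, forall s (t : N.-tuple bool),
     expR (- (N%:R * a (inl s))) <=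
     fine (P (xi N s (word_spins (k N) t (val s)) @^-1` [set v | (`|v - c (inl s)| < r)%R]));
  cell_blocks : forall i, \forall N \near \oo, expR (N%:R * (p i * ln 2 - a (inr i))) <=
     \sum_(t : (k N i).-tuple bool) (`|N%:R^-1 * \sum_(b <- t) spin R b - c (inr i)| < r)%R%:R;
  cell_budget : forall B : {set 'I_n}, B != finset.set0 ->
     \sum_(s : S | (val s != [::]) && (symbols (val s) \subset B)) a (inl s) +
     \sum_(i in B) a (inr i) < \sum_(i in B) p i * ln 2 }.

Lemma Dom_fin (z : coord -> R) : Dom z -> forall j, coord_rate j (z j) = (fine (coord_rate j (z j)))%:E.
Proof.
move=> Dz j; have cr0 := coord_rate_ge0 lam p_gt0; rewrite fineK// ge0_fin_numE//.
apply: (@le_lt_trans _ _ (budget p [set: 'I_n]%SET)%:E); last exact: ltry.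
apply: le_trans (Dz [set: 'I_n]%SET).
by rewrite (bigD1 j) ?inside_setT//= leeDl// sume_ge0.
Qed.

(** At z itself constraints may be equalities and Cramer's bound may fail.
    Moving z by a factor e towards the zeros of the rates gains e times the
    budget in every constraint, which leaves room for costs a that are
    rational and strictly above the rates; the rational centre c is taken so
    close that the cell contains a window around the moved point. *)
Lemma exists_cell (z : coord -> R) (del eta : R) : Dom z -> 0 < del -> 0 < eta ->
  exists (c a : {ffun coord -> rat}) (m : nat),
  [/\ cell_ok (fun j => ratr (c j)) (fun j => ratr (a j)) m.+1%:R^-1,
      forall j v, `|v - ratr (c j)| < m.+1%:R^-1 -> `|v - z j| < del,
      forall j, 0 <= ratr (a j) :> R &
      \sum_j (ratr (a j) : R) <= \sum_j fine (coord_rate j (z j)) + eta].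
Proof.
move=> Dz del0 eta0.
pose g j := fine (coord_rate j (z j)).
have gE j : coord_rate j (z j) = (g j)%:E by exact: Dom_fin.
have g0 j : 0 <= g j by rewrite -lee_fin -gE coord_rate_ge0.
have gB B : \sum_(j | inside B j) g j <= budget p B.
  by have := Dz B; rewrite (eq_bigr _ (fun j _ => gE j)) sumEFin lee_fin.
have [b0 b00 hb0] : exists2 b0, 0 < b0 & forall B : {set 'I_n}, B != finset.set0 -> b0 <= budget p B.
  apply: (@finite_pos_lower_bound R {set 'I_n} (fun B => B != finset.set0)) => B.
  move=> /set0Pn[i iB]; rewrite /budget (bigD1 i)//= ltr_wpDr//.
    by apply: sumr_ge0 => i' _; rewrite mulr_ge0 ?ln_ge0 ?ler1n// ltW.
  by rewrite mulr_gt0// ln_gt0// ltr1n.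
pose nK := \sum_(j : coord) 1 : R.
have nK0 : 0 <= nK by apply: sumr_ge0.
have nK1 : 0 < nK + 1 by lra.
pose W := \sum_j `|coord_center j - z j|.
have W0 : 0 <= W by apply: sumr_ge0.
have W1 : 0 < W + 1 by lra.
pose e := Num.min 2^-1 (del / 4 / (W + 1)).
have d4 : 0 < del / 4 by rewrite divr_gt0.
have e0 : 0 < e by rewrite lt_min invr_gt0 ltr0n /= divr_gt0.
have e1 : e <= 2^-1 by rewrite ge_min lexx.
have eW : e * (W + 1) <= del / 4 by rewrite -ler_pdivlMr// ge_min lexx orbT.
have e01 : 0 < e < 1 by rewrite e0 (le_lt_trans e1)// invf_lt1// ltr1n.
have e01' : 0 <= e <= 1 by case/andP: e01 => *; rewrite !ltW.
(* The point to which z is moved; e is small enough to keep it within del / 4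
   of z. *)
pose ze j := (1 - e) * z j + e * coord_center j.
have zez j : `|ze j - z j| <= del / 4.
  have -> : ze j - z j = e * (coord_center j - z j) by rewrite /ze; ring.
  rewrite normrM gtr0_norm// (le_trans _ eW)// ler_pM2l//.
  by rewrite /W (bigD1 j)//= -addrA lerDl addr_ge0// sumr_ge0.
(* The total excess of the costs over the rates, at most nK kap, must stay
   below the gain e b0 in the constraints and below eta. *)
pose kap := Num.min (e * b0) eta / (nK + 1).
have kap0 : 0 < kap by rewrite divr_gt0// lt_min mulr_gt0.
have kapK : nK * kap < Num.min (e * b0) eta.
  have E : kap * (nK + 1) = Num.min (e * b0) eta by rewrite /kap divfK// gt_eqF.
  rewrite -E mulrC ltr_pM2l//; lra.
have [kap1 kap2] : nK * kap < e * b0 /\ nK * kap < eta.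
  by move: kapK; rewrite lt_min => /andP[].
pose m := Num.truncn (del / 4)^-1.
pose r := m.+1%:R^-1 : R.
have r0 : 0 < r by rewrite invr_gt0 ltr0n.
have rd : r <= del / 4.
  by rewrite /r -[leRHS]invrK lef_pV2 ?posrE ?invr_gt0 ?ltr0n// ltW// truncnS_gt.
have r2 : 0 < r / 2 by rewrite divr_gt0.
have Hc j : exists q : rat, `|(ratr q : R) - ze j| < r / 2.
  have : ze j - r / 2 < ze j + r / 2 by lra.
  move=> /rat_in_itvoo[q]; rewrite in_itv/= => h; exists q.
  by rewrite ltr_distl.
have Ha j : exists q : rat, (1 - e) * g j < (ratr q : R) < (1 - e) * g j + kap.
  have : (1 - e) * g j < (1 - e) * g j + kap by rewrite ltrDl.
  by move=> /rat_in_itvoo[q]; rewrite in_itv/= => h; exists q.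
have [c0 Hc0] := choice Hc; have [a0 Ha0] := choice Ha.
pose c := [ffun j => c0 j] : {ffun coord -> rat}.
pose a := [ffun j => a0 j] : {ffun coord -> rat}.
have hc j : `|(ratr (c j) : R) - ze j| < r / 2 by rewrite ffunE.
have ha j : (1 - e) * g j < (ratr (a j) : R) < (1 - e) * g j + kap by rewrite ffunE.
have win j v : `|v - ze j| < r / 2 -> `|v - ratr (c j)| < r.
  move=> h; have := hc j; rewrite distrC => h'.
  by have := ler_distD (ze j) v (ratr (c j)); lra.
have eg0 j : 0 <= (1 - e) * g j by rewrite mulr_ge0//; lra.
exists c, a, m; split; rewrite -?/r.
- split.
  + have H (s : S) : \forall N \near \oo, forall mu : probability R R,
        is_sample_mean_law (lam s) N mu ->
        expR (- (N%:R * ratr (a (inl s)))) <= fine (mu [set v | (`|v - ze (inl s)| < r / 2)%R]).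
      have [t t0 [tp tm]] := mgf_near0 lam_mgf s.
      apply: (sample_lower t0 tp tm e01 _ r2 (r := g (inl s))).
        by rewrite -gE.
      by case/andP: (ha (inl s)).
    pose Q (s : S) N := forall mu : probability R R,
        is_sample_mean_law (lam s) N mu ->
        expR (- (N%:R * ratr (a (inl s)))) <= fine (mu [set v | (`|v - ze (inl s)| < r / 2)%R]).
    have H' : \forall N \near \oo, forall s, Q s N by exact: (@filter_forall _ _ Q).
    apply: filterS2 H' (nbhs_infty_ge n) => N hN nN s t.
    have mP x r' : measurable (xi N s (word_spins (k N) t (val s)) @^-1` [set v | (`|v - x| < r')%R]).
      by rewrite -[X in measurable X]setTI; exact: measurable_funP (measurable_window x r').
    have hs : expR (- (N%:R * ratr (a (inl s)))) <=
        fine (P (xi N s (word_spins (k N) t (val s)) @^-1` [set v | (`|v - ze (inl s)| < r / 2)%R])).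
      exact: hN s _ (xi_law nN (possible_word _ t s)).
    apply: (le_trans hs).
    apply: fine_le; [by apply: fin_num_measure; exact: mP|by apply: fin_num_measure; exact: mP|].
    apply: le_measure; rewrite ?inE; [exact: mP|exact: mP|].
    by move=> x /=; exact: win.
  + move=> i.
    have p0 := p_gt0 i.
    have yp : `|ze (inr i)| < p i.
      have := gE (inr i); rewrite /= => E.
      have zp : `|z (inr i) / p i| <= 1.
        apply: (@rate0_fin R _ ((p i)^-1 * g (inr i))).
        by rewrite EFinM lee_pdivlMl// E.
      have zp' : `|z (inr i)| <= p i.
        by move: zp; rewrite normrM normfV (gtr0_norm p0) ler_pdivrMr// mul1r.
      rewrite /ze /= mulr0 addr0 normrM ger0_norm; last lra.
      have : (1 - e) * `|z (inr i)| <= (1 - e) * p i by rewrite ler_wpM2l//; lra.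
      have : 0 < e * p i by rewrite mulr_gt0.
      lra.
    have hr : ((p i)%:E * rate0 (ze (inr i) / p i) < (ratr (a (inr i)))%:E)%E.
      have := @coord_rate_shrink R n S p lam p_gt0 lam_mgf (inr i) (z (inr i)) e (g (inr i)) e01'.
      rewrite gE lexx => /(_ isT) h1; apply: (le_lt_trans h1).
      by rewrite lte_fin; case/andP: (ha (inr i)).
    have := block_count p0 (@k_lim i) yp r2 hr.
    apply: filterS => N h; apply: (le_trans h); apply: ler_sum => t _.
    rewrite ler_nat; case: ltP => // h1.
    by rewrite win.
  + move=> B B0.
    have h1 : \sum_(s : S | (val s != [::]) && (symbols (val s) \subset B)) ratr (a (inl s)) +
        \sum_(i in B) ratr (a (inr i)) <= \sum_(j | inside B j) ratr (a j) :> R.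
      rewrite sum_inside lerD2r [leRHS](bigID (fun s : S => val s != [::]))/=.
      rewrite [X in _ <= X + _](eq_bigl (fun s : S => (val s != [::]) && (symbols (val s) \subset B))); last first.
        by move=> s; rewrite andbC.
      rewrite lerDl; apply: sumr_ge0 => s _.
      by rewrite (le_trans (eg0 (inl s)))// ltW//; case/andP: (ha (inl s)).
    have h2 : \sum_(j | inside B j) ratr (a j) <= (1 - e) * budget p B + nK * kap :> R.
      apply: (@le_trans _ _ (\sum_(j | inside B j) ((1 - e) * g j + kap))).
        by apply: ler_sum => j _; rewrite ltW//; case/andP: (ha j).
      rewrite big_split/= -mulr_sumr lerD//.
        by rewrite ler_wpM2l ?gB//; lra.
      rewrite /nK mulr_suml big_mkcond/=; apply: ler_sum => j _.
      by rewrite mul1r; case: ifP => // _; rewrite ltW.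
    have h3 := hb0 B B0.
    have h4 : e * b0 <= e * budget p B by rewrite ler_pM2l.
    rewrite -/(budget p B); lra.
- move=> j v h; have h1 := hc j; have h2 := zez j.
  have h3 := ler_distD (ratr (c j)) v (z j).
  have h4 := ler_distD (ze j) (ratr (c j)) (z j).
  lra.
- by move=> j; rewrite (le_trans (eg0 j))// ltW//; case/andP: (ha j).
apply: (@le_trans _ _ (\sum_j (g j + kap))).
  apply: ler_sum => j _; case/andP: (ha j) => _ /ltW h; apply: (le_trans h).
  have : 0 <= e * g j by rewrite mulr_ge0// ltW.
  lra.
rewrite big_split/= lerD2l ltW//.
rewrite (_ : \sum_j kap = nK * kap)//.
by rewrite /nK mulr_suml; apply: eq_bigr => j _; rewrite mul1r.
Qed.

Variable w : T.
Local Notation X := (fun N s v => xi N s v w).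
Local Notation zeta := (@zeta R n S k X).
Hypothesis exp_sum_le : forall tau : {ffun coord -> rat},
  (forall j, coord_dom j (ratr (tau j))) -> forall m : nat,
  \forall N \near \oo, exp_sum k X N tau <=
    expR (N%:R * (\sum_s lmgf (lam s) (ratr (tau (inl s)))) + N%:R * ln 2 +
      \sum_i (k N i)%:R * lcosh (ratr (tau (inr i))) + N%:R * (m.+1%:R^-1)).
Hypothesis cell_count_ge : forall (c a : {ffun coord -> rat}) (m : nat),
  cell_ok (fun j => ratr (c j)) (fun j => ratr (a j)) m.+1%:R^-1 ->
  \forall N \near \oo,
    expR (N%:R * (\sum_i p i * ln 2 - \sum_(s : S | val s != [::]) ratr (a (inl s)) - \sum_i ratr (a (inr i)))) / 2
    <= cell_count k xi (fun j => ratr (c j)) m.+1%:R^-1 N w.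

(** The constraint of the empty set bounds its rate by zero. *)
Lemma Dom_empty_word (z : coord -> R) (s : S) : Dom z -> val s = [::] -> z (inl s) = mean (lam s).
Proof.
move=> Dz s0; apply/eqP/contraT => zm.
have [t t0 [tp tm]] := mgf_near0 lam_mgf s.
have [u hu u0] := rate_gt0_witness t0 tp tm zm.
have ins : inside finset.set0 (inl s).
  by apply/fintype.subsetP => i; rewrite inE s0.
have := Dz finset.set0; rewrite /budget big_set0 (bigD1 (inl s))//= => h.
have h1 : (rate (lam s) (z (inl s)) <= 0%:E)%E.
  apply: le_trans h; rewrite leeDl// sume_ge0// => j _.
  exact: coord_rate_ge0.
by have := le_trans (rate_young (z (inl s)) hu) h1; rewrite lee_fin leNgt u0.
Qed.

Variables (f : {ptws S -> R} -> R) (h beta : R).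
Hypothesis f_cont : continuous f.
Local Notation energy := (@energy R n S f h beta).

(** All the configurations of a cell close to z have energy at least energy z
    - sl / 4, and exists_cell with cell_count_ge bounds their number from
    below. The words which the count ignores are empty, and their energies are
    close to those of z by empty_word_near. *)
Lemma partition_lower (z : coord -> R) (c0 : R) : Dom z ->
  c0 < energy z + ln 2 - \sum_j fine (coord_rate j (z j)) ->
  \forall N \near \oo, expR (N%:R * c0) <=
    partition_function f (k N) (fun s v => xi N s v w) h beta N.
Proof.
move=> Dz hc0.
pose sl := energy z + ln 2 - \sum_j fine (coord_rate j (z j)) - c0.
have sl0 : 0 < sl by rewrite subr_gt0.
have eta0 : 0 < sl / 4 by rewrite divr_gt0.
have [del del0 Hdel] := @energy_cont R n S f h beta f_cont z _ eta0.
have [c [a [m [cok near_z a0 suma]]]] := exists_cell Dz del0 eta0.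
have Hempty : \forall N \near \oo, forall s : S, val s = [::] ->
    forall t : N.-tuple bool, `|zeta t (inl s) - z (inl s)| < del.
  pose Q (s : S) N := val s = [::] -> forall t : N.-tuple bool, `|zeta t (inl s) - z (inl s)| < del.
  apply: (@filter_forall _ _ Q) => s; rewrite /Q.
  have [s0|/eqP s0] := eqVneq (val s) [::]; last by apply: nearW => N /s0.
  rewrite (Dom_empty_word Dz s0).
  by apply: filterS (empty_word_near k_sum k_lim lam_mgf exp_sum_le s0 del0) => N hN _.
have sl2 : 0 <= expR (- (sl / 2)) < 1 by rewrite expR_ge0 expR_lt1; lra.
have i2 : (0 : R) < 2^-1 by rewrite invr_gt0.
have H12 : \forall N \near \oo, (maxn n 1 <= N)%N /\ expR (- (sl / 2)) ^+ N < 2^-1.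
  by apply: filterS2 (nbhs_infty_ge (maxn n 1)) (near_expr_lt sl2 i2) => N.
apply: filterS3 (cell_count_ge cok) Hempty H12 => N h1 h2 [].
rewrite geq_max => /andP[nN N0] h3.
rewrite (partition_functionE k_sum (fun N s v => xi N s v w))//.
apply: (@le_trans _ _ (expR (N%:R * (energy z - sl / 4)) *
    cell_count k xi (fun j => ratr (c j)) m.+1%:R^-1 N w)); last first.
  rewrite /cell_count mulr_sumr; apply: ler_sum => t _.
  case: andP => [[/forallP gt /forallP ht]|_]; last by rewrite mulr0 expR_ge0.
  rewrite mulr1 ler_expR ler_wpM2l//.
  have hz j : `|zeta t j - z j| < del.
    case: j => [s|i]; last by apply: near_z; exact: gt.
    have [s0|s0] := eqVneq (val s) [::]; first exact: h2.
    by apply: near_z; have := ht s; rewrite s0 /= inE.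
  have := Hdel _ hz; rewrite ltr_distl => /andP[h4 _].
  exact: ltW.
have lb := ler_wpM2l (expR_ge0 (N%:R * (energy z - sl / 4))) h1.
apply: le_trans lb.
set A := \sum_(s : S | _) _; set B := \sum_i ratr _.
have AB : A + B <= \sum_j fine (coord_rate j (z j)) + sl / 4.
  apply: le_trans suma.
  rewrite big_sumType lerD2r /A [leRHS](bigID (fun s : S => val s != [::]))/= lerDl.
  by apply: sumr_ge0.
have pE : \sum_i p i * ln 2 = ln 2 by rewrite -mulr_suml (sum_p k_sum k_lim) mul1r.
rewrite pE mulrA -expRD -mulrDr.
have h5 : expR (N%:R * (c0 + sl / 2)) <= expR (N%:R * (energy z - sl / 4 + (ln 2 - A - B))).
  rewrite ler_expR ler_wpM2l//.
  have : sl = energy z + ln 2 - \sum_j fine (coord_rate j (z j)) - c0 by [].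
  lra.
apply: (@le_trans _ _ (expR (N%:R * (c0 + sl / 2)) / 2)); last by rewrite ler_wpM2r.
rewrite mulrDr expRD -mulrA ler_peMr ?expR_ge0//.
move: h3; rewrite -expRM_natl mulrN expRN => h3.
rewrite ler_pdivlMr// mul1r -[leLHS]invrK -[leRHS]invrK lef_pV2 ?posrE ?invr_gt0 ?expR_gt0//.
by rewrite ltW.
Qed.

End PartitionLower.

(** * The limit *)

Theorem theorem4p3p4 (R : realType)
    (* symbols and words *)
    (n : nat) (n_gt0 : (0 < n)%N) (S : {fset seq 'I_n})
    (S_cover : forall i : 'I_n, exists s : S, i \in val s)
    (* block lengths *)
    (k : nat -> 'I_n -> nat) (p : 'I_n -> R)
    (k_gt0 : forall N, (n <= N)%N -> forall i, (1 <= k N i)%N)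
    (k_sum : forall N, (n <= N)%N -> (\sum_(i < n) k N i)%N = N)
    (k_lim : forall i, ((k N i)%:R / N%:R : R) @[N --> \oo] --> p i)
    (p_gt0 : forall i, 0 < p i)
    (* driving distributions *)
    (lam : S -> probability R R)
    (lam_mgf : forall s, [set rho : R | (log_mgf (lam s) rho < +oo)%E]° 0)
    (* disorder, all N on one probability space *)
    (d : measure_display) (T : measurableType d) (P : probability T R)
    (xi : nat -> S -> seq (seq bool) -> {RV P >-> R})
    (xi_indep : forall N, (n <= N)%N ->
       mutually_independent (possible_values S (k N) N)
         (fun sw : S * seq (seq bool) => xi N sw.1 sw.2))
    (xi_law : forall N, (n <= N)%N ->
       forall s w, possible_values S (k N) N (s, w) ->
       is_sample_mean_law (lam s) N (distribution P (xi N s w)))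
    (* energy function and field intensity *)
    (f : {ptws S -> R} -> R) (f_cont : continuous f)
    (h : R) (h_ge0 : 0 <= h) :
  {ae P, forall omega, forall beta : R, 0 < beta ->
    (N%:R^-1 * ln (partition_function f (k N) (fun s w => xi N s w omega)
                     h beta N))%:E @[N --> \oo] -->
    ((ln 2)%:E -
     ereal_inf
       [set ((beta * f xy.1 + beta * h * \sum_(i < n) xy.2 i)%:E
             + rate_sum p lam xy.1 xy.2)%E
       | xy in rate_domain p lam])%E}.
Proof.
(* Both almost sure bounds are taken for countably many parameters at once,
   before beta is chosen: the exceptional set does not depend on beta. *)
pose coord := (S + 'I_n)%type.
have as_upper : {ae P, forall w, forall tm : {ffun coord -> rat} * nat,
    (forall j, coord_dom lam j (ratr (tm.1 j))) -> \forall N \near \oo,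
    exp_sum k (fun N s v => xi N s v w) N tm.1 <=
    expR (N%:R * (\sum_s lmgf (lam s) (ratr (tm.1 (inl s)))) + N%:R * ln 2 +
      \sum_i (k N i)%:R * lcosh (ratr (tm.1 (inr i))) + N%:R * (tm.2.+1%:R^-1))}.
  apply: ae_forall_countable => -[tau m] /=.
  have [htau|ntau] := pselect (forall j, coord_dom lam j (ratr (tau j) : R)); last first.
    by apply: aeW => w /ntau.
  have m0 : 0 < (m.+1%:R^-1 : R) by rewrite invr_gt0 ltr0n.
  have := @exp_moment_as R n S k k_sum _ T P xi xi_indep lam xi_law (fun s => ratr (tau (inl s)))
    (fun i => ratr (tau (inr i))) _ (fun s => htau (inl s)) m0.
  by apply: filterS => w hw _.
have as_lower : {ae P, forall w, forall cam : {ffun coord -> rat} * {ffun coord -> rat} * nat,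
    cell_ok k p xi (fun j => ratr (cam.1.1 j)) (fun j => ratr (cam.1.2 j)) cam.2.+1%:R^-1 ->
    \forall N \near \oo,
    expR (N%:R * (\sum_i p i * ln 2 - \sum_(s : S | val s != [::]) ratr (cam.1.2 (inl s)) - \sum_i ratr (cam.1.2 (inr i)))) / 2
    <= cell_count k xi (fun j => ratr (cam.1.1 j)) cam.2.+1%:R^-1 N w}.
  apply: ae_forall_countable => -[[c a] m] /=.
  have [ok|nok] := pselect (cell_ok k p xi (fun j => ratr (c j)) (fun j => ratr (a j)) m.+1%:R^-1); last first.
    by apply: aeW => w /nok.
  have := cell_count_as k_sum xi_indep (cell_words ok) (cell_blocks ok) (cell_budget ok).
  by apply: filterS => w hw _.
apply: filterS2 as_upper as_lower => w hup hlow beta beta0.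
have hup' (tau : {ffun coord -> rat}) (htau : forall j, coord_dom lam j (ratr (tau j))) m :=
  hup (tau, m) htau.
have hlow' c a m := hlow (c, a, m).
have Zgt0 N : (n <= N)%N -> (0 < N)%N ->
    0 < partition_function f (k N) (fun s v => xi N s v w) h beta N.
  move=> nN N0; rewrite (partition_functionE k_sum (fun N s v => xi N s v w))//.
  rewrite (bigD1 [tuple of nseq N true])//= ltr_wpDr ?expR_gt0//.
  by apply: sumr_ge0 => t _; exact: expR_ge0.
set l := (_ - _)%E.
have value (x : S -> R) (y : 'I_n -> R) : domain (@inside n S) (budget p) (coord_rate p lam) (glue x y) ->
    ((beta * f x + beta * h * \sum_(i < n) y i)%:E + rate_sum p lam x y)%E =
    (- energy f h beta (glue x y) + \sum_j fine (coord_rate p lam j (glue x y j)))%:E.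
  move=> D; rewrite rate_sum_coord (eq_bigr _ (fun j _ => Dom_fin p_gt0 D j)) sumEFin -EFinD.
  by congr (_%:E); rewrite /energy opprK.
have glueE (z : coord -> R) : z = glue (fun s => z (inl s)) (fun i => z (inr i)).
  by apply/funext => -[].
apply: ereal_cvg_between => c.
- move=> lc.
  have [c1 lc1 c1c] := ereal_real_between lc.
  have := @partition_upper R n S k p k_sum k_lim p_gt0 lam lam_mgf _ hup'
    f h beta f_cont c1 c c1c.
  case.
    move=> z Dz; apply: le_lt_trans lc1.
    rewrite (eq_bigr _ (fun j _ => Dom_fin p_gt0 Dz j)) sumEFin -EFinB.
    have -> : energy f h beta z + ln 2 - \sum_j fine (coord_rate p lam j (z j)) =
      ln 2 - (- energy f h beta z + \sum_j fine (coord_rate p lam j (z j))) by ring.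
    rewrite EFinB; apply: leeB => //; apply: ereal_inf_lbound.
    exists (fun s => z (inl s), fun i => z (inr i)); last by rewrite value -?glueE.
    by apply/domain_rate; rewrite -glueE.
  move=> N1 _ HN1; exists (maxn N1 (maxn n 1)) => // N.
  rewrite /= !geq_max => /and3P[h1 h2 h3].
  have := HN1 N h1 => hN.
  rewrite -(ler_pM2l (_ : 0 < N%:R)) ?ltr0n// mulrA divff ?mul1r ?pnatr_eq0 -?lt0n//.
  by rewrite -ler_expR lnK ?posrE ?Zgt0.
move=> cl.
have [z Dz hz] : exists2 z : coord -> R, domain (@inside n S) (budget p) (coord_rate p lam) z &
    c < energy f h beta z + ln 2 - \sum_j fine (coord_rate p lam j (z j)).
  have : (ereal_inf [set ((beta * f xy.1 + beta * h * \sum_(i < n) xy.2 i)%:E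
             + rate_sum p lam xy.1 xy.2)%E
       | xy in rate_domain p lam] < (ln 2 - c)%:E)%E.
    move: cl; rewrite /l; case: ereal_inf => [I| |]//; last by rewrite ltNyr.
    by rewrite -EFinB !lte_fin; lra.
  move=> /ereal_inf_lt[_ [[x y] Dxy <-]] /=.
  have D := (domain_rate p lam x y).2 Dxy.
  rewrite value// lte_fin => hv; exists (glue x y) => //; lra.
have := @partition_lower R n S k p k_sum k_lim p_gt0 lam lam_mgf _ T P xi xi_law w
  hup' hlow' f h beta f_cont z c Dz hz.
move=> [N1 _ HN1]; exists (maxn N1 (maxn n 1)) => // N.
rewrite /= !geq_max => /and3P[h1 h2 h3].
have := HN1 N h1 => hN.
rewrite -(ler_pM2l (_ : 0 < N%:R)) ?ltr0n// mulrA divff ?mul1r ?pnatr_eq0 -?lt0n//.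
by rewrite -ler_expR lnK ?posrE ?Zgt0.
Qed.
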